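(* Assume $N+1>d$. Up to a change of probability space, the sample means and covariances $(m_n,p_n,\widehat m_n,\widehat p_n)_{n\ge0}$ of the Ensemble Kalman filter satisfy, for every $n\ge0$, the updating equations $$\widehat{m}_{n}=m_n+K(p_n)(Y_n-B m_n) +\frac{1}{\sqrt{N+1}}K(p_n)R_0^{1/2}\,\widehat{z}^{\,0}_n,\qquad \widehat{p}_n=\widehat{A}(p_n)\, p_n+\frac{1}{\sqrt{N}}\, \widehat{\Delta}^N_{n},$$ and the prediction equations $$m_{n+1}=A\,\widehat{m}_{n}+\frac{1}{\sqrt{N+1}}R^{1/2}z^{0}_{n+1},\qquad p_{n+1}=A\,\widehat{p}_{n}A'+R+\frac{1}{\sqrt{N}}\Delta^N_{n+1},$$ where $$\Delta^N_{n+1}:=R^{1/2}H^N_{n+1}R^{1/2}+2\left(R^{1/2}G_{n+1}(A\widehat{p}_{n}A')^{1/2}\right)_{\rm sym},$$ $$\widehat{\Delta}^N_{n}:=\widehat{R}(p_n)^{1/2}\widehat{H}^N_{n}\widehat{R}(p_n)^{1/2}+2\left(\widehat{R}(p_n)^{1/2}\,\widehat{G}_n\left(\widehat{A}(p_n)p_n\widehat{A}(p_n)'\right)^{1/2}\right)_{\rm sym}.$$ That is: on a probability space carrying a copy of $(X_n,Y_n)_{n\ge0}$, a pair $(m_0,p_0)$ with the law of the initial sample mean and covariance of the filter, and the Gaussian variables $(Z_{n+1},\widehat Z_n,z^0_{n+1},\widehat z^{\,0}_n)_{n\ge0}$ of the context, all these being independent, the process defined recursively from $(m_0,p_0)$,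 for $n\ge0$, by $$\widehat{m}_{n}=m_n+K(p_n)(Y_n-B m_n) +\frac{1}{\sqrt{N+1}}K(p_n)R_0^{1/2}\,\widehat{z}^{\,0}_n,\qquad \widehat{p}_n=\widehat{A}(p_n)\, p_n+\frac{1}{\sqrt{N}}\, \widehat{\Delta}^N_{n},$$ $$m_{n+1}=A\,\widehat{m}_{n}+\frac{1}{\sqrt{N+1}}R^{1/2}z^{0}_{n+1},\qquad p_{n+1}=A\,\widehat{p}_{n}A'+R+\frac{1}{\sqrt{N}}\Delta^N_{n+1}$$ has, jointly with $(X_n,Y_n)_{n\ge 0}$, the same law as the process $(m_n,p_n,\widehat m_n,\widehat p_n)_{n\ge0}$ of the Ensemble Kalman filter.
   Context: $M'$ is the transpose, $I$ the identity, $M_{\rm sym}=(M+M')/2$, and $M^{1/2}$ the symmetric positive semi-definite square root of a positive semi-definite $M$. Model. Fix $d,d_0\ge1$, $A\in\mathbb{R}^{d\times d}$, $B\in\mathbb{R}^{d_0\times d}$, and symmetric positive definite $R\in\mathbb{R}^{d\times d}$, $R_0\in\mathbb{R}^{d_0\times d_0}$, $P_0\in\mathbb{R}^{d\times d}$. The signal-observation process is $X_{n+1}=AX_n+W_n$, $Y_n=BX_n+V_n$, $n\ge0$, where $W_n\sim\mathcal N(0,R)$, $V_n\sim\mathcal N(0,R_0)$ are independent sequences of independent variables, independent of the Gaussian variable $X_0$ which has covariance $P_0$. Put $S:=B'R_0^{-1}B$. For positive semi-definite $P$ set $K(P):=PB'(BPB'+R_0)^{-1}$, $\widehat A(P):=I-K(P)B=(I+PS)^{-1}$,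 $\widehat R(P):=K(P)R_0K(P)'$. Ensemble Kalman filter. Let $\xi_0^i$, $1\le i\le N+1$, be independent copies of $X_0$ and let $\mathcal W_n^i\sim\mathcal N(0,R)$, $\mathcal V^i_n\sim\mathcal N(0,R_0)$ be independent, all independent of each other and of $(X_n,Y_n)_{n\ge0}$. Define for $n\ge 0$, $1\le i\le N+1$ $$\widehat\xi_n^i=\xi_n^i+K(p_n)\big(Y_n-(B\xi_n^i+\mathcal V_n^i)\big),\qquad \xi_{n+1}^i=A\widehat\xi_n^i+\mathcal W_{n+1}^i,$$ where $m_n=\frac1{N+1}\sum_i\xi_n^i$, $p_n=\frac1N\sum_{i}(\xi_n^i-m_n)(\xi_n^i-m_n)'$, $\widehat m_n=\frac1{N+1}\sum_i\widehat\xi_n^i$, $\widehat p_n=\frac1N\sum_{i}(\widehat\xi_n^i-\widehat m_n)(\widehat\xi_n^i-\widehat m_n)'$, sums over $1\le i\le N+1$. Gaussian matrices. $Z_n$ and $\widehat Z_n$ are independent $d\times N$ random matrices with i.i.d. $\mathcal N(0,1)$ entries; $z_n^0\in\mathbb{R}^d$, $\widehat z_n^{\,0}\in\mathbb{R}^{d_0}$ are independent standard Gaussian vectors, independent of $(Z_n,\widehat Z_n)_n$. Set $H_n^N:=N^{-1/2}(Z_nZ_n'-NI)$, $G_n:=$ the $d\times d$ matrix formed by the first $d$ columns of $Z_n$, and define $\widehat H^N_n,\widehat G_n$ in the same way from $\widehat Z_n$. *)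

(* Defs.v *)
From HB Require Import structures.
From mathcomp Require Import all_boot all_order all_algebra finmap.
From mathcomp Require Import all_classical all_reals all_analysis.

Set Implicit Arguments.
Unset Strict Implicit.
Unset Printing Implicit Defensive.

Import Order.TTheory GRing.Theory Num.Theory.

Local Open Scope classical_set_scope.
Local Open Scope ring_scope.

Section Matrices.
Variable F : realType.

Definition psdmx n (M : 'M[F]_n) : Prop :=
  M^T = M /\ forall v : 'cV[F]_n, 0 <= (v^T *m M *m v) 0 0.

Definition posdefmx n (M : 'M[F]_n) : Prop :=
  M^T = M /\ forall v : 'cV[F]_n, v != 0 -> 0 < (v^T *m M *m v) 0 0.

Definition symmx n (M : 'M[F]_n) : 'M[F]_n := 2^-1 *: (M + M^T).

(* For positive semi-definite [M] the set below is a singleton; the value is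
   the junk matrix 0 when [M] is not positive semi-definite. *)
Definition sqrtmx n (M : 'M[F]_n) : 'M[F]_n :=
  xget 0 [set Q : 'M[F]_n | psdmx Q /\ Q *m Q = M].

End Matrices.

Definition mx_display : measure_display -> measure_display.
Proof. by []. Qed.

Section MeasurableMatrix.
Context d (T : measurableType d) (m n : nat).

Definition mx_measurable : set (set 'M[T]_(m, n)) :=
  <<s \bigcup_(ij in [set: 'I_m * 'I_n])
        preimage_set_system setT (fun M : 'M[T]_(m, n) => M ij.1 ij.2) measurable >>.

Let mx_measurable0 : mx_measurable set0.
Proof. exact: sigma_algebra0. Qed.

Let mx_measurableC A : mx_measurable A -> mx_measurable (~` A).
Proof. exact: sigma_algebraC. Qed.

Let mx_measurable_bigcup (E : (set 'M[T]_(m, n))^nat) :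
  (forall i, mx_measurable (E i)) -> mx_measurable (\bigcup_i E i).
Proof. exact: sigma_algebra_bigcup. Qed.

HB.instance Definition _ := @isMeasurable.Build (mx_display d)
  'M[T]_(m, n) mx_measurable mx_measurable0 mx_measurableC mx_measurable_bigcup.

End MeasurableMatrix.

Definition seq_space d (E : measurableType d) : Type :=
  g_sigma_algebraType (\bigcup_(n in [set: nat])
    preimage_set_system setT (fun x : nat -> E => x n) measurable).

HB.instance Definition _ d (E : measurableType d) :=
  Measurable.on (seq_space E).

Definition same_law (F : realType) d1 d2 d (O1 : measurableType d1)
    (O2 : measurableType d2) (E : measurableType d)
    (P1 : probability O1 F) (P2 : probability O2 F)
    (X1 : O1 -> E) (X2 : O2 -> E) : Prop :=
  [/\ measurable_fun setT X1, measurable_fun setT X2 &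
      forall C : set E, measurable C ->
        pushforward P1 X1 C = pushforward P2 X2 C].

Section Independence.
Context (F : realType) d (O : measurableType d) (P : probability O F).

Definition mutually_independent (I : choiceType) (G : I -> set (set O)) :
    Prop :=
  forall (J : {fset I}) (E : I -> set O),
    (forall i, i \in J -> G i (E i)) ->
    P (\bigcap_(i in [set` J]) E i) = (\prod_(i <- J) P (E i))%E.

End Independence.

Definition sum_fam (I J S : Type) (G : I -> S) (H : J -> S) (k : I + J) : S :=
  match k with inl i => G i | inr j => H j end.

Notation "G \+fam H" := (sum_fam G H) (at level 52, left associativity).

Notation sigma_of X := (g_sigma_algebra_preimage X).

Section Gaussian.
Context (F : realType) d (O : measurableType d) (P : probability O F).

Definition std_gaussian m n (Z : O -> 'M[F]_(m, n)) : Prop :=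
  [/\ forall i j, measurable_fun setT (fun w => Z w i j),
      forall i j (C : set F), measurable C ->
        pushforward P (fun w => Z w i j) C = normal_prob 0 1 C &
      mutually_independent P
        (fun ij : 'I_m * 'I_n => sigma_of (fun w => Z w ij.1 ij.2))].

(* N(mu, C). When [C] is positive definite, [Z] is necessarily C^{-1/2}(X - mu),
   so asking for it on the space of [X] is no restriction. *)
Definition gaussian n (X : O -> 'cV[F]_n) (mu : 'cV[F]_n) (C : 'M[F]_n) :
    Prop :=
  exists2 Z : O -> 'cV[F]_n, std_gaussian Z &
    forall w, X w = mu + sqrtmx C *m Z w.

End Gaussian.

Section Kalman.
Context (F : realType) (d d0 : nat) (B : 'M[F]_(d0, d)) (R0 : 'M[F]_d0).
Implicit Types P : 'M[F]_d.

Definition gain P : 'M[F]_(d, d0) := P *m B^T *m invmx (B *m P *m B^T + R0).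

Definition Ahat P : 'M[F]_d := 1%:M - gain P *m B.

Definition Rhat P : 'M[F]_d := gain P *m R0 *m (gain P)^T.

(* The second expression for [Ahat], with S = B' R0^-1 B. *)
Lemma Ahat_invE P : R0 \in unitmx -> B *m P *m B^T + R0 \in unitmx ->
  Ahat P = invmx (1%:M + P *m (B^T *m invmx R0 *m B)).
Proof.
move=> uR0 uS; set S := B^T *m _ *m B; set M := 1%:M + _.
have gE : gain P *m (B *m P *m B^T) = P *m B^T - gain P *m R0.
  by apply/eqP; rewrite eq_sym subr_eq -mulmxDr mulmxKV.
have AM : Ahat P *m M = 1%:M.
  rewrite /Ahat /M mulmxDr mulmx1 mulmxBl mul1mx.
  have -> : gain P *m B *m (P *m S) = P *m S - gain P *m B.
    rewrite /S !mulmxA -(mulmxA _ B P) -(mulmxA _ (B *m P)) gE.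
    by rewrite !mulmxBl -!mulmxA (mulmxA R0) mulmxV// mul1mx.
  by rewrite subKr subrK.
have [_ uM] := mulmx1_unit AM.
by rewrite -[LHS](mulmxK uM) AM mul1mx.
Qed.

End Kalman.

Section SampleStatistics.
Context (F : realType) (d N : nat).

Definition sample_mean (x : 'I_N.+1 -> 'cV[F]_d) : 'cV[F]_d :=
  N.+1%:R^-1 *: \sum_i x i.

Definition sample_cov (x : 'I_N.+1 -> 'cV[F]_d) : 'M[F]_d :=
  N%:R^-1 *: \sum_i (x i - sample_mean x) *m (x i - sample_mean x)^T.

End SampleStatistics.

Section Fluctuations.
Context (F : realType) (d N : nat) (dN : (d <= N)%N).

Definition Hmx (Z : 'M[F]_(d, N)) : 'M[F]_d :=
  (Num.sqrt N%:R)^-1 *: (Z *m Z^T - N%:R%:M).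

Definition Gmx (Z : 'M[F]_(d, N)) : 'M[F]_d := colsub (widen_ord dN) Z.

(* The common shape of Delta_{n+1}, with [C] = R and [D] = A phat_n A', and of
   hat Delta_n, with [C] = Rhat(p_n) and [D] = Ahat(p_n) p_n Ahat(p_n)'. *)
Definition Delta (C D : 'M[F]_d) (Z : 'M[F]_(d, N)) : 'M[F]_d :=
  sqrtmx C *m Hmx Z *m sqrtmx C +
  2 *: symmx (sqrtmx C *m Gmx Z *m sqrtmx D).

End Fluctuations.

Record signal_observation (F : realType) (d d0 : nat)
    (A : 'M[F]_d) (B : 'M[F]_(d0, d)) (R : 'M[F]_d) (R0 : 'M[F]_d0)
    (P0 : 'M[F]_d) dO (O : measurableType dO) (P : probability O F)
    (X : nat -> O -> 'cV[F]_d) (Y : nat -> O -> 'cV[F]_d0)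
    (W : nat -> O -> 'cV[F]_d) (V : nat -> O -> 'cV[F]_d0) : Prop := {
  (* the mean of the initial condition is arbitrary *)
  so_init : exists mu, gaussian P (X 0%N) mu P0 ;
  so_W : forall n, gaussian P (W n) 0 R ;
  so_V : forall n, gaussian P (V n) 0 R0 ;
  so_indep : mutually_independent P
    ((fun _ : unit => sigma_of (X 0%N)) \+fam
     (fun n : nat => sigma_of (W n)) \+fam
     (fun n : nat => sigma_of (V n))) ;
  so_X : forall n w, X n.+1 w = A *m X n w + W n w ;
  so_Y : forall n w, Y n w = B *m X n w + V n w }.

Definition path2 (F : realType) (d d0 : nat) (O : Type)
    (X : nat -> O -> 'cV[F]_d) (Y : nat -> O -> 'cV[F]_d0) (w : O) :
    seq_space ('cV[F]_d * 'cV[F]_d0)%type :=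
  fun n => (X n w, Y n w).

(* [xi n i] is the predicted particle, [xih n i] the updated (hatted) one. The
   noise [cW] is used from time 1 on. *)
Record enkf (F : realType) (d d0 N : nat)
    (A : 'M[F]_d) (B : 'M[F]_(d0, d)) (R : 'M[F]_d) (R0 : 'M[F]_d0)
    dO (O : measurableType dO) (P : probability O F)
    (X : nat -> O -> 'cV[F]_d) (Y : nat -> O -> 'cV[F]_d0)
    (xi xih : nat -> 'I_N.+1 -> O -> 'cV[F]_d)
    (cW : nat -> 'I_N.+1 -> O -> 'cV[F]_d)
    (cV : nat -> 'I_N.+1 -> O -> 'cV[F]_d0) : Prop := {
  enkf_init : forall i, same_law P P (xi 0%N i) (X 0%N) ;
  enkf_W : forall n i, gaussian P (cW n.+1 i) 0 R ;
  enkf_V : forall n i, gaussian P (cV n i) 0 R0 ;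
  enkf_indep : mutually_independent P
    ((fun _ : unit => sigma_of (path2 X Y)) \+fam
     (fun i : 'I_N.+1 => sigma_of (xi 0%N i)) \+fam
     (fun ni : nat * 'I_N.+1 => sigma_of (cW ni.1.+1 ni.2)) \+fam
     (fun ni : nat * 'I_N.+1 => sigma_of (cV ni.1 ni.2))) ;
  enkf_update : forall n i w,
    xih n i w = xi n i w +
      gain B R0 (sample_cov (fun j => xi n j w)) *m
        (Y n w - (B *m xi n i w + cV n i w)) ;
  enkf_predict : forall n i w,
    xi n.+1 i w = A *m xih n i w + cW n.+1 i w }.

(* [Z] and [z] are used from time 1 on; their values at time 0 are irrelevant. *)
Record gaussian_inputs (F : realType) (d d0 N : nat)
    dO (O : measurableType dO) (P : probability O F)
    (X : nat -> O -> 'cV[F]_d) (Y : nat -> O -> 'cV[F]_d0)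
    (m0 : O -> 'cV[F]_d) (p0 : O -> 'M[F]_d)
    (Z Zh : nat -> O -> 'M[F]_(d, N))
    (z : nat -> O -> 'cV[F]_d) (zh : nat -> O -> 'cV[F]_d0) : Prop := {
  gi_Z : forall n, std_gaussian P (Z n.+1) ;
  gi_Zh : forall n, std_gaussian P (Zh n) ;
  gi_z : forall n, std_gaussian P (z n.+1) ;
  gi_zh : forall n, std_gaussian P (zh n) ;
  gi_indep : mutually_independent P
    ((fun _ : unit => sigma_of (path2 X Y)) \+fam
     (fun _ : unit => sigma_of (fun w => (m0 w, p0 w))) \+fam
     (fun n : nat => sigma_of (Z n.+1)) \+fam
     (fun n : nat => sigma_of (Zh n)) \+fam
     (fun n : nat => sigma_of (z n.+1)) \+fam
     (fun n : nat => sigma_of (zh n))) }.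

Record mean_cov_recursion (F : realType) (d d0 N : nat) (dN : (d <= N)%N)
    (A : 'M[F]_d) (B : 'M[F]_(d0, d)) (R : 'M[F]_d) (R0 : 'M[F]_d0) (O : Type)
    (Y : nat -> O -> 'cV[F]_d0)
    (Z Zh : nat -> O -> 'M[F]_(d, N))
    (z : nat -> O -> 'cV[F]_d) (zh : nat -> O -> 'cV[F]_d0)
    (m mh : nat -> O -> 'cV[F]_d) (p ph : nat -> O -> 'M[F]_d) : Prop := {
  mcr_mh : forall n w,
    mh n w = m n w + gain B R0 (p n w) *m (Y n w - B *m m n w) +
      (Num.sqrt N.+1%:R)^-1 *: (gain B R0 (p n w) *m sqrtmx R0 *m zh n w) ;
  mcr_ph : forall n w,
    ph n w = Ahat B R0 (p n w) *m p n w +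
      (Num.sqrt N%:R)^-1 *:
        Delta dN (Rhat B R0 (p n w))
          (Ahat B R0 (p n w) *m p n w *m (Ahat B R0 (p n w))^T) (Zh n w) ;
  mcr_m : forall n w,
    m n.+1 w = A *m mh n w +
      (Num.sqrt N.+1%:R)^-1 *: (sqrtmx R *m z n.+1 w) ;
  mcr_p : forall n w,
    p n.+1 w = A *m ph n w *m A^T + R +
      (Num.sqrt N%:R)^-1 *: Delta dN R (A *m ph n w *m A^T) (Z n.+1 w) }.

Definition path6 (F : realType) (d d0 : nat) (O : Type)
    (X : nat -> O -> 'cV[F]_d) (Y : nat -> O -> 'cV[F]_d0)
    (m : nat -> O -> 'cV[F]_d) (p : nat -> O -> 'M[F]_d)
    (mh : nat -> O -> 'cV[F]_d) (ph : nat -> O -> 'M[F]_d) (w : O) :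
    seq_space ('cV[F]_d * 'cV[F]_d0 * 'cV[F]_d * 'M[F]_d * 'cV[F]_d * 'M[F]_d)%type :=
  fun n => (X n w, Y n w, m n w, p n w, mh n w, ph n w).

(* Main.v *)
(* Each step of the filter maps the d x (N+1) matrix x of particles to
   W = L x + b 1' + M V, where V is a standard Gaussian matrix independent of
   the past and L, b, M depend only on the sample mean m, the sample covariance p of
   x and on the observation.  The point is that, given x, the law of the sample
   mean and covariance of W depends on x only through m and p.  The rows 1' and
   L (x - m 1') have the same Gram matrix as the rows sqrt(N+1) e_1' and
   [0 | sqrt(N) (L p L')^(1/2) J] with J = [I_d | 0] (this is where d <= N is
   used), hence an isometry E depending on x maps the former to the latter.  As
   E preserves the sample statistics up to this change of coordinates, and V E
   has the law of V, the pair (mean, covariance) of W has the law of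
   L m + b + (N+1)^(-1/2) v_0 and of the Gram matrix, divided by N, of
   sqrt(N) (L p L')^(1/2) J + U, where [v_0 | U] = M V E; expanding this Gram
   matrix gives the Delta terms.  Two linear images of standard Gaussian vectors
   with the same covariance have the same law, because an isometry carries one
   coefficient matrix to the other and isometries are products of plane rotations
   and sign changes, which preserve the Gaussian law.  Since the past enters only
   through independent inputs, the joint laws of the observations and of the
   sample statistics agree by induction on the number of half-steps. *)
From HB Require Import structures.
Require Import Defs.
From mathcomp Require Import all_boot all_order all_algebra finmap.
From mathcomp Require Import all_classical all_reals all_analysis.
From mathcomp Require Import measurable_realfun charge.
From mathcomp Require Import ring lra.

Set Implicit Arguments.
Unset Strict Implicit.
Unset Printing Implicit Defensive.

Import Order.TTheory GRing.Theory Num.Theory.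
Import numFieldNormedType.Exports.

Local Open Scope classical_set_scope.
Local Open Scope ring_scope.

(** * Isometries generated by plane rotations *)

(** The isometry E comes from an existence statement, and no measurability in x is claimed for it.
    This is harmless: the kernel identity is proved for one frozen x at a time, and only the
    resulting probability, a function of the mean and covariance of x, is integrated over the law of
    x. Measurability is then asked of the explicit half-step maps. These contain [sqrtmx], which is
    defined by choice; it is recovered as the limit of an explicit iteration, which also gives the
    existence of the square root without spectral decomposition. In an update the ensemble uses d0
    (N+1) Gaussian inputs and the recursion d0 + d N, hence the comparison by covariances on a
    product space. The whole path of (X, Y) is carried as a parameter of every half-step: it is
    independent of the filter noises, so fixing all of it, future included, leaves their law
    unchanged. The argument starts from the ensemble because p is known pointwise to be positive
    semi-definite only there, and the identity Ahat p Ahat' + Rhat = Ahat p relies on this. *)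

Section Isometries.
Variable F : realType.
Implicit Types n : nat.

Definition flipmx n (i : 'I_n) : 'M[F]_n := 1%:M - 2 *: delta_mx i i.

Definition rotmx n (i j : 'I_n) (c s : F) : 'M[F]_n :=
  \matrix_(a, b) if a == i then c *+ (b == i) + s *+ (b == j)
                 else if a == j then - s *+ (b == i) + c *+ (b == j)
                 else (a == b)%:R.

(* Rotations with [c = 0] are left out: the change of variables behind
   [integral_rotation] divides by [c]. *)
Inductive isomx n : 'M[F]_n -> Prop :=
| isomx1 : isomx 1%:M
| isomx_flip i T : isomx T -> isomx (flipmx i *m T)
| isomx_rot i j c s T : i != j -> c != 0 -> c ^+ 2 + s ^+ 2 = 1 ->
    isomx T -> isomx (rotmx i j c s *m T).

Lemma isomxM n (S T : 'M[F]_n) : isomx S -> isomx T -> isomx (S *m T).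
Proof.
move=> + hT; elim=> [|i S' _ IH|i j c s S' ij c0 cs _ IH].
- by rewrite mul1mx.
- by rewrite -mulmxA; exact: isomx_flip.
- by rewrite -mulmxA; exact: isomx_rot.
Qed.

Lemma flipmxE n (i : 'I_n) m (M : 'M[F]_(n, m)) a b :
  (flipmx i *m M) a b = if a == i then - M a b else M a b.
Proof.
rewrite mulmxBl mul1mx -scalemxAl !mxE (bigD1 i)//= big1 ?addr0; last first.
  by move=> k ki; rewrite !mxE (negbTE ki) andbF mul0r.
rewrite mxE eqxx andbT; case: eqP => [->|_]; last by rewrite mul0r mulr0 subr0.
by rewrite mul1r; ring.
Qed.

Lemma rotmxE n (i j : 'I_n) c s m (M : 'M[F]_(n, m)) a b : i != j ->
  (rotmx i j c s *m M) a b =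
    if a == i then c * M i b + s * M j b
    else if a == j then - s * M i b + c * M j b else M a b.
Proof.
move=> ij; rewrite !mxE.
have aux (x y : F) : \sum_k (x *+ (k == i) + y *+ (k == j)) * M k b =
    x * M i b + y * M j b.
  under eq_bigr do rewrite mulrDl; rewrite big_split/=; congr (_ + _).
    rewrite (bigD1 i)//= eqxx big1 ?addr0// => k ki.
    by rewrite (negbTE ki) mul0r.
  rewrite (bigD1 j)//= eqxx big1 ?addr0// => k ki.
  by rewrite (negbTE ki) mul0r.
have [ai|ai] := eqVneq a i.
  by rewrite -aux; apply: eq_bigr => k _; rewrite !mxE ai eqxx.
have [aj|aj] := eqVneq a j.
  by rewrite -aux; apply: eq_bigr => k _; rewrite !mxE aj eq_sym (negbTE ij) eqxx.
rewrite (bigD1 a)//= big1 ?addr0.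
  by rewrite !mxE (negbTE ai) (negbTE aj) eqxx mul1r.
by move=> k ka; rewrite !mxE (negbTE ai) (negbTE aj) eq_sym (negbTE ka) mul0r.
Qed.

Lemma tr_flipmx n (i : 'I_n) : (flipmx i)^T = flipmx i.
Proof. by rewrite /flipmx linearB linearZ/= trmx1 trmx_delta. Qed.

Lemma tr_rotmx n (i j : 'I_n) c s : i != j ->
  (rotmx i j c s)^T = rotmx i j c (- s).
Proof.
move=> ij; apply/matrixP => a b; rewrite !mxE.
have ji : (j == i) = false by rewrite eq_sym (negbTE ij).
have [->|ai] := eqVneq a i; have [->|bi] := eqVneq b i;
  rewrite ?eqxx ?(negbTE ij) ?mulr0n ?mulr1n ?addr0 //.
- by case: eqVneq => _; rewrite ?mulr0n ?mulr1n ?add0r.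
- by case: eqVneq => _; rewrite ?mulr0n ?mulr1n ?add0r ?opprK ?(negbTE ai).
- case: (eqVneq b j) => [bj|bj]; case: (eqVneq a j) => [aj|aj];
    rewrite ?mulr0n ?mulr1n ?add0r//.
  + by rewrite bj (negbTE aj).
  + by rewrite aj (negbTE bj).
  + by rewrite eq_sym.
Qed.

Lemma isomx_tr n (T : 'M[F]_n) : isomx T -> isomx T^T.
Proof.
elim=> [|i S _ IH|i j c s S ij c0 cs _ IH].
- by rewrite trmx1; exact: isomx1.
- rewrite trmx_mul tr_flipmx; apply: isomxM => //.
  by rewrite -(mulmx1 (flipmx i)); apply: isomx_flip; exact: isomx1.
- rewrite trmx_mul tr_rotmx//; apply: isomxM => //.
  rewrite -(mulmx1 (rotmx _ _ _ _)); apply: isomx_rot; rewrite ?sqrrN//.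
  exact: isomx1.
Qed.

Lemma isomx_mul_tr n (T : 'M[F]_n) : isomx T -> T *m T^T = 1%:M.
Proof.
elim=> [|i S _ IH|i j c s S ij c0 cs _ IH].
- by rewrite trmx1 mulmx1.
- rewrite trmx_mul mulmxA -(mulmxA _ S) IH mulmx1 tr_flipmx.
  apply/matrixP => a b; rewrite flipmxE !mxE.
  have [->|ai] := eqVneq a i; last by rewrite andFb mulr0 subr0.
  by rewrite eq_sym andTb; case: eqVneq => _; rewrite ?mulr1n ?mulr0n; ring.
- rewrite trmx_mul mulmxA -(mulmxA _ S) IH mulmx1 tr_rotmx//.
  apply/matrixP => a b; rewrite rotmxE// !mxE.
  have ji : (j == i) = false by rewrite eq_sym (negbTE ij).
  rewrite !eqxx ji.
  have [->|ai] := eqVneq a i.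
    rewrite [i == b]eq_sym; have [bi|bi] := eqVneq b i.
      by rewrite bi (negbTE ij) ?mulr1n ?mulr0n -cs; ring.
    by case: eqVneq => _; rewrite ?mulr1n ?mulr0n; ring.
  have [aj|aj] := eqVneq a j; last by [].
  rewrite aj; have [bi|bi] := eqVneq b i.
    by rewrite bi ji (negbTE ij) ?mulr1n ?mulr0n; ring.
  rewrite [j == b]eq_sym; case: eqVneq => _; rewrite ?mulr1n ?mulr0n -?cs; ring.
Qed.

Lemma isomx_tr_mul n (T : 'M[F]_n) : isomx T -> T^T *m T = 1%:M.
Proof. by move=> /isomx_tr/isomx_mul_tr; rewrite trmxK. Qed.

Lemma sqr_norm_gt0 n (v : 'cV[F]_n) : v != 0 -> 0 < (v^T *m v) 0 0.
Proof.
move=> v0; have /cV0Pn[i vi] := v0.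
rewrite mxE (bigD1 i)//= ltr_wpDr//.
  by apply: sumr_ge0 => k _; rewrite mxE -expr2 sqr_ge0.
by rewrite mxE -expr2 lt0r sqrf_eq0 vi sqr_ge0.
Qed.

(** Givens rotations in the planes (i, j) clear the other entries one at a time. The pivot x is
    replaced by r = sqrt(x^2 + y^2), so it stays nonzero, and so does the cosine x / r, as
    [isomx_rot] demands. *)
Lemma isomx_pivot n (v : 'cV[F]_n) i : v i 0 != 0 ->
  exists2 T, isomx T & exists2 r, r != 0 & T *m v = r *: delta_mx i 0.
Proof.
move=> vi.
have H (s : seq 'I_n) : i \notin s -> exists2 T, isomx T &
    (T *m v) i 0 != 0 /\ forall j, j \in s -> (T *m v) j 0 = 0.
  elim: s => [|j s IH]; first by exists 1%:M; [exact: isomx1|rewrite mul1mx].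
  rewrite inE negb_or => /andP[ij /IH[T hT [Ti Ts]]].
  set x := (T *m v) i 0 in Ti; set y := (T *m v) j 0.
  have xy0 : 0 < x ^+ 2 + y ^+ 2 by rewrite ltr_pwDl ?sqr_ge0// lt0r sqrf_eq0 Ti sqr_ge0.
  pose r := Num.sqrt (x ^+ 2 + y ^+ 2).
  have r0 : r != 0 by rewrite gt_eqF// sqrtr_gt0.
  have rE : r ^+ 2 = x ^+ 2 + y ^+ 2 by rewrite sqr_sqrtr// ltW.
  exists (rotmx i j (x / r) (y / r) *m T).
    apply: isomx_rot => //; first by rewrite mulf_neq0// invr_eq0.
    by rewrite !expr_div_n -mulrDl -rE divff// sqrf_eq0.
  split.
    rewrite -mulmxA rotmxE// eqxx -/x -/y.
    have -> : x / r * x + y / r * y = r by apply: (mulIf r0); rewrite -expr2 rE; field.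
    exact: r0.
  move=> k; rewrite inE -mulmxA rotmxE// -/x -/y => /orP[/eqP ->|ks].
    by rewrite eq_sym (negbTE ij) eqxx; field.
  have [ki|ki] := eqVneq k i.
    by move: (Ts _ ks); rewrite ki => h; move: Ti; rewrite /x h eqxx.
  by case: eqP => [kj|_]; [subst k; rewrite /y Ts// mulr0 addr0|rewrite Ts];
    rewrite // /x; field.
have [|T hT [Ti Ts]] := H (rem i (enum 'I_n)).
  by rewrite mem_rem_uniqF// enum_uniq.
exists T => //; exists ((T *m v) i 0) => //.
apply/matrixP => k l; rewrite !ord1 [RHS]mxE [delta_mx _ _ _ _]mxE andbT.
have [->|ki] := eqVneq k i; first by rewrite mulr1.
by rewrite mulr0 Ts// mem_rem_uniq ?enum_uniq// inE ki mem_enum.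
Qed.

(** Conjugation by an isometry carrying v to a multiple of e_i turns the reflection along v into the
    flip of coordinate i. *)
Lemma isomx_reflection n (v : 'cV[F]_n) : v != 0 ->
  isomx (1%:M - (2 / (v^T *m v) 0 0) *: (v *m v^T)).
Proof.
move=> v0; have /cV0Pn[i vi] := v0.
have [T hT [r r0 Tv]] := isomx_pivot vi.
have vE : v = r *: (T^T *m delta_mx i 0).
  by rewrite scalemxAr -Tv mulmxA isomx_tr_mul// mul1mx.
have -> : (v^T *m v) 0 0 = r ^+ 2.
  rewrite -{2}(mul1mx v) -(isomx_tr_mul hT) -mulmxA mulmxA -trmx_mul Tv.
  rewrite [(_ *: _)^T]linearZ/= -scalemxAl -scalemxAr trmx_delta mul_delta_mx.
  rewrite scalerA !mxE.
  by rewrite !eqxx mulr1 expr2.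
have -> : 1%:M - 2 / r ^+ 2 *: (v *m v^T) = T^T *m (flipmx i *m T).
  rewrite mulmxBl mul1mx mulmxBr isomx_tr_mul//; congr (_ - _).
  rewrite vE [(_ *: _)^T]linearZ/= -!scalemxAl -!scalemxAr !scalerA.
  congr (_ *: _).
    by field.
  by rewrite trmx_mul trmxK trmx_delta mulmxA -(mulmxA T^T) mul_delta_mx mulmxA.
by apply: isomxM; [exact: isomx_tr|exact: isomx_flip].
Qed.

(* Equal Gram matrices differ by an isometry: align the rows one by one, a
   reflection along the difference of the two current rows fixing the previous
   ones. *)
Lemma isomx_gram k n (M1 M2 : 'M[F]_(k, n)) : M1 *m M1^T = M2 *m M2^T ->
  exists2 T, isomx T & M1 *m T = M2.
Proof.
move=> G.
have H l : exists2 T, isomx T &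
    forall i : 'I_k, (i < l)%N -> row i (M1 *m T) = row i M2.
  elim: l => [|l [T hT IH]]; first by exists 1%:M => //; exact: isomx1.
  have [kl|lk] := leqP k l.
    by exists T => // i _; apply: IH; exact: leq_trans (ltn_ord i) kl.
  set N1 := M1 *m T in IH.
  have GN : N1 *m N1^T = M2 *m M2^T.
    by rewrite /N1 trmx_mul mulmxA -(mulmxA M1) isomx_mul_tr// mulmx1.
  pose j := Ordinal lk; pose v : 'cV[F]_n := (row j N1 - row j M2)^T.
  have [v0|v0] := eqVneq v 0.
    exists T => // i; rewrite ltnS leq_eqVlt => /orP[/eqP il|/IH//].
    have -> : i = j by exact: val_inj.
    by apply/eqP; rewrite -subr_eq0 -trmx_eq0; exact/eqP.
  have rowG (i i' : 'I_k) : row i N1 *m (row i' N1)^T = row i M2 *m (row i' M2)^T.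
    have rr (M : 'M[F]_(k, n)) :
        row i M *m (row i' M)^T = row i (M *m M^T) *m delta_mx i' 0.
      by rewrite tr_row row_mul -mulmxA -colE.
    by rewrite !rr GN.
  pose c := (v^T *m v) 0 0; have c0 : 0 < c := sqr_norm_gt0 v0.
  have hxv (x : 'rV[F]_n) : x *m (1%:M - (2 / c) *: (v *m v^T)) =
      x - (2 / c * (x *m v) 0 0) *: v^T.
    rewrite mulmxBr mulmx1; congr (_ - _); rewrite -scalemxAr -scalerA mulmxA.
    by rewrite [X in X *m _]mx11_scalar mul_scalar_mx.
  exists (T *m (1%:M - (2 / c) *: (v *m v^T))).
    by apply: isomxM => //; exact: isomx_reflection.
  move=> i; rewrite ltnS leq_eqVlt => /orP[/eqP il|il];
    rewrite mulmxA row_mul -/N1 hxv; last first.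
    (* A row already aligned has the same inner product with both rows whose difference is v, by
       equality of the Gram matrices. *)
    suff -> : (row i N1 *m v) 0 0 = 0 by rewrite mulr0 scale0r subr0 IH.
    by rewrite /v linearB/= mulmxBr rowG IH// subrr mxE.
  have -> : i = j by exact: val_inj.
  (* The current row and its target have equal norm, so the component of the current row along v is
     v / 2 and the reflection subtracts exactly v. *)
  have cE : c = 2 * (row j N1 *m v) 0 0.
    rewrite /c {1}/v trmxK mulmxBl [LHS]mxE [X in _ + X]mxE.
    suff -> : (row j M2 *m v) 0 0 = - (row j N1 *m v) 0 0 by ring.
    rewrite /v linearB/= !mulmxBr rowG !mxE opprB; congr (_ - _).
    by apply: eq_bigr => b _; rewrite !mxE mulrC.
  rewrite -mulrA mulrCA -cE mulVf ?gt_eqF// scale1r /v trmxK.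
  by rewrite opprB addrC subrK.
have [T hT TE] := H k; exists T => //.
by apply/row_matrixP => i; exact: TE.
Qed.

End Isometries.

(** * Square roots of positive semi-definite matrices *)

Section PositiveSemidefinite.
Variable F : realType.

Lemma psdmxD n (M P : 'M[F]_n) : psdmx M -> psdmx P -> psdmx (M + P).
Proof.
move=> [sM pM] [sP pP]; split; first by rewrite linearD/= sM sP.
by move=> v; rewrite mulmxDr mulmxDl mxE addr_ge0.
Qed.

Lemma psdmxZ n a (M : 'M[F]_n) : 0 <= a -> psdmx M -> psdmx (a *: M).
Proof.
move=> a0 [sM pM]; split; first by rewrite linearZ/= sM.
by move=> v; rewrite -scalemxAr -scalemxAl mxE mulr_ge0.
Qed.

Lemma psdmx_conj m n (L : 'M[F]_(m, n)) M : psdmx M -> psdmx (L *m M *m L^T).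
Proof.
move=> [sM pM]; split; first by rewrite !trmx_mul trmxK sM mulmxA.
by move=> v; have := pM (L^T *m v); rewrite trmx_mul trmxK !mulmxA.
Qed.

Lemma psdmx1 n : psdmx (1%:M : 'M[F]_n).
Proof.
split; first by rewrite trmx1.
move=> v; rewrite mulmx1 mxE; apply: sumr_ge0 => i _.
by rewrite mxE -expr2 sqr_ge0.
Qed.

Lemma psdmx_gram m n (L : 'M[F]_(m, n)) : psdmx (L *m L^T).
Proof. by rewrite -{1}(mulmx1 L); apply: psdmx_conj; exact: psdmx1. Qed.

Lemma posdef_psd n (M : 'M[F]_n) : posdefmx M -> psdmx M.
Proof.
move=> [sM pM]; split=> // v; have [->|v0] := eqVneq v 0.
  by rewrite mulmx0 mxE.
exact/ltW/pM.
Qed.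

Definition bform n (M : 'M[F]_n) (u w : 'cV[F]_n) : F := (u^T *m M *m w) 0 0.

Lemma bformDr n (M : 'M[F]_n) u w w' :
  bform M u (w + w') = bform M u w + bform M u w'.
Proof. by rewrite /bform mulmxDr mxE. Qed.

Lemma bformZr n (M : 'M[F]_n) a u w : bform M u (a *: w) = a * bform M u w.
Proof. by rewrite /bform -scalemxAr mxE. Qed.

Lemma bformC n (M : 'M[F]_n) u w : M^T = M -> bform M u w = bform M w u.
Proof.
move=> sM; rewrite /bform -[w^T *m M *m u]trmxK [RHS]mxE.
by rewrite !trmx_mul trmxK sM mulmxA.
Qed.


Lemma bformD n (M : 'M[F]_n) (u w : 'cV[F]_n) : M^T = M ->
  bform M (u + w) (u + w) = bform M u u + bform M w w + 2 * bform M u w.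
Proof.
move=> sM; rewrite bformDr (bformC _ u)// (bformC _ w)// !bformDr.
by rewrite (bformC w u)//; ring.
Qed.

Lemma bform_delta n (M : 'M[F]_n) i j :
  bform M (delta_mx i 0) (delta_mx j 0) = M i j.
Proof. by rewrite /bform trmx_delta -rowE -colE !mxE. Qed.

(** The diagonal entries are nonnegative with sum 0, hence vanish; the form at e_j - M_ij e_i is
    then -2 M_ij^2, which must be nonnegative. *)
Lemma psdmx_trace0 n (M : 'M[F]_n) : psdmx M -> \tr M = 0 -> M = 0.
Proof.
move=> [sM pM] t0.
have d0 i : M i i = 0.
  have h : forall j, true -> 0 <= M j j.
    by move=> j _; rewrite -(bform_delta M j j); exact: pM.
  exact: (psumr_eq0P h t0).
apply/matrixP => i j; rewrite mxE.
have : 0 <= bform M (- M i j *: delta_mx i 0 + delta_mx j 0)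
                    (- M i j *: delta_mx i 0 + delta_mx j 0) by exact: pM.
rewrite bformD// bformZr !(bformC (_ *: _))// !bformZr !bform_delta !d0.
rewrite !mulr0 !add0r (_ : M j i = M i j); last by rewrite -[in RHS]sM mxE.
rewrite mulNr -expr2 mulrN oppr_ge0 pmulr_rle0// => h.
by apply/eqP; rewrite -sqrf_eq0 eq_le h sqr_ge0.
Qed.

Lemma gram_eq0 m n (M : 'M[F]_(m, n)) : M *m M^T = 0 -> M = 0.
Proof.
move=> h; apply/matrixP => k l.
have := congr1 (fun A : 'M[F]_m => A k k) h; rewrite !mxE => /eqP.
rewrite psumr_eq0; last by move=> a _; rewrite [_^T _ _]mxE -expr2 sqr_ge0.
move=> /allP/(_ l (mem_index_enum _)) /=.
by rewrite [_^T _ _]mxE -expr2 sqrf_eq0 => /eqP.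
Qed.

(** With D = Q - S one has Q D + D S = Q^2 - S^2 = 0. Multiplying by D and taking traces gives tr(D
    Q D) + tr(D S D) = 0, where both matrices are positive semi-definite, hence zero. Their
    difference is D^3, and for a symmetric D this forces D^2 = 0 and then D = 0. *)
Lemma psdmx_sqrt_unique n (Q S : 'M[F]_n) : psdmx Q -> psdmx S ->
  Q *m Q = S *m S -> Q = S.
Proof.
move=> pQ pS QS; have [D DE] : {D | D = Q - S} by exists (Q - S).
have sD : D^T = D by rewrite DE linearB/= pQ.1 pS.1.
have DQD : psdmx (D *m Q *m D) by rewrite -{2}sD; exact: psdmx_conj.
have DSD : psdmx (D *m S *m D) by rewrite -{2}sD; exact: psdmx_conj.
have E : Q *m D + D *m S = 0.
  by rewrite DE mulmxBr mulmxBl QS addrA subrK subrr.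
have T : \tr (D *m Q *m D) + \tr (D *m S *m D) = 0.
  have : \tr (D *m (Q *m D + D *m S)) = 0 by rewrite E mulmx0 mxtrace0.
  rewrite mulmxDr mxtraceD !mulmxA => <-; congr (_ + _).
  by rewrite mxtrace_mulC mulmxA.
have tge0 (M : 'M[F]_n) : psdmx M -> 0 <= \tr M.
  by move=> [_ pM]; apply: sumr_ge0 => i _; rewrite -(bform_delta M i i); exact: pM.
move: T => /eqP; rewrite paddr_eq0 ?tge0// => /andP[/eqP T1 /eqP T2].
have D3 : D *m D *m D = 0.
  rewrite {2}DE mulmxBr mulmxBl (psdmx_trace0 DQD T1) (psdmx_trace0 DSD T2).
  by rewrite subrr.
have D2 : D *m D = 0.
  by apply: gram_eq0; rewrite trmx_mul !sD mulmxA D3 mul0mx.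
by apply/eqP; rewrite -subr_eq0 -DE; apply/eqP/gram_eq0; rewrite sD.
Qed.

Lemma psdmxX n (X : 'M[F]_n.+1) j : psdmx X -> psdmx (X ^+ j).
Proof.
move=> pX; have sX i : (X ^+ i)^T = X ^+ i.
  elim: i => [|i IH]; first by rewrite expr0 trmx1.
  by rewrite exprS trmx_mul IH pX.1 -[_ *m _]/(_ * _) -exprSr exprS.
rewrite -(odd_double_half j) -addnn addnCA exprD exprD mulrA.
rewrite -[_ * _]/(_ *m _) -[X in _ *m X]sX; apply: psdmx_conj.
by case: odd; rewrite ?expr1 ?expr0//; exact: psdmx1.
Qed.

(** A product of positive semi-definite matrices need not be positive semi-definite; for polynomials
    in a single matrix the question reduces to the signs of the coefficients. *)
Lemma psdmx_horner n (X : 'M[F]_n.+1) (p : {poly F}) : psdmx X ->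
  (forall i, 0 <= p`_i) -> psdmx (horner_mx X p).
Proof.
move=> pX pp; rewrite -[p]coefK poly_def rmorph_sum/=.
apply: (big_ind (@psdmx F n.+1)).
- by rewrite -(scale0r (1%:M)); apply: psdmxZ => //; exact: psdmx1.
- exact: psdmxD.
- move=> i _; rewrite linearZ/= rmorphXn/= horner_mx_X.
  by apply: psdmxZ; [exact: pp|exact: psdmxX].
Qed.

Definition mxcvg m n (S : nat -> 'M[F]_(m, n)) (L : 'M[F]_(m, n)) : Prop :=
  forall i j, S k i j @[k --> \oo] --> L i j.

Lemma mxcvgM m n p (S : nat -> 'M[F]_(m, n)) (T : nat -> 'M[F]_(n, p)) L M :
  mxcvg S L -> mxcvg T M -> mxcvg (fun k => S k *m T k) (L *m M).
Proof.
move=> SL TM i j; under eq_fun do rewrite mxE; rewrite mxE.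
apply: cvg_big => [|l _]; first exact: (@add_continuous F^o).
by apply: cvgM; [exact: SL|exact: TM].
Qed.

Lemma mxcvg_cst m n (L : 'M[F]_(m, n)) : mxcvg (fun=> L) L.
Proof. by move=> i j; exact: cvg_cst. Qed.

Lemma mxcvgD m n (S T : nat -> 'M[F]_(m, n)) L M :
  mxcvg S L -> mxcvg T M -> mxcvg (fun k => S k + T k) (L + M).
Proof.
move=> SL TM i j; under eq_fun do rewrite mxE; rewrite mxE.
by apply: (@cvgD _ F^o).
Qed.

Lemma mxcvgZ m n a (S : nat -> 'M[F]_(m, n)) L :
  mxcvg S L -> mxcvg (fun k => a *: S k) (a *: L).
Proof.
move=> SL i j; under eq_fun do rewrite mxE; rewrite mxE.
by apply: cvgM => //; exact: cvg_cst.
Qed.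

Lemma mxcvg_unique m n (S : nat -> 'M[F]_(m, n)) L M :
  mxcvg S L -> mxcvg S M -> L = M.
Proof.
move=> SL SM; apply/matrixP => i j.
exact: (@cvg_unique F^o _ _ _ _ _ (SL i j) (SM i j)).
Qed.

Lemma psdmx_lim n (S : nat -> 'M[F]_n) (L : 'M[F]_n) :
  (forall k, psdmx (S k)) -> mxcvg S L -> psdmx L.
Proof.
move=> pS SL; split.
  apply: (@mxcvg_unique _ _ (fun k => (S k)^T)); last first.
    by move=> i j; under eq_fun do rewrite (pS _).1; exact: SL.
  by move=> i j; under eq_fun do rewrite mxE; rewrite mxE; exact: SL.
move=> v; have := mxcvgM (mxcvgM (mxcvg_cst (L:=v^T)) SL) (mxcvg_cst (L:=v)).
move=> /(_ 0 0) h; rewrite -(cvg_lim (@Rhausdorff F) h).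
apply: limr_ge; first by apply/cvg_ex; eexists; exact: h.
by near=> k; exact: (pS k).2.
Unshelve. all: by end_near. Qed.

(* For [0 <= X <= 1] the iterates increase to [1 - sqrt(1 - X)]: they and their
   increments are polynomials in [X] with nonnegative coefficients. *)
Fixpoint newton n (X : 'M[F]_n) k : 'M[F]_n :=
  if k is k'.+1 then 2^-1 *: (X + newton X k' *m newton X k') else 0.

Lemma newton_psd n (X : 'M[F]_n) k : psdmx X ->
  psdmx (newton X k) /\ psdmx (newton X k.+1 - newton X k).
Proof.
(* [horner_mx] acts on matrices of nonzero size, so the empty matrix is treated apart. *)
case: n X => [|n] X pX.
  suff h (M : 'M[F]_0) : psdmx M by split; exact: h.
  by rewrite (flatmx0 M) -(flatmx0 1%:M); exact: psdmx1.
pose y := fix y k : {poly F} :=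
  if k is k'.+1 then 2^-1 *: ('X + y k' * y k') else 0.
have yE j : newton X j = horner_mx X (y j).
  elim: j => [|j IH]; first by rewrite rmorph0.
  by rewrite /= IH linearZ/= rmorphD/= horner_mx_X rmorphM.
pose nng (q : {poly F}) := forall i, 0 <= q`_i.
have nngD q r : nng q -> nng r -> nng (q + r).
  by move=> hq hr i; rewrite coefD addr_ge0.
have nngM q r : nng q -> nng r -> nng (q * r).
  by move=> hq hr i; rewrite coefM sumr_ge0// => l _; rewrite mulr_ge0.
have nngZ q : nng q -> nng (2^-1 *: q).
  by move=> hq i; rewrite coefZ mulr_ge0// invr_ge0.
have py j : nng (y j).
  elim: j => [|j IH]; first by move=> i; rewrite coef0.
  by apply/nngZ/nngD; [move=> i; rewrite coefX ler0n|exact: nngM].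
have pdy j : nng (y j.+1 - y j).
  elim: j => [|j IH]; first by rewrite subr0; exact: py.
  have -> : y j.+2 - y j.+1 = 2^-1 *: ((y j.+1 - y j) * (y j.+1 + y j)).
    rewrite [y j.+2]/= [in X in _ - X]/= -scalerBr; congr (_ *: _).
    by rewrite -/(y j.+1); ring.
  by apply: nngZ; apply: nngM => //; exact: nngD.
split; first by rewrite yE; apply: psdmx_horner => //; exact: py.
by rewrite !yE -rmorphB; apply: psdmx_horner => //; exact: pdy.
Qed.

Lemma newton_le1 n (X : 'M[F]_n) k : psdmx X -> psdmx (1%:M - X) ->
  psdmx (1%:M - newton X k).
Proof.
move=> pX p1X; elim: k => [|k IH] /=; first by rewrite subr0; exact: psdmx1.
set Y := newton X k in IH *; have [pY _] := newton_psd k pX.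
(* Since Y + (1 - Y) = 1, Y (1 - Y) = Y (1 - Y) Y + (1 - Y) Y (1 - Y), which is a sum of two
   congruences; adding 1 - Y gives 1 - Y^2. *)
have -> : 1%:M - 2^-1 *: (X + Y *m Y) =
    2^-1 *: ((1%:M - X) + ((1%:M - Y) + (Y *m (1%:M - Y) *m Y^T +
      (1%:M - Y) *m Y *m (1%:M - Y)^T))).
  rewrite IH.1 pY.1; apply/(scalerI (a := 2)) => //.
  rewrite scalerBr !scalerA divff// !scale1r scaler_nat mulr2n.
  rewrite !mulmxBr !mulmxBl !(mulmx1, mul1mx).
  move: (Y *m Y) (Y *m Y *m Y) => Y2 Y3.
  by apply/matrixP => i j; rewrite !mxE; ring.
apply: psdmxZ; first by rewrite invr_ge0.
do 2?[apply: psdmxD => //].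
by apply: psdmxD; exact: psdmx_conj.
Qed.

(** For each fixed v the values of the quadratic form at v increase and are bounded by v'v;
    polarization on basis vectors turns this into convergence of the entries. *)
Lemma newton_cvg n (X : 'M[F]_n) : psdmx X -> psdmx (1%:M - X) ->
  exists L, mxcvg (newton X) L.
Proof.
move=> pX p1X.
have cb v : cvgn (fun k => bform (newton X k) v v).
  apply: nondecreasing_is_cvgn.
    apply/nondecreasing_seqP => k; rewrite -subr_ge0.
    have [_ [_ /(_ v)]] := newton_psd k pX.
    by rewrite mulmxBr mulmxBl mxE [X in _ + X]mxE.
  exists (bform 1%:M v v) => _ [k _ <-]; rewrite -subr_ge0.
  have [_ /(_ v)] := newton_le1 k pX p1X.
  by rewrite mulmxBr mulmxBl mxE [X in _ + X]mxE.
pose b i j k := bform (newton X k) (delta_mx i 0 + delta_mx j 0)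
  (delta_mx i 0 + delta_mx j 0).
exists (\matrix_(i, j) limn (fun k => newton X k i j)) => i j; rewrite mxE.
suff : cvgn (fun k => newton X k i j) by [].
have e k : newton X k i j = (bform (newton X k) (delta_mx i 0 + delta_mx j 0)
  (delta_mx i 0 + delta_mx j 0) - bform (newton X k) (delta_mx i 0) (delta_mx i 0)
  - bform (newton X k) (delta_mx j 0) (delta_mx j 0)) * 2^-1.
  rewrite bformD ?(newton_psd k pX).1.1// !bform_delta.
  by field.
under eq_fun do rewrite e.
apply: is_cvgM; last exact: is_cvg_cst.
by apply: (@is_cvgB _ F^o); [apply: (@is_cvgB _ F^o)|].
Qed.

(** Large enough to dominate a symmetric M, and positive even at M = 0 so that one can divide by it.
    It is also a measurable test for zero: its value is 1 exactly at the zero matrix. *)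
Definition mxscale n (M : 'M[F]_n) : F := 1 + \sum_i \sum_j `|M i j|.

(** With c = [mxscale M] and X = 1 - M / c, the square root of M is sqrt(c) sqrt(1 - X), and the
    iterates at X tend to 1 - sqrt(1 - X). *)
Definition sqrtmx_approx n (M : 'M[F]_n) k : 'M[F]_n :=
  Num.sqrt (mxscale M) *: (1%:M - newton (1%:M - (mxscale M)^-1 *: M) k).

Lemma mxscale_gt0 n (M : 'M[F]_n) : 0 < mxscale M.
Proof.
by rewrite ltr_pwDl// sumr_ge0// => i _; rewrite sumr_ge0.
Qed.

(** Each product |v_i v_j| is at most v'v, so v'Mv is at most v'v times the sum of the |M_ij|. *)
Lemma mxscale_dominates n (M : 'M[F]_n) : M^T = M ->
  psdmx ((mxscale M)%:M - M).
Proof.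
move=> sM; split=> [|v]; first by rewrite linearB/= tr_scalar_mx sM.
set N2 := (v^T *m v) 0 0.
have vi i : v i 0 ^+ 2 <= N2.
  rewrite /N2 mxE (bigD1 i)//= !mxE -expr2 lerDl sumr_ge0// => j _.
  by rewrite !mxE -expr2 sqr_ge0.
have N20 : 0 <= N2.
  by rewrite /N2 mxE sumr_ge0// => i _; rewrite mxE -expr2 sqr_ge0.
have vv i j : `|v i 0 * v j 0| <= N2.
  rewrite ler_norml; have := vi i; have := vi j.
  have := sqr_ge0 (v i 0 + v j 0); have := sqr_ge0 (v i 0 - v j 0).
  by move=> h1 h2 h3 h4; apply/andP; split; nra.
rewrite mulmxBr mulmxBl mxE [X in _ + X]mxE subr_ge0.
rewrite -scalemx1 -scalemxAr mulmx1 -scalemxAl [leRHS]mxE -/N2.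
rewrite mulrDl mul1r ler_wpDl// mxE mulr_suml.
rewrite [leLHS](eq_bigr (fun j => \sum_i v i 0 * M i j * v j 0)); last first.
  by move=> j _; rewrite mxE mulr_suml; apply: eq_bigr => i _; rewrite mxE.
rewrite exchange_big/=; apply: ler_sum => i _; rewrite mulr_suml.
apply: ler_sum => j _; rewrite (le_trans (ler_norm _))//.
by rewrite mulrAC normrM mulrC ler_wpM2l.
Qed.

(** The limit L of the iteration satisfies 2 L = X + L^2, that is (1 - L)^2 = 1 - X, so the rescaled
    limit is a positive semi-definite square root. This makes the set behind [sqrtmx] nonempty, and
    uniqueness identifies the chosen element with the limit. *)
Lemma sqrtmxP n (M : 'M[F]_n) : psdmx M ->
  [/\ psdmx (sqrtmx M), sqrtmx M *m sqrtmx M = M &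
      mxcvg (sqrtmx_approx M) (sqrtmx M)].
Proof.
move=> pM; set c := mxscale M; have c0 : 0 < c := mxscale_gt0 M.
have cV0 : 0 <= c^-1 by rewrite invr_ge0 ltW.
pose X := 1%:M - c^-1 *: M.
have pX : psdmx X.
  have -> : X = c^-1 *: (c%:M - M).
    by rewrite scalerBr scale_scalar_mx mulVf ?gt_eqF.
  by apply: psdmxZ => //; apply: mxscale_dominates; exact: pM.1.
have p1X : psdmx (1%:M - X) by rewrite subKr; exact: psdmxZ.
have [L XL] := newton_cvg pX p1X.
have fixL : L = 2^-1 *: (X + L *m L).
  apply: (@mxcvg_unique _ _ (fun k => newton X k.+1)).
    by move=> i j; have := XL i j; rewrite -(cvg_shiftS (fun k => newton X k i j)).
  by apply: mxcvgZ; apply: mxcvgD; [exact: mxcvg_cst|exact: mxcvgM].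
have cvgS : mxcvg (sqrtmx_approx M) (Num.sqrt c *: (1%:M - L)).
  apply: mxcvgZ; apply: mxcvgD; first exact: mxcvg_cst.
  move=> i j; under eq_fun do rewrite mxE; rewrite mxE.
  by apply: (@cvgN _ F^o); exact: XL.
have pS : psdmx (Num.sqrt c *: (1%:M - L)).
  apply: psdmxZ; first exact: sqrtr_ge0.
  apply: (@psdmx_lim _ (fun k => 1%:M - newton X k)).
    by move=> k; exact: newton_le1.
  apply: mxcvgD; first exact: mxcvg_cst.
  move=> i j; under eq_fun do rewrite mxE; rewrite mxE.
  by apply: (@cvgN _ F^o); exact: XL.
have SS : (Num.sqrt c *: (1%:M - L)) *m (Num.sqrt c *: (1%:M - L)) = M.
  rewrite -scalemxAl -scalemxAr scalerA -expr2 sqr_sqrtr ?(ltW c0)//.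
  have -> : (1%:M - L) *m (1%:M - L) = 1%:M - X.
    rewrite mulmxBr !mulmxBl !(mul1mx, mulmx1).
    have : 2 *: L = X + L *m L by rewrite {1}fixL scalerA divff// scale1r.
    move: (L *m L) => L2 h; have -> : X = 2 *: L - L2 by rewrite h addrK.
    by apply/matrixP => i j; rewrite !mxE; ring.
  by rewrite subKr scalerA divff ?gt_eqF// scale1r.
have [Q1 Q2] : psdmx (sqrtmx M) /\ sqrtmx M *m sqrtmx M = M.
  suff h : [set Q | psdmx Q /\ Q *m Q = M] (sqrtmx M) by [].
  by apply: xgetPex; eexists; split; [exact: pS|exact: SS].
by split => //; rewrite (psdmx_sqrt_unique Q1 pS _)// Q2.
Qed.

Lemma sqrtmx_psd n (M : 'M[F]_n) : psdmx M -> psdmx (sqrtmx M).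
Proof. by case/sqrtmxP. Qed.

Lemma sqrtmxK n (M : 'M[F]_n) : psdmx M -> sqrtmx M *m sqrtmx M = M.
Proof. by case/sqrtmxP. Qed.

End PositiveSemidefinite.

(** * Measurability of matrix operations *)

Section MeasurableMatrix.
Context d (T : measurableType d).

Lemma measurable_mx_entry d' (E : measurableType d') m n i j :
  measurable_fun setT (fun M : 'M[E]_(m, n) => M i j).
Proof.
move=> _ A mA; apply: sub_sigma_algebra; exists (i, j) => //=.
by exists A => //; rewrite setTI.
Qed.

Lemma measurable_mxP d' (E : measurableType d') m n (f : T -> 'M[E]_(m, n)) :
  measurable_fun setT f <-> forall i j, measurable_fun setT (fun w => f w i j).
Proof.
split=> [mf i j|mf].
  exact: (measurableT_comp (measurable_mx_entry i j) mf).
apply: (measurability (\bigcup_(ij in [set: 'I_m * 'I_n])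
    preimage_set_system setT (fun M : 'M[E]_(m, n) => M ij.1 ij.2) measurable)) => //.
move=> _ [_ [[i j] _ [A mA <-]] <-]; rewrite setTI -comp_preimage.
by have := mf i j measurableT A mA; rewrite setTI.
Qed.

Variable F : realType.

Lemma measurable_addmx m n (f g : T -> 'M[F]_(m, n)) :
  measurable_fun setT f -> measurable_fun setT g ->
  measurable_fun setT (fun w => f w + g w).
Proof.
move=> /measurable_mxP mf /measurable_mxP mg; apply/measurable_mxP => i j.
by under eq_fun do rewrite mxE; exact: measurable_funD.
Qed.

Lemma measurable_scalemx m n (a : T -> F) (f : T -> 'M[F]_(m, n)) :
  measurable_fun setT a -> measurable_fun setT f ->
  measurable_fun setT (fun w => a w *: f w).
Proof.
move=> ma /measurable_mxP mf; apply/measurable_mxP => i j.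
by under eq_fun do rewrite mxE; exact: measurable_funM.
Qed.

Lemma measurable_oppmx m n (f : T -> 'M[F]_(m, n)) :
  measurable_fun setT f -> measurable_fun setT (fun w => - f w).
Proof.
move=> /measurable_mxP mf; apply/measurable_mxP => i j.
by under eq_fun do rewrite mxE; exact: measurable_funN.
Qed.

Lemma measurable_mulmx m n p (f : T -> 'M[F]_(m, n)) (g : T -> 'M[F]_(n, p)) :
  measurable_fun setT f -> measurable_fun setT g ->
  measurable_fun setT (fun w => f w *m g w).
Proof.
move=> /measurable_mxP mf /measurable_mxP mg; apply/measurable_mxP => i j.
under eq_fun do rewrite mxE; apply: measurable_sum => k.
exact: measurable_funM.
Qed.

Lemma measurable_trmx m n (f : T -> 'M[F]_(m, n)) :
  measurable_fun setT f -> measurable_fun setT (fun w => (f w)^T).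
Proof.
move=> /measurable_mxP mf; apply/measurable_mxP => i j.
by under eq_fun do rewrite mxE; exact: mf.
Qed.

Lemma measurable_summx (I : Type) (s : seq I) m n (f : I -> T -> 'M[F]_(m, n)) :
  (forall i, measurable_fun setT (f i)) ->
  measurable_fun setT (fun w => \sum_(i <- s) f i w).
Proof.
move=> mf; elim: s => [|i s IH].
  by under eq_fun do rewrite big_nil; exact: measurable_cst.
by under eq_fun do rewrite big_cons; exact: measurable_addmx.
Qed.

Lemma measurable_det n (f : T -> 'M[F]_n) :
  measurable_fun setT f -> measurable_fun setT (fun w => \det (f w)).
Proof.
move=> /measurable_mxP mf; apply: measurable_sum => s.
apply: measurable_funM; first exact: measurable_cst.
by apply: measurable_prod => i _; exact: mf.
Qed.

Lemma measurable_adjmx n (f : T -> 'M[F]_n) :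
  measurable_fun setT f -> measurable_fun setT (fun w => \adj (f w)).
Proof.
move=> /measurable_mxP mf; apply/measurable_mxP => i j.
under eq_fun do rewrite mxE; apply: measurable_funM; first exact: measurable_cst.
apply: measurable_det; apply/measurable_mxP => k l.
by under eq_fun do rewrite !mxE; exact: mf.
Qed.

(** Inversion is not continuous at 0; writing 1/y as y times the power -1 of y^2 reduces it to real
    powers of a nonnegative base, and both sides are 0 at y = 0. *)
Lemma measurable_invr (f : T -> F) :
  measurable_fun setT f -> measurable_fun setT (fun w => (f w)^-1).
Proof.
move=> mf; rewrite (_ : (fun _ => _) = f \* (fun w => (f w ^+ 2) `^ (- 1))).
  apply: measurable_funM => //; 
  by apply: (measurableT_comp (measurable_powR (- 1)) (measurable_funX 2 mf)).
apply/funext => w /=; rewrite powR_inv1 ?sqr_ge0//.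
have [->|f0] := eqVneq (f w) 0; first by rewrite invr0 mul0r.
by field.
Qed.

Lemma measurable_invmx n (f : T -> 'M[F]_n) :
  measurable_fun setT f -> measurable_fun setT (fun w => invmx (f w)).
Proof.
move=> mf.
(* [invmx] returns its argument on singular matrices, whence the first branch; the second is
   Cramer's rule. *)
rewrite (_ : (fun _ => _) = fun w => if \det (f w) == 0 then f w
    else (\det (f w))^-1 *: \adj (f w)); last first.
  by apply/funext => w; rewrite /invmx unitmxE unitfE; case: eqP.
have md := measurable_det mf; apply: measurable_fun_ifT => //.
  by apply: measurable_fun_eqr => //; exact: measurable_cst.
by apply: measurable_scalemx; [exact: measurable_invr|exact: measurable_adjmx].
Qed.

Lemma measurable_newton n (f : T -> 'M[F]_n) k :
  measurable_fun setT f -> measurable_fun setT (fun w => newton (f w) k).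
Proof.
move=> mf; elim: k => [|k IH] /=; first exact: measurable_cst.
apply: measurable_scalemx; first exact: measurable_cst.
by apply: measurable_addmx => //; exact: measurable_mulmx.
Qed.

Lemma measurable_mxscale n (f : T -> 'M[F]_n) :
  measurable_fun setT f -> measurable_fun setT (fun w => mxscale (f w)).
Proof.
move=> /measurable_mxP mf; apply: measurable_funD; first exact: measurable_cst.
apply: measurable_sum => i; apply: measurable_sum => j.
by apply: measurableT_comp => //; exact: mf.
Qed.

Lemma measurable_sqrtmx_approx n (f : T -> 'M[F]_n) k :
  measurable_fun setT f -> measurable_fun setT (fun w => sqrtmx_approx (f w) k).
Proof.
move=> mf; have mc := measurable_mxscale mf.
apply: measurable_scalemx.
  apply: (measurableT_comp _ mc).
  by apply: continuous_measurable_fun; exact: sqrt_continuous.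
apply: measurable_addmx; first exact: measurable_cst.
apply: measurable_oppmx; apply: measurable_newton.
apply: measurable_addmx; first exact: measurable_cst.
apply: measurable_oppmx; apply: measurable_scalemx => //.
exact: measurable_invr.
Qed.

End MeasurableMatrix.

Section MeasurableSqrt.
Variable F : realType.

(** An upper limit exists for every M, convergent or not, and is measurable in M. *)
Let sqrtmx_lim n (M : 'M[F]_n) : 'M[F]_n :=
  \matrix_(i, j) fine (limn_esup (fun k => (sqrtmx_approx M k i j)%:E)).

Let mxscale_eq1 n (M : 'M[F]_n) : (mxscale M == 1) = (M == 0).
Proof.
have s0 i : 0 <= \sum_j `|M i j| by rewrite sumr_ge0.
apply/idP/idP => [|/eqP ->]; last first.
  rewrite /mxscale big1 ?addr0// => i _; rewrite big1// => j _.
  by rewrite mxE normr0.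
rewrite -subr_eq0 /mxscale addrC addKr psumr_eq0// => /allP h.
apply/eqP/matrixP => i j; rewrite mxE; apply/eqP; rewrite -normr_eq0.
have /= := h i (mem_index_enum _); rewrite psumr_eq0// => /allP.
by move=> /(_ j (mem_index_enum _)).
Qed.

(* Where the limit is not a symmetric square root of [M], the matrix [M] is not
   positive semi-definite and [sqrtmx] takes its junk value. *)
Let sqrtmxE n (M : 'M[F]_n) : sqrtmx M =
  let S := sqrtmx_lim M in
  if (mxscale (S^T - S) == 1) && (mxscale (S *m S - M) == 1) then S else 0.
Proof.
have limE : psdmx M -> sqrtmx_lim M = sqrtmx M.
  move=> /sqrtmxP[_ _ SL]; apply/matrixP => i j; rewrite mxE.
  have h : (sqrtmx_approx M k i j)%:E @[k --> \oo] --> (sqrtmx M i j)%:E.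
    by apply: cvg_EFin; [exact: nearW|exact: SL].
  by have [_ ->] := cvg_limn_einf_sup h.
rewrite /= !mxscale_eq1 !subr_eq0.
have [pM|npM] := pselect (psdmx M).
  by rewrite limE// sqrtmxK// (sqrtmx_psd pM).1 !eqxx.
case: ifP => [/andP[/eqP sS /eqP SS]|_].
  by exfalso; apply: npM; rewrite -SS -{2}sS; exact: psdmx_gram.
rewrite /sqrtmx; case: xgetP => // Q _ [pQ QM]; exfalso; apply: npM.
by rewrite -QM -{2}pQ.1; exact: psdmx_gram.
Qed.

Lemma measurable_sqrtmx d (T : measurableType d) n (f : T -> 'M[F]_n) :
  measurable_fun setT f -> measurable_fun setT (fun w => sqrtmx (f w)).
Proof.
move=> mf; under eq_fun do rewrite sqrtmxE.
have mS : measurable_fun setT (fun w => sqrtmx_lim (f w)).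
  apply/measurable_mxP => i j; under eq_fun do rewrite mxE.
  apply: (measurableT_comp (fine_measurable _)) => //.
  apply: measurable_fun_limn_esup => k; apply: measurableT_comp => //.
  by have /measurable_mxP := measurable_sqrtmx_approx k mf.
apply: measurable_fun_ifT => //.
apply: measurable_and; apply: measurable_fun_eqr; do ?exact: measurable_cst;
  apply: measurable_mxscale; apply: measurable_addmx => //.
- exact: measurable_trmx.
- exact: measurable_oppmx.
- exact: measurable_mulmx.
- exact: measurable_oppmx.
Qed.

End MeasurableSqrt.

Section MeasurableKalman.
Context d0 (T : measurableType d0) (F : realType).

Lemma measurable_gain d k (B : 'M[F]_(k, d)) R0 (p : T -> 'M[F]_d) :
  measurable_fun setT p -> measurable_fun setT (fun w => gain B R0 (p w)).
Proof.
move=> mp; have mc m n (M : 'M[F]_(m, n)) : measurable_fun setT (fun _ : T => M).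
  exact: measurable_cst.
apply: measurable_mulmx; first exact: measurable_mulmx.
apply: measurable_invmx; apply: measurable_addmx => //.
by do 2!apply: measurable_mulmx => //.
Qed.

Lemma measurable_Delta d N (dN : (d <= N)%N) (C D : T -> 'M[F]_d)
    (Z : T -> 'M[F]_(d, N)) :
  measurable_fun setT C -> measurable_fun setT D -> measurable_fun setT Z ->
  measurable_fun setT (fun w => Delta dN (C w) (D w) (Z w)).
Proof.
move=> mC mD mZ; have mc m n (M : 'M[F]_(m, n)) : measurable_fun setT (fun _ : T => M).
  exact: measurable_cst.
have mCD : measurable_fun setT
    (fun w => sqrtmx (C w) *m Gmx dN (Z w) *m sqrtmx (D w)).
  apply: measurable_mulmx; last exact: measurable_sqrtmx.
  apply: measurable_mulmx; first exact: measurable_sqrtmx.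
  apply/measurable_mxP => i j; under eq_fun do rewrite mxE.
  by move/measurable_mxP: mZ; apply.
apply: measurable_addmx.
  apply: measurable_mulmx; last exact: measurable_sqrtmx.
  apply: measurable_mulmx; first exact: measurable_sqrtmx.
  apply: measurable_scalemx => //; apply: measurable_addmx => //.
  by apply: measurable_mulmx => //; exact: measurable_trmx.
apply: measurable_scalemx => //; apply: measurable_scalemx => //.
by apply: measurable_addmx => //; exact: measurable_trmx.
Qed.

End MeasurableKalman.

(** * Rotation invariance of the standard normal law *)

Section AffineSubstitution.
Context {F : realType}.
Local Notation mu := (@lebesgue_measure F).
Variables a b : F.
Hypothesis a0 : a != 0.

Let aff (x : F) : measurableTypeR F := a * x + b.

Let measurable_aff : measurable_fun setT aff.
Proof. by apply: measurable_funD => //; exact: measurable_funM. Qed.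

Let aff_mfun : {mfun F >-> measurableTypeR F} :=
  HB.pack aff (isMeasurableFun.Build _ _ _ _ _ measurable_aff).

Let lebesgue_measure_aff (A : set F) : measurable A ->
  (mu A = `|a|%:E * pushforward mu aff A)%E.
Proof.
have na0 : 0 <= `|a| by [].
pose k : {nonneg F} := NngNum na0.
move: A; apply: (@lebesgue_measure_unique F (mscale k (pushforward mu aff_mfun))).
move=> /= _ [[x y]] _ <-; rewrite /mscale /= /pushforward.
have [ap|an] := ltrP 0 a.
  have -> : aff @^-1` `]x, y] = `](x - b) / a, (y - b) / a]%classic.
    apply/seteqP; split=> z /=; rewrite /aff !in_itv/= ltr_pdivrMr// ler_pdivlMr//;
      by rewrite ltrBlDr lerBrDr ![z * a]mulrC.
  rewrite !lebesgue_measure_itv/= !lte_fin ltr_pM2r ?invr_gt0// ltrD2r.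
  case: ifP => _; last by rewrite mule0.
  rewrite -!EFinD -EFinM; congr EFin; rewrite gtr0_norm//.
  by field; rewrite gt_eqF.
(* A negative slope exchanges the open and the closed end of the interval; the length does not see
   this. *)
have {}an : a < 0 by rewrite lt_neqAle a0.
have -> : aff @^-1` `]x, y] = `[(y - b) / a, (x - b) / a[%classic.
  apply/seteqP; split=> z /=; rewrite /aff !in_itv/= ler_ndivrMr// ltr_ndivlMr//;
    by rewrite ltrBlDr lerBrDr ![z * a]mulrC andbC.
rewrite !lebesgue_measure_itv/= !lte_fin ltr_nM2r ?invr_lt0// ltrD2r.
case: ifP => _; last by rewrite mule0.
rewrite -!EFinD -EFinM; congr EFin; rewrite ltr0_norm//.
by field; rewrite lt_eqF.
Qed.

Lemma ge0_integral_aff (f : F -> \bar F) :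
  measurable_fun setT f -> (forall x, 0 <= f x)%E ->
  (\int[mu]_x f x = `|a|%:E * \int[mu]_x f (a * x + b)%R)%E.
Proof.
move=> mf f0; have na0 : 0 <= `|a| by [].
pose k : {nonneg F} := NngNum na0.
rewrite (@eq_measure_integral _ _ _ _ (mscale k (pushforward mu aff_mfun)));
  last by move=> A mA _; exact: lebesgue_measure_aff.
rewrite ge0_integral_mscale//; congr (_ * _)%E.
by rewrite ge0_integral_pushforward.
Qed.

End AffineSubstitution.

Section GaussianRotation.
Context {F : realType}.
Local Notation mu := (@lebesgue_measure F).
Local Notation phi := (@normal_pdf F 0 1).
Local Notation gamma := (@normal_prob F 0 1).
Local Open Scope ereal_scope.

(** The Radon-Nikodym derivative of the normal law and the Gaussian density have the same integral
    over every measurable set, hence agree almost everywhere. *)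
Lemma ge0_integral_normal (f : F -> \bar F) :
  measurable_fun setT f -> (forall x, 0 <= f x) ->
  \int[gamma]_x f x = \int[mu]_x (f x * (phi x)%:E).
Proof.
move=> mf f0; have dom := @normal_prob_dominates F 0%R 1%R.
rewrite -(Radon_Nikodym_SigmaFinite.change_of_variables dom)//.
have mRN : measurable_fun setT (Radon_Nikodym_SigmaFinite.f gamma mu).
  exact: measurable_int (Radon_Nikodym_SigmaFinite.f_integrable dom).
have mphi : measurable_fun setT (EFin \o phi).
  by apply/measurable_EFinP; exact: measurable_normal_pdf.
apply: ge0_ae_eq_integral => //.
- exact: emeasurable_funM.
- exact: emeasurable_funM.
- by move=> x _; rewrite mule_ge0// Radon_Nikodym_SigmaFinite.f_ge0.
- by move=> x _; rewrite mule_ge0// lee_fin normal_pdf_ge0.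
have : ae_eq mu setT (Radon_Nikodym_SigmaFinite.f gamma mu) (EFin \o phi).
  apply: integral_ae_eq => //.
    exact: Radon_Nikodym_SigmaFinite.f_integrable.
  by move=> E _ mE; rewrite -(Radon_Nikodym_SigmaFinite.f_integral dom).
by apply: filterS => x /= h _; rewrite h.
Qed.

(** The rotation is factored into two one-dimensional affine substitutions, x into (x - s y) / c at
    fixed y and then y into c y + s x at fixed x, with Tonelli in between. Their Jacobians 1/|c| and
    |c| cancel. *)
Lemma integral_rotation c s (H : F * F -> \bar F) :
  c != 0%R -> (c ^+ 2 + s ^+ 2 = 1)%R ->
  measurable_fun setT H -> (forall z, 0 <= H z) ->
  \int[mu]_x \int[mu]_y H (x, y) =
  \int[mu]_x \int[mu]_y H (c * x - s * y, s * x + c * y)%R.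
Proof.
move=> c0 cs mH H0.
have mHx x : measurable_fun setT (fun y => H (x, y)).
  exact: measurableT_comp mH (pair1_measurable x).
have mHy y : measurable_fun setT (fun x => H (x, y)).
  exact: measurableT_comp mH (pair2_measurable y).
have c1 : (`|c^-1| * `|c| = 1)%R by rewrite -normrM mulVf// normr1.
pose K (z : F * F) := `|c^-1|%:E * H (c^-1 * z.1 - s * z.2 / c, z.2)%R.
have K0 z : 0 <= K z by rewrite mule_ge0// lee_fin.
have mH1 : measurable_fun setT (fun z : F * F => H (c^-1 * z.1 - s * z.2 / c, z.2)%R).
  apply: (measurableT_comp mH); apply: measurable_fun_pair => //.
  apply: measurable_funB; first exact: measurable_funM.
  by apply: measurable_funM => //; exact: measurable_funM.
have mK : measurable_fun setT K by exact: measurable_funeM.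
have mKx x : measurable_fun setT (fun y => K (x, y)).
  exact: measurableT_comp mK (pair1_measurable x).
rewrite fubini_tonelli//.
transitivity (\int[mu]_y \int[mu]_x K (x, y)).
  apply: eq_integral => y _.
  rewrite [LHS](@ge0_integral_aff _ c^-1 (- (s * y / c))) ?invr_eq0//.
  rewrite -ge0_integralZl//.
  exact: (measurableT_comp mH1 (pair2_measurable y)).
rewrite -fubini_tonelli//; apply: eq_integral => x _.
rewrite [LHS](@ge0_integral_aff _ c (s * x))//.
rewrite -ge0_integralZl//; last first.
  apply: (measurableT_comp (mKx x)).
  by apply: measurable_funD => //; exact: measurable_funM.
apply: eq_integral => y _; rewrite /K muleA -EFinM mulrC c1 mul1e/=.
congr (H (_, _)); last by rewrite addrC.
have -> : (c^-1 * x = c^-1 * ((c ^+ 2 + s ^+ 2) * x))%R by rewrite cs mul1r.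
by field.
Qed.

Lemma normal_pdf_rotation c s x y : (c ^+ 2 + s ^+ 2 = 1)%R ->
  (phi (c * x - s * y) * phi (s * x + c * y) = phi x * phi y)%R.
Proof.
move=> cs; rewrite !normal_pdfE ?oner_eq0// /normal_fun !subr0.
rewrite mulrACA [in RHS]mulrACA -!expRD; congr (_ * expR _)%R.
rewrite -!mulrDl; congr (_ / _)%R.
have -> : (- x ^+ 2 - y ^+ 2 = - (c ^+ 2 + s ^+ 2) * (x ^+ 2 + y ^+ 2))%R.
  by rewrite cs; ring.
by ring.
Qed.

(** The joint density depends only on x^2 + y^2, and the substitution of [integral_rotation] is the
    inverse of the rotation defining the event, which therefore becomes the rectangle A x B. *)
Lemma normal_prob_rotation c s (A B : set F) :
  c != 0%R -> (c ^+ 2 + s ^+ 2 = 1)%R -> measurable A -> measurable B ->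
  (gamma \x gamma) [set z : F * F | A (c * z.1 + s * z.2)%R /\
                                    B (- s * z.1 + c * z.2)%R] =
  gamma A * gamma B.
Proof.
move=> c0 cs mA mB; set C := [set z | _].
have mlin (a b : F) : measurable_fun setT (fun z : F * F => a * z.1 + b * z.2)%R.
  by apply: measurable_funD; exact: measurable_funM.
have mC : measurable C.
  rewrite (_ : C = (fun z : F * F => c * z.1 + s * z.2)%R @^-1` A `&`
     (fun z : F * F => - s * z.1 + c * z.2)%R @^-1` B)//.
  by apply: measurableI; rewrite -[X in measurable X]setTI; exact: mlin.
have mphi : measurable_fun setT (EFin \o phi).
  by apply/measurable_EFinP; exact: measurable_normal_pdf.
have phi0 x : 0 <= (phi x)%:E by rewrite lee_fin normal_pdf_ge0.
have mI (D : set F) : measurable D ->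
    measurable_fun setT (fun x => (\1_D x)%:E : \bar F).
  by move=> mD; apply/measurable_EFinP; exact: measurable_indic.
pose H (z : F * F) := (\1_C z)%:E * ((phi z.2)%:E * (phi z.1)%:E).
have mH : measurable_fun setT H.
  apply: emeasurable_funM; first by apply/measurable_EFinP; exact: measurable_indic.
  apply: emeasurable_funM; first exact: (measurableT_comp mphi measurable_snd).
  exact: (measurableT_comp mphi measurable_fst).
have H0 z : 0 <= H z by rewrite mule_ge0 ?mule_ge0// lee_fin.
have gE (D : set F) : measurable D -> gamma D = \int[mu]_x ((\1_D x)%:E * (phi x)%:E).
  move=> mD; rewrite -ge0_integral_normal//.
    by rewrite integral_indic// setIT.
  exact: mI.
transitivity (\int[mu]_x \int[mu]_y H (x, y)).
  rewrite [LHS]ge0_integral_normal; last 2 first.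
  - exact: measurable_fun_xsection.
  - by move=> x; exact: measure_ge0.
  apply: eq_integral => x _ /=; rewrite gE; last exact: measurable_xsection.
  rewrite -ge0_integralZr//; last 2 first.
  - apply: emeasurable_funM => //; apply: mI; exact: measurable_xsection.
  - by move=> y _; rewrite mule_ge0// lee_fin.
  apply: eq_integral => y _; rewrite /H muleA; congr (_ * _ * _).
  by rewrite !indicE mem_xsection.
rewrite (integral_rotation c0 cs)//.
transitivity (\int[mu]_x (((\1_A x)%:E * (phi x)%:E) * gamma B)).
  apply: eq_integral => x _; rewrite (gE _ mB) -[RHS]ge0_integralZl//; last 3 first.
  - by apply: emeasurable_funM => //; exact: mI.
  - by move=> y _; rewrite mule_ge0// lee_fin.
  - by rewrite mule_ge0// lee_fin.
  apply: eq_integral => y _; rewrite /H /=.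
  rewrite [RHS]muleACA -!EFinM; congr (_%:E); congr (_ * _)%R; last first.
    by rewrite [LHS]mulrC normal_pdf_rotation.
  rewrite !indicE -natrM mulnb; congr ((nat_of_bool _)%:R)%R.
  have e1 : (c * (c * x - s * y) + s * (s * x + c * y) = x)%R.
    by rewrite -[RHS]mul1r -cs; ring.
  have e2 : (- s * (c * x - s * y) + c * (s * x + c * y) = y)%R.
    by rewrite -[RHS]mul1r -cs; ring.
  apply/idP/andP; rewrite !inE /C /= e1 e2; first by move=> [].
  by move=> [].
rewrite ge0_integralZr//; last 2 first.
- by apply: emeasurable_funM => //; exact: mI.
- by move=> x _; rewrite mule_ge0// lee_fin.
by rewrite -gE.
Qed.

Lemma normal_probN (A : set F) : measurable A ->
  gamma ((fun x => - x)%R @^-1` A) = gamma A.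
Proof.
move=> mA; have mphi : measurable_fun setT (EFin \o phi).
  by apply/measurable_EFinP; exact: measurable_normal_pdf.
have mNA : measurable ((fun x : F => - x)%R @^-1` A).
  by rewrite -[X in measurable X]setTI; exact: oppr_measurable.
have mI (D : set F) : measurable D ->
    measurable_fun setT (fun x => (\1_D x)%:E : \bar F).
  by move=> mD; apply/measurable_EFinP; exact: measurable_indic.
have gE (D : set F) : measurable D -> gamma D = \int[mu]_x ((\1_D x)%:E * (phi x)%:E).
  move=> mD; rewrite -ge0_integral_normal//.
    by rewrite integral_indic// setIT.
  exact: mI.
rewrite !gE// [RHS](@ge0_integral_aff _ (- 1)%R 0%R) ?oppr_eq0 ?oner_eq0//.
- rewrite normrN1 mul1e; apply: eq_integral => x _.
  rewrite addr0 mulN1r; congr (_%:E * _%:E).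
  by rewrite !normal_pdfE ?oner_eq0// /normal_fun !subr0 sqrrN.
- by apply: emeasurable_funM => //; exact: mI.
- by move=> x; rewrite mule_ge0// lee_fin normal_pdf_ge0.
Qed.

End GaussianRotation.

(** * Laws and independence *)

Section Laws.
Context {F : realType}.
Local Open Scope ereal_scope.

Lemma measurable_preimage d d' (T : measurableType d) (E : measurableType d')
    (X : T -> E) A : measurable_fun setT X -> measurable A ->
  measurable (X @^-1` A).
Proof. by move=> mX mA; rewrite -[X in measurable X]setTI; exact: mX. Qed.

Lemma eq_measure_prod d1 d2 (E1 : measurableType d1) (E2 : measurableType d2)
    (m1 m2 : {measure set (E1 * E2) -> \bar F}) :
  m1 setT < +oo ->
  (forall A B, measurable A -> measurable B -> m1 (A `*` B) = m2 (A `*` B)) ->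
  forall C, measurable C -> m1 C = m2 C.
Proof.
move=> m1oo m12; pose G : set (set (E1 * E2)) :=
  [set C | exists A B, [/\ measurable A, measurable B & C = A `*` B]].
apply: (measure_unique G (fun=> setT)) => //.
- rewrite measurable_prod_measurableType //; congr (<<s _ >>).
  rewrite predeqE => C; split => [[A mA [B mB <-]]|[A [B [mA mB ->]]]].
    by exists A, B.
  by exists A => //; exists B.
- move=> _ _ [A [B [mA mB ->]]] [A' [B' [mA' mB' ->]]].
  by rewrite -setXI; exists (A `&` A'), (B `&` B'); split => //; exact: measurableI.
- by move=> _; exists setT, setT; rewrite setXTT.
- by rewrite bigcup_const//; exists 0%N.
- by move=> _ [A [B [mA mB ->]]]; exact: m12.
Qed.

Lemma same_law_sym d1 d2 d (O1 : measurableType d1) (O2 : measurableType d2)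
    (E : measurableType d) (P1 : probability O1 F) (P2 : probability O2 F)
    (X1 : O1 -> E) (X2 : O2 -> E) :
  same_law P1 P2 X1 X2 -> same_law P2 P1 X2 X1.
Proof. by move=> [m1 m2 h]; split => // C mC; rewrite h. Qed.

Lemma same_law_comp d1 d2 d d' (O1 : measurableType d1) (O2 : measurableType d2)
    (E : measurableType d) (E' : measurableType d')
    (P1 : probability O1 F) (P2 : probability O2 F)
    (X1 : O1 -> E) (X2 : O2 -> E) (f : E -> E') :
  measurable_fun setT f ->
  same_law P1 P2 X1 X2 -> same_law P1 P2 (f \o X1) (f \o X2).
Proof.
move=> mf [m1 m2 h]; split; [exact: measurableT_comp..|move=> C mC].
by have := h _ (measurable_preimage mf mC).
Qed.

Definition indep d d1 d2 (O : measurableType d) (E1 : measurableType d1)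
    (E2 : measurableType d2) (P : probability O F) (X : O -> E1) (Y : O -> E2) :=
  forall A B, measurable A -> measurable B ->
    P (X @^-1` A `&` Y @^-1` B) = P (X @^-1` A) * P (Y @^-1` B).

Definition mfun_of d d' (T : measurableType d) (E : measurableType d')
    (X : T -> E) (mX : measurable_fun setT X) : {mfun T >-> E} :=
  HB.pack X (isMeasurableFun.Build _ _ _ _ _ mX).

Section IndependentPair.
Context d d1 d2 (O : measurableType d) (E1 : measurableType d1)
  (E2 : measurableType d2) (P : probability O F) (X : O -> E1) (Y : O -> E2).
Hypotheses (mX : measurable_fun setT X) (mY : measurable_fun setT Y).

Lemma indep_law C : indep P X Y -> measurable C ->
  P ((fun w => (X w, Y w)) @^-1` C) =
  \int[distribution P (mfun_of mX)]_x
    distribution P (mfun_of mY) (xsection C x).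
Proof.
move=> XY; pose XYm := mfun_of (measurable_fun_pair mX mY).
pose m := (distribution P (mfun_of mX) \x distribution P (mfun_of mY)).
apply: (@eq_measure_prod _ _ _ _ (distribution P XYm) m).
  by rewrite -[X in X < _]/(P setT) probability_setT ltry.
move=> A B mA mB; apply: (etrans (XY A B mA mB)); apply/esym.
exact: product_measure1E.
Qed.

End IndependentPair.

Lemma indep_same_law d d' d1 d2 (O : measurableType d) (O' : measurableType d')
    (E1 : measurableType d1) (E2 : measurableType d2)
    (P : probability O F) (P' : probability O' F)
    (X : O -> E1) (Y : O -> E2) (X' : O' -> E1) (Y' : O' -> E2) :
  indep P X Y -> indep P' X' Y' -> same_law P P' X X' -> same_law P P' Y Y' ->
  same_law P P' (fun w => (X w, Y w)) (fun w => (X' w, Y' w)).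
Proof.
move=> XY XY' [mX mX' lX] [mY mY' lY].
split; [exact: measurable_fun_pair..|].
apply: (@eq_measure_prod _ _ _ _
  (distribution P (mfun_of (measurable_fun_pair mX mY)))
  (distribution P' (mfun_of (measurable_fun_pair mX' mY')))).
  by rewrite -[X in X < _]/(P setT) probability_setT ltry.
move=> A B mA mB; apply: (etrans (XY _ _ mA mB)).
rewrite [X in X * _ = _]lX// [X in _ * X = _]lY//; exact/esym/XY'.
Qed.

(* Lumping: given the state, the law of the image of the next state depends only
   on the image of the state. *)
Lemma same_law_step d d' ds dt dv dv' du (O : measurableType d)
    (O' : measurableType d') (S : measurableType ds) (T : measurableType dt)
    (V : measurableType dv) (V' : measurableType dv') (U : measurableType du)
    (P : probability O F) (P' : probability O' F)
    (X : O -> S) (X' : O' -> T) (Y : O -> V) (Y' : O' -> V')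
    (g : S -> T) (Phi : S -> V -> U) (Psi : T -> V' -> U) :
  measurable_fun setT X -> measurable_fun setT Y -> measurable_fun setT Y' ->
  measurable_fun setT g ->
  measurable_fun setT (fun z => Phi z.1 z.2) ->
  measurable_fun setT (fun z => Psi z.1 z.2) ->
  indep P X Y -> indep P' X' Y' ->
  same_law P P' (g \o X) X' ->
  (forall x, same_law P P' (fun w => Phi x (Y w)) (fun w => Psi (g x) (Y' w))) ->
  same_law P P' (fun w => (g (X w), Phi (X w) (Y w)))
                (fun w => (X' w, Psi (X' w) (Y' w))).
Proof.
move=> mX mY mY' mg mPhi mPsi XY XY' [mgX mX' lX] lPhi.
have mXY := measurable_fun_pair mX mY.
have mXY' := measurable_fun_pair mX' mY'.
have mf : measurable_fun setT (fun z : S * V => (g z.1, Phi z.1 z.2)).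
  by apply: measurable_fun_pair => //; exact: (measurableT_comp mg measurable_fst).
have mf' : measurable_fun setT (fun z : T * V' => (z.1, Psi z.1 z.2)).
  by apply: measurable_fun_pair => //; exact: measurable_fst.
split.
- exact: (measurableT_comp mf mXY).
- exact: (measurableT_comp mf' mXY').
move=> C mC.
have mC1 := measurable_preimage mf mC.
have mC2 := measurable_preimage mf' mC.
rewrite [LHS](indep_law mX mY XY mC1) [RHS](indep_law mX' mY' XY' mC2).
pose h t := distribution P' (mfun_of mY')
  (xsection ((fun z : T * V' => (z.1, Psi z.1 z.2)) @^-1` C) t).
have mh : measurable_fun setT h by exact: measurable_fun_xsection.
transitivity (\int[distribution P (mfun_of mX)]_x h (g x)).
  apply: eq_integral => x _; rewrite /h.
  have [_ _ /(_ _ (measurable_xsection (g x) mC)) e] := lPhi x.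
  have -> : xsection ((fun z : S * V => (g z.1, Phi z.1 z.2)) @^-1` C) x =
      Phi x @^-1` xsection C (g x).
    by apply/seteqP; split=> v; rewrite /xsection /= !inE.
  have -> : xsection ((fun z : T * V' => (z.1, Psi z.1 z.2)) @^-1` C) (g x) =
      Psi (g x) @^-1` xsection C (g x).
    by apply/seteqP; split=> v; rewrite /xsection /= !inE.
  exact: e.
transitivity (\int[pushforward (distribution P (mfun_of mX)) g]_t h t).
  by rewrite (ge0_integral_pushforward mg).
apply: eq_measure_integral => A mA _; exact: lX.
Qed.

End Laws.

Section StandardNormal.
Context {F : realType}.
Local Open Scope ereal_scope.

Let measurable_idR : measurable_fun setT (idfun : measurableTypeR F -> F).
Proof. by move=> _ A mA; rewrite setTI. Qed.

(* [normal_prob 0 1] lives on [measurableTypeR F], whose sigma-algebra is that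
   of [F] but with another display. *)
Definition std_normal : probability F F :=
  distribution (@normal_prob F 0%R 1%R) (mfun_of measurable_idR).

Lemma std_normal_rotation c s (A B : set F) :
  c != 0%R -> (c ^+ 2 + s ^+ 2 = 1)%R -> measurable A -> measurable B ->
  (std_normal \x std_normal) [set z : F * F | A (c * z.1 + s * z.2)%R /\
                                    B (- s * z.1 + c * z.2)%R] =
  std_normal A * std_normal B.
Proof.
move=> c0 cs mA mB; set C := [set z | _].
have mC : measurable C.
  have ml (a b : F) : measurable_fun setT (fun z : F * F => a * z.1 + b * z.2)%R.
    by apply: measurable_funD; exact: measurable_funM.
  rewrite (_ : C = (fun z : F * F => c * z.1 + s * z.2)%R @^-1` A `&`
     (fun z : F * F => - s * z.1 + c * z.2)%R @^-1` B)//.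
  by apply: measurableI; exact: measurable_preimage.
rewrite -[RHS](normal_prob_rotation c0 cs mA mB).
rewrite /product_measure1 [LHS](ge0_integral_pushforward measurable_idR)//.
exact: measurable_fun_xsection.
Qed.

Lemma std_normalN (A : set F) : measurable A ->
  std_normal ((fun x => - x)%R @^-1` A) = std_normal A.
Proof. exact: normal_probN. Qed.

End StandardNormal.

(** * Finite families of independent standard normal variables *)

Section StandardNormalFamily.
Context {F : realType}.
Local Notation gamma := (@std_normal F).
Local Open Scope ereal_scope.

(** Marginals and independence are encoded in one product formula over full boxes; subfamilies are
    covered by taking [B i] to be [setT] elsewhere. *)
Definition normal_family d (O : measurableType d) (P : probability O F)
    (I : finType) (g : I -> O -> F) :=
  (forall i, measurable_fun setT (g i)) /\
  forall B : I -> set F, (forall i, measurable (B i)) ->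
    P (\bigcap_(i in setT) g i @^-1` B i) = \prod_i gamma (B i).

Section OneSpace.
Context d (O : measurableType d) (P : probability O F).

Lemma normal_family_reindex (I J : finType) (f : J -> I) (g : I -> O -> F) :
  bijective f -> normal_family P g -> normal_family P (fun j => g (f j)).
Proof.
move=> bf [mg lg]; split=> [j|B mB]; first exact: mg.
have [h fK hK] := bf.
have := lg (fun i => B (h i)) (fun i => mB (h i)).
rewrite (reindex f)/=; last exact: onW_bij.
under eq_bigr do rewrite fK.
move=> <-; congr (P _); apply/seteqP; split=> w /= Bw i _.
  by have := Bw (h i) Logic.I; rewrite /= hK.
by have := Bw (f i) Logic.I; rewrite /= fK.
Qed.

Lemma normal_family_flip n (g : 'I_n -> O -> F) i : normal_family P g ->
  normal_family P (fun a w => if a == i then - g a w else g a w)%R.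
Proof.
move=> [mg lg]; split=> [a|B mB].
  by case: eqP => _ //; exact: measurable_funN.
pose B' a := if a == i then (fun x : F => - x)%R @^-1` B a else B a.
have mN : measurable ((fun x : F => - x)%R @^-1` B i).
  by rewrite -[X in measurable X]setTI; exact: oppr_measurable.
have mB' a : measurable (B' a) by rewrite /B'; case: eqP => [->|].
transitivity (\prod_a gamma (B' a)).
  rewrite -lg//; congr (P _); apply/seteqP; split=> w /= Bw a _;
    by have := Bw a Logic.I; rewrite /= /B'; case: eqP.
apply: eq_bigr => a _; rewrite /B'; case: eqP => // _.
exact: std_normalN.
Qed.

(** A rotation turns a rectangle in the plane of coordinates i, j into a set that is no longer a
    rectangle, so the product formula is extended to arbitrary measurable sets of this plane, the
    other coordinates staying in a box. *)
Lemma normal_family_pair n (g : 'I_n -> O -> F) i j (C : set (F * F))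
    (B : 'I_n -> set F) : i != j -> normal_family P g ->
  measurable C -> (forall a, measurable (B a)) ->
  P ((fun w => (g i w, g j w)) @^-1` C `&`
     \bigcap_(a in [set a | (a != i) && (a != j)]) g a @^-1` B a) =
  \prod_(a | (a != i) && (a != j)) gamma (B a) * (gamma \x gamma) C.
Proof.
move=> ij [mg lg] mC mB.
set K := \bigcap_(a in _) _; set r := \prod_(a | _) _.
have mK : measurable K.
  apply: fin_bigcap_measurable; first exact: finite_finset.
  by move=> a _; exact: measurable_preimage.
have rect (D E : set F) : measurable D -> measurable E ->
    P ((fun w => (g i w, g j w)) @^-1` (D `*` E) `&` K) =
    r * (gamma D * gamma E).
  move=> mD mE.
  pose B' a := if a == i then D else if a == j then E else B a.
  have mB' a : measurable (B' a) by rewrite /B'; case: eqP => // _; case: eqP.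
  transitivity (\prod_a gamma (B' a)).
    rewrite -lg//; congr (P _); apply/seteqP; split=> w /=.
      move=> [[/= Dw Ew] Kw] a _; rewrite /B' /=.
      have [->//|ai] := eqVneq a i; have [->//|aj] := eqVneq a j.
      by apply: Kw; rewrite /= ai aj.
    move=> Bw; split.
      have := Bw i Logic.I; have := Bw j Logic.I.
      by rewrite /= /B' !eqxx eq_sym (negbTE ij).
    move=> a /= /andP[ai aj]; have := Bw a Logic.I.
    by rewrite /= /B' (negbTE ai) (negbTE aj).
  rewrite (bigD1 i)//= (bigD1 j) ?(eq_sym j)//=.
  rewrite {1 2}/B' eqxx eq_sym (negbTE ij) eqxx muleA muleC; congr (_ * _).
  by apply: eq_bigr => a /andP[ai aj]; rewrite /B' (negbTE ai) (negbTE aj).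
have rK : r = P K.
  have := rect setT setT measurableT measurableT.
  by rewrite setXTT preimage_setT setTI !probability_setT !mule1.
(* As the probability of K, r is finite and nonnegative, hence a legitimate factor for [mscale]. *)
have rfin : r \is a fin_num by rewrite rK fin_num_measure.
have r0 : (0 <= fine r)%R by rewrite fine_ge0// rK.
pose k : {nonneg F} := NngNum r0.
pose gij := mfun_of (measurable_fun_pair (mg i) (mg j)).
transitivity (k%:num%:E * (gamma \x gamma) C); last by rewrite /= fineK.
apply: (@eq_measure_prod F _ _ _ _ (pushforward (mrestr P mK) gij)
  (mscale k (gamma \x gamma))) => //.
- by rewrite -[X in X < _]/(P (setT `&` K)) setTI -rK ltey_eq rfin.
move=> D E mD mE.
rewrite [LHS]rect// [RHS](_ : _ = k%:num%:E * (gamma \x gamma) (D `*` E))//.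
by rewrite product_measure1E//= fineK.
Qed.

Lemma normal_family_rot n (g : 'I_n -> O -> F) i j c s :
  i != j -> c != 0%R -> (c ^+ 2 + s ^+ 2 = 1)%R -> normal_family P g ->
  normal_family P (fun a w => if a == i then c * g i w + s * g j w
    else if a == j then - s * g i w + c * g j w else g a w)%R.
Proof.
move=> ij c0 cs Ng; have [mg _] := Ng.
have mlin (a b : F) : measurable_fun setT (fun w => a * g i w + b * g j w)%R.
  by apply: measurable_funD; exact: measurable_funM.
split=> [a|B mB].
  by case: eqP => // _; case: eqP.
pose C := [set z : F * F | B i (c * z.1 + s * z.2)%R /\
                           B j (- s * z.1 + c * z.2)%R].
have mC : measurable C.
  have ml (a b : F) : measurable_fun setT (fun z : F * F => a * z.1 + b * z.2)%R.
    by apply: measurable_funD; exact: measurable_funM.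
  rewrite (_ : C = (fun z : F * F => c * z.1 + s * z.2)%R @^-1` B i `&`
     (fun z : F * F => - s * z.1 + c * z.2)%R @^-1` B j)//.
  by apply: measurableI; exact: measurable_preimage.
rewrite (bigD1 i)//= (bigD1 j) ?(eq_sym j)//= muleA.
rewrite -(std_normal_rotation c0 cs (mB i) (mB j)) muleC -(normal_family_pair ij Ng mC mB).
congr (P _); apply/seteqP; split=> w /=.
  move=> Bw; split.
    have := Bw i Logic.I; have := Bw j Logic.I.
    by rewrite /= eqxx eq_sym (negbTE ij) eqxx.
  move=> a /= /andP[ai aj]; have := Bw a Logic.I.
  by rewrite /= (negbTE ai) (negbTE aj).
move=> [[/= Bi Bj] Kw] a _ /=.
have [->//|ai] := eqVneq a i; have [->//|aj] := eqVneq a j.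
by apply: Kw; rewrite /= ai aj.
Qed.

Lemma normal_family_isomx n (T : 'M[F]_n) (G : O -> 'cV[F]_n) : isomx T ->
  normal_family P (fun i w => G w i 0%R) ->
  normal_family P (fun i w => (T *m G w)%R i 0%R).
Proof.
elim=> [|i S _ IH|i j c s S ij c0 cs _ IH] NG.
- by under [fun i w => _]eq_fun2 do rewrite mul1mx.
- under [fun i w => _]eq_fun2 do rewrite -mulmxA flipmxE.
  exact: (normal_family_flip i (IH NG)).
- under [fun i w => _]eq_fun2 do rewrite -mulmxA rotmxE//.
  exact: (normal_family_rot ij c0 cs (IH NG)).
Qed.

End OneSpace.

Lemma normal_family_law d d' (O : measurableType d) (O' : measurableType d')
    (P : probability O F) (P' : probability O' F) n (G : O -> 'cV[F]_n)
    (G' : O' -> 'cV[F]_n) :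
  normal_family P (fun i w => G w i 0%R) ->
  normal_family P' (fun i w => G' w i 0%R) -> same_law P P' G G'.
Proof.
move=> [mg lg] [mg' lg'].
have mG : measurable_fun setT G.
  by apply/measurable_mxP => i j; rewrite ord1; exact: mg.
have mG' : measurable_fun setT G'.
  by apply/measurable_mxP => i j; rewrite ord1; exact: mg'.
split => // C mC.
pose R (B : 'I_n -> set F) := \bigcap_(i in setT) (fun M : 'cV[F]_n => M i 0%R) @^-1` B i.
pose Pi := [set C | exists2 B : 'I_n -> set F, forall i, measurable (B i) & C = R B].
have PiT : Pi setT.
  exists (fun=> setT) => //; apply/seteqP; split=> // M _ i _ //.
apply: (@measure_unique _ _ _ Pi (fun=> setT) _ _ _ _
  (distribution P (mfun_of mG)) (distribution P' (mfun_of mG'))) => //.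
- apply/seteqP; split; last first.
    apply: smallest_sub; first exact: sigma_algebra_measurable.
    move=> _ [B mB ->]; apply: fin_bigcap_measurable; first exact: finite_finset.
    by move=> i _; apply: measurable_preimage => //; exact: measurable_mx_entry.
  apply: smallest_sub; first exact: smallest_sigma_algebra.
  move=> _ [[i j] _ [B mB <-]]; rewrite setTI; apply: sub_sigma_algebra.
  exists (fun a => if a == i then B else setT).
    by move=> a; case: eqP.
  apply/seteqP; split=> M /=; rewrite ord1.
    by move=> Bw a _ /=; case: eqP => [->|].
  by move=> /(_ i Logic.I) /=; rewrite eqxx.
- move=> _ _ [B mB ->] [B' mB' ->]; exists (fun i => B i `&` B' i).
    by move=> i; exact: measurableI.
  by rewrite /R -bigcapI; apply: eq_bigcapr => i _.
- by rewrite bigcup_const//; exists 0%N.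
- move=> _ [B mB ->]; exact: (etrans (lg B mB) (esym (lg' B mB))).
- by move=> _; rewrite -[X in X < _]/(P setT) probability_setT ltry.
Qed.

End StandardNormalFamily.

Section GaussianGram.
Context {F : realType}.
Context d1 d2 (O1 : measurableType d1) (O2 : measurableType d2)
  (P1 : probability O1 F) (P2 : probability O2 F).

Let prod_family (I1 I2 : finType) (g1 : I1 -> O1 -> F) (g2 : I2 -> O2 -> F)
    (i : I1 + I2) (w : O1 * O2) : F :=
  match i with inl i1 => g1 i1 w.1 | inr i2 => g2 i2 w.2 end.

Let normal_family_prod (I1 I2 : finType) (g1 : I1 -> O1 -> F) (g2 : I2 -> O2 -> F) :
  normal_family P1 g1 -> normal_family P2 g2 ->
  normal_family (P1 \x P2)%E (prod_family g1 g2).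
Proof.
move=> [mg1 lg1] [mg2 lg2]; split=> [[i|i]|B mB].
- exact: (measurableT_comp (mg1 i) measurable_fst).
- exact: (measurableT_comp (mg2 i) measurable_snd).
rewrite big_sumType/= -lg1// -lg2//.
rewrite -product_measure1E; last 2 first.
- apply: fin_bigcap_measurable; first exact: finite_finset.
  by move=> i _; exact: measurable_preimage.
- apply: fin_bigcap_measurable; first exact: finite_finset.
  by move=> i _; exact: measurable_preimage.
congr ((P1 \x P2)%E _); apply/seteqP; split=> w /=.
  by move=> Bw; split=> i _; [exact: (Bw (inl i) Logic.I)|exact: (Bw (inr i) Logic.I)].
by move=> [B1 B2] [i|i] _ /=; [exact: (B1 i Logic.I)|exact: (B2 i Logic.I)].
Qed.

(* Padding both families by zero coefficients puts them on the product space,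
   where an isometry carries one coefficient matrix to the other. *)
Lemma normal_family_gram m n (I1 I2 : finType) (g1 : I1 -> O1 -> F)
    (g2 : I2 -> O2 -> F) (c1 : I1 -> 'M[F]_(m, n)) (c2 : I2 -> 'M[F]_(m, n)) :
  normal_family P1 g1 -> normal_family P2 g2 ->
  (forall a b a' b', \sum_i c1 i a b * c1 i a' b' =
                     \sum_i c2 i a b * c2 i a' b') ->
  same_law P1 P2 (fun w => \sum_i g1 i w *: c1 i) (fun w => \sum_i g2 i w *: c2 i).
Proof.
move=> N1 N2 Gr.
pose Q := (P1 \x P2)%E.
pose k := #|{: I1 + I2}|.
pose ev (j : 'I_k) : (I1 + I2)%type := enum_val j.
have bev : bijective ev by exact: enum_val_bij.
pose G w : 'cV[F]_k := \col_i prod_family g1 g2 (ev i) w.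
have NG : normal_family Q (fun i w => G w i 0).
  have -> : (fun i w => G w i 0) = (fun i => prod_family g1 g2 (ev i)).
    by apply/funext => i; apply/funext => w; rewrite mxE.
  apply: normal_family_reindex => //.
  exact: normal_family_prod.
pose e1 (i : I1 + I2) := match i with inl i1 => c1 i1 | inr _ => 0 end.
pose e2 (i : I1 + I2) := match i with inl _ => 0 | inr i2 => c2 i2 end.
(* The columns are the vectorised coefficient matrices, so M M' lists the covariances between all
   pairs of entries of the linear image. *)
pose M (e : I1 + I2 -> 'M[F]_(m, n)) : 'M[F]_(m * n, k) :=
  \matrix_(r, i) mxvec (e (ev i)) 0 r.
have ME e w : vec_mx (M e *m G w)^T = \sum_i prod_family g1 g2 i w *: e i.
  rewrite (reindex ev)/=; last exact: onW_bij.
  apply/(can_inj (@mxvecK _ _ _)); rewrite vec_mxK linear_sum/=.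
  apply/rowP => r; rewrite !mxE summxE; apply: eq_bigr => i _.
  by rewrite !mxE linearZ/= mxE mulrC.
have MM (e : I1 + I2 -> 'M[F]_(m, n)) a b a' b' :
    (M e *m (M e)^T) (mxvec_index a b) (mxvec_index a' b') =
    \sum_i e i a b * e i a' b'.
  rewrite (reindex ev)/=; last exact: onW_bij.
  by rewrite mxE; apply: eq_bigr => i _; rewrite !mxE !mxvecE.
have Gr' : M e1 *m (M e1)^T = M e2 *m (M e2)^T.
  apply/matrixP => r r'; case/mxvec_indexP: r => a b; case/mxvec_indexP: r' => a' b'.
  rewrite !MM !big_sumType/=.
  rewrite [X in _ + X = _]big1 ?addr0; last by move=> i _; rewrite mxE mul0r.
  rewrite [X in _ = X + _]big1 ?add0r; last by move=> i _; rewrite mxE mul0r.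
  exact: Gr.
have [T isoT MT] := isomx_gram Gr'.
have mlin p (M' : 'M[F]_(p, k)) : measurable_fun setT (fun v : 'cV[F]_k => M' *m v).
  by apply: measurable_mulmx; [exact: measurable_cst|exact: measurable_id].
have mvec : measurable_fun setT (fun v : 'cV[F]_(m * n) => vec_mx v^T : 'M[F]_(m, n)).
  apply/measurable_mxP => i j; under eq_fun do rewrite !mxE.
  exact: measurable_mx_entry.
have lawG : same_law Q Q (fun w => vec_mx (M e1 *m G w)^T)
                         (fun w => vec_mx (M e2 *m G w)^T).
  rewrite -MT; under [X in same_law _ _ _ X]eq_fun do rewrite -mulmxA.
  apply: (@same_law_comp _ _ _ _ _ _ _ _ _ _ _ G (fun w => T *m G w)
    (fun v => vec_mx (M e1 *m v)^T)).
    exact: (measurableT_comp mvec (mlin _ _)).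
  exact: normal_family_law NG (normal_family_isomx isoT NG).
have E1 w : vec_mx (M e1 *m G w)^T = \sum_i g1 i w.1 *: c1 i.
  by rewrite ME big_sumType/= [X in _ + X]big1 ?addr0// => i _; rewrite scaler0.
have E2 w : vec_mx (M e2 *m G w)^T = \sum_i g2 i w.2 *: c2 i.
  by rewrite ME big_sumType/= [X in X + _]big1 ?add0r// => i _; rewrite scaler0.
have mf1 : measurable_fun setT (fun w => \sum_i g1 i w *: c1 i).
  apply: measurable_summx => i; apply: measurable_scalemx; first exact: N1.1.
  exact: measurable_cst.
have mf2 : measurable_fun setT (fun w => \sum_i g2 i w *: c2 i).
  apply: measurable_summx => i; apply: measurable_scalemx; first exact: N2.1.
  exact: measurable_cst.
split=> // C mC; have [_ _ /(_ C mC)] := lawG.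
rewrite /pushforward; under eq_fun do rewrite E1; under [in RHS]eq_fun do rewrite E2.
move=> QE.
have m1 := measurable_preimage mf1 mC; have m2 := measurable_preimage mf2 mC.
transitivity (Q (((fun w => \sum_i g1 i w *: c1 i) @^-1` C) `*` setT)).
  rewrite -[LHS]mule1 -(probability_setT P2); apply/esym.
  exact: product_measure1E.
transitivity (Q (setT `*` ((fun w => \sum_i g2 i w *: c2 i) @^-1` C))).
  by rewrite setXT setTX.
rewrite -[RHS]mul1e -(probability_setT P1); exact: product_measure1E.
Qed.

End GaussianGram.

(** * One step of the ensemble *)

Section EnsembleAlgebra.
Context {F : realType}.

Definition mxmean d N (x : 'M[F]_(d, N.+1)) : 'cV[F]_d := sample_mean (fun i => col i x).
Definition mxcov d N (x : 'M[F]_(d, N.+1)) : 'M[F]_d := sample_cov (fun i => col i x).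

Local Notation ones N := (const_mx 1 : 'cV[F]_N.+1).

Lemma mxmeanE d N (x : 'M[F]_(d, N.+1)) : mxmean x = N.+1%:R^-1 *: (x *m ones N).
Proof.
congr (_ *: _); apply/matrixP => a b; rewrite summxE mxE.
by apply: eq_bigr => i _; rewrite !mxE mulr1.
Qed.

Lemma ones_gram N : (ones N)^T *m ones N = N.+1%:R%:M.
Proof.
apply/matrixP => a b; rewrite !ord1 !mxE eqxx mulr1n.
under eq_bigr do rewrite !mxE mulr1.
by rewrite sumr_const card_ord.
Qed.

Lemma mxcovE d N (x : 'M[F]_(d, N.+1)) :
  let y := x - mxmean x *m (ones N)^T in
  y *m ones N = 0 /\ mxcov x = N%:R^-1 *: (y *m y^T).
Proof.
move=> y; split.
  rewrite mulmxBl -mulmxA ones_gram mul_mx_scalar mxmeanE scalerA divff ?pnatr_eq0//.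
  by rewrite scale1r subrr.
congr (_ *: _); apply/matrixP => a b; rewrite summxE [RHS]mxE.
apply: eq_bigr => i _; rewrite -/(mxmean x) mxE big_ord1.
by rewrite !mxE !big_ord1 !mxE !mulr1.
Qed.

Lemma mxcov_psd d N (x : 'M[F]_(d, N.+1)) : psdmx (mxcov x).
Proof.
rewrite (mxcovE x).2; apply: psdmxZ; first by rewrite invr_ge0 ler0n.
exact: psdmx_gram.
Qed.

(* An isometry rotating the constant vector to the first basis vector separates
   the sample mean from the sample covariance. *)
Lemma mxmean_mxcov_isometry d N (x : 'M[F]_(d, N.+1)) (E : 'M[F]_(N.+1))
    (y0 : 'cV[F]_d) (U : 'M[F]_(d, N)) :
  E *m E^T = 1%:M -> (ones N)^T *m E = Num.sqrt N.+1%:R *: delta_mx 0 0 ->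
  x *m E = row_mx y0 U ->
  mxmean x = (Num.sqrt N.+1%:R)^-1 *: y0 /\ mxcov x = N%:R^-1 *: (U *m U^T).
Proof.
move=> EE oE xE; set s := Num.sqrt N.+1%:R in oE *.
have s2 : s * s = N.+1%:R by rewrite -expr2 sqr_sqrtr// ler0n.
have s0 : s != 0 by rewrite gt_eqF// sqrtr_gt0 ltr0n.
have e0 : row_mx y0 U *m (delta_mx 0 0 : 'cV[F]_(N.+1)) = y0.
  rewrite -colE; apply/matrixP => a b; rewrite !ord1 mxE.
  have -> : (0 : 'I_(1 + N)) = lshift N 0 by exact: val_inj.
  by rewrite row_mxEl.
have oE' : E^T *m ones N = s *: delta_mx 0 0.
  by rewrite -[ones N]trmxK -trmx_mul oE [(_ *: _)^T]linearZ/= trmx_delta.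
have mE : mxmean x = s^-1 *: y0.
  rewrite mxmeanE -{1}(mulmx1 x) -EE mulmxA xE -mulmxA oE' -scalemxAr e0.
  by rewrite scalerA -s2; congr (_ *: _); field.
split=> //; have [_ ->] := mxcovE x; congr (_ *: _).
set y := x - _.
have yE : y *m E = row_mx (0 : 'cV[F]_d) U.
  rewrite mulmxBl -mulmxA oE xE mE -scalemxAl -scalemxAr scalerA mulVf// scale1r.
  apply/matrixP => a b; rewrite !mxE big_ord1 mxE.
  case: split_ordP => c ->.
    by rewrite !ord1 (_ : (0 == _) = true) ?mulr1 ?subrr ?mxE.
  by rewrite (_ : (rshift 1 c == 0) = false) ?andbF ?mulr0 ?subr0.
rewrite -{1}(mulmx1 y) -EE mulmxA yE -mulmxA -trmx_mul yE.
by rewrite (@tr_row_mx _ d 1 N) (@mul_row_col _ d 1 N d) trmx0 mul0mx add0r.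
Qed.

Lemma pid_mx_gram d N : (d <= N)%N ->
  (pid_mx d : 'M[F]_(d, N)) *m (pid_mx d : 'M[F]_(d, N))^T = 1%:M.
Proof.
by move=> dN; rewrite tr_pid_mx mul_pid_mx minnn (minn_idPr dN) pid_mx_1.
Qed.

Lemma ensemble_isometry d N (dN : (d <= N)%N) (x : 'M[F]_(d, N.+1)) (L : 'M[F]_d) :
  let D := L *m mxcov x *m L^T in
  exists E : 'M[F]_(N.+1), [/\ isomx E,
    (ones N)^T *m E = Num.sqrt N.+1%:R *: delta_mx 0 0 &
    L *m (x - mxmean x *m (ones N)^T) *m E =
      row_mx (0 : 'cV[F]_d) (Num.sqrt N%:R *: (sqrtmx D *m pid_mx d))].
Proof.
move=> D; have pD : psdmx D by apply: psdmx_conj; exact: mxcov_psd.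
have [yo yy] := mxcovE x; set y := x - _ in yo yy *.
pose M1 := col_mx (ones N)^T (L *m y).
pose W : 'M[F]_(d, N) := Num.sqrt N%:R *: (sqrtmx D *m pid_mx d).
pose M2 : 'M[F]_(1 + d, N.+1) :=
  col_mx (Num.sqrt N.+1%:R *: delta_mx 0 0) (row_mx (0 : 'cV[F]_d) W).
have s2 n : Num.sqrt n%:R * Num.sqrt n%:R = n%:R :> F.
  by rewrite -expr2 sqr_sqrtr// ler0n.
(* For N = 0 the factor 1/N of [mxcov] cannot be cancelled, but d <= N then makes the block
   empty. *)
have N0 : (N == 0%N) -> d = 0%N by move=> /eqP h; apply/eqP; rewrite -leqn0 -h.
have [|E isoE ME] := @isomx_gram F _ _ M1 M2; last first.
  exists E; move: ME; rewrite mul_col_mx => /eq_col_mx[e1 e2]; split => //.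
rewrite !tr_col_mx !mul_col_row; congr block_mx.
- rewrite trmxK ones_gram [(_ *: _)^T]linearZ/= -scalemxAl -scalemxAr scalerA.
  rewrite s2 trmx_delta mul_delta_mx; apply/matrixP => a b.
  by rewrite !ord1 !mxE !eqxx mulr1.
- rewrite trmx_mul mulmxA -trmx_mul yo trmx0 mul0mx -scalemxAl -rowE.
  rewrite (@tr_row_mx _ d 1 N) trmx0; apply/matrixP => a b; rewrite !ord1 !mxE.
  have -> : (0 : 'I_(1 + N)) = lshift N 0 by exact: val_inj.
  by case: split_ordP => c e; [rewrite mxE mulr0|move/eqP: e; rewrite eq_lrshift].
- rewrite trmxK -mulmxA yo mulmx0 [(_ *: _)^T]linearZ/= -scalemxAr.
  rewrite trmx_delta -colE; apply/matrixP => a b; rewrite !ord1 !mxE.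
  have -> : (0 : 'I_(1 + N)) = lshift N 0 by exact: val_inj.
  by case: split_ordP => c e; [rewrite mxE mulr0|move/eqP: e; rewrite eq_lrshift].
- rewrite (@tr_row_mx _ d 1 N) (@mul_row_col _ d 1 N d) trmx0 mul0mx add0r.
  rewrite /W [(_ *: _)^T]linearZ/= -scalemxAl -scalemxAr scalerA s2.
  rewrite !trmx_mul !mulmxA -(mulmxA (sqrtmx D)) pid_mx_gram// mulmx1.
  rewrite (sqrtmx_psd pD).1 sqrtmxK//.
  rewrite /D yy -scalemxAr -scalemxAl scalerA.
  have [/N0 d0|N0'] := boolP (N == 0%N).
    by subst d; rewrite [LHS]flatmx0 [RHS]flatmx0.
  by rewrite divff ?pnatr_eq0// scale1r !mulmxA.
Qed.

(** [Gmx] is Z J' for J = [I_d | 0], so the two cross terms of U U' form the symmetrised part of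
    [Delta]. The summand C on the right compensates the centring of Z Z' by N I in [Hmx]. *)
Lemma Delta_gram d N (dN : (d <= N)%N) (C D : 'M[F]_d) (Z : 'M[F]_(d, N)) :
  (0 < N)%N -> psdmx C -> psdmx D ->
  let U := Num.sqrt N%:R *: (sqrtmx D *m pid_mx d) + sqrtmx C *m Z in
  N%:R^-1 *: (U *m U^T) = D + C + (Num.sqrt N%:R)^-1 *: Delta dN C D Z.
Proof.
move=> N0 pC pD; set s := Num.sqrt N%:R.
have s2 : s * s = N%:R by rewrite -expr2 sqr_sqrtr// ler0n.
have s0 : s != 0 by rewrite gt_eqF// sqrtr_gt0 ltr0n.
have GE : Gmx dN Z = Z *m (pid_mx d : 'M[F]_(d, N))^T.
  apply/matrixP => a b; rewrite !mxE (bigD1 (widen_ord dN b))//= big1 ?addr0.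
    by rewrite !mxE /= eqxx ltn_ord mulr1.
  by move=> c cb; rewrite !mxE eq_sym -val_eqE /= in cb *; rewrite (negbTE cb) mulr0.
set Cs := sqrtmx C; set Ds := sqrtmx D.
have [sC sD] : Cs^T = Cs /\ Ds^T = Ds by rewrite (sqrtmx_psd pC).1 (sqrtmx_psd pD).1.
rewrite /Delta /symmx /Hmx GE -/Cs -/Ds; set J := pid_mx d : 'M[F]_(d, N).
have [T TD] : {T | T = Cs *m (Z *m J^T) *m Ds} by eexists.
have [K KD] : {K | K = Cs *m (Z *m Z^T) *m Cs} by eexists.
have TE : T^T = Ds *m J *m (Z^T *m Cs).
  by rewrite TD !trmx_mul trmxK sC sD !mulmxA.
rewrite /= -TD.
have UU : (s *: (Ds *m J) + Cs *m Z) *m (s *: (Ds *m J) + Cs *m Z)^T =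
    (s * s) *: D + s *: T^T + s *: T + K.
  rewrite [(_ + _)^T]linearD/= [(_ *: _)^T]linearZ/= !trmx_mul sC sD.
  rewrite !mulmxDr !mulmxDl -!scalemxAl -!scalemxAr scalerA.
  have -> : Ds *m J *m (J^T *m Ds) = D.
    by rewrite mulmxA -(mulmxA Ds) pid_mx_gram// mulmx1 sqrtmxK.
  have -> : Cs *m Z *m (J^T *m Ds) = T by rewrite TD !mulmxA.
  have -> : Cs *m Z *m (Z^T *m Cs) = K by rewrite KD !mulmxA.
  by rewrite -TE addrA [X in X + _]addrAC.
rewrite UU.
have -> : Cs *m (s^-1 *: (Z *m Z^T - N%:R%:M)) *m Cs = s^-1 *: (K - N%:R *: C).
  rewrite -scalemxAr -scalemxAl mulmxBr mulmxBl; rewrite -KD.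
  congr (_ *: (_ - _)).
  by rewrite mul_mx_scalar -scalemxAl sqrtmxK.
rewrite -s2; move: T^T => T'; apply/matrixP => a b; rewrite !mxE.
by field.
Qed.

End EnsembleAlgebra.

Section EnsembleStep.
Context {F : realType} (d k N : nat) (dN : (d <= N)%N) (N0 : (0 < N)%N).
Context dO dO' (O : measurableType dO) (O' : measurableType dO')
  (P : probability O F) (P' : probability O' F).

(** The left summand indexes the noise of the mean, the right one the noise of the covariance; a
    single family lets the pair be treated as one Gaussian vector. *)
Definition mean_cov_inputs (z : O' -> 'cV[F]_k) (Z : O' -> 'M[F]_(d, N))
    (i : 'I_k + 'I_d * 'I_N) (w : O') : F :=
  match i with inl a => z w a 0 | inr ab => Z w ab.1 ab.2 end.

Variables (x : 'M[F]_(d, N.+1)) (L C : 'M[F]_d) (b : 'cV[F]_d)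
  (M1 M2 : 'M[F]_(d, k)).
Hypotheses (pC : psdmx C) (M1C : M1 *m M1^T = C) (M2C : M2 *m M2^T = C).
Variables (V : O -> 'M[F]_(k, N.+1)) (z : O' -> 'cV[F]_k) (Z : O' -> 'M[F]_(d, N)).
Hypotheses (NV : normal_family P (fun (ai : 'I_k * 'I_N.+1) w => V w ai.1 ai.2))
  (NzZ : normal_family P' (mean_cov_inputs z Z)).

(** On both sides the entries (r, s) and (r', s') have covariance C_rr' if s = s' and 0 otherwise;
    on the left because the columns of E are orthonormal. [normal_family_gram] then applies,
    although the left has k (N+1) inputs and the right k + d N. *)
Let noise_law (E : 'M[F]_N.+1) : E^T *m E = 1%:M ->
  same_law P P' (fun w => M1 *m V w *m E : 'M[F]_(d, 1 + N))
                (fun w => row_mx (M2 *m z w) (sqrtmx C *m Z w)).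
Proof.
move=> EE; pose c1 (ai : 'I_k * 'I_N.+1) : 'M[F]_(d, 1 + N) :=
  col ai.1 M1 *m row ai.2 E.
pose c2 (i : 'I_k + 'I_d * 'I_N) : 'M[F]_(d, 1 + N) := match i with
  | inl a => row_mx (col a M2) 0
  | inr ab => row_mx 0 (col ab.1 (sqrtmx C) *m delta_mx 0 ab.2) end.
have c1E w : \sum_ai V w ai.1 ai.2 *: c1 ai = M1 *m V w *m E.
  apply/matrixP => r s; rewrite summxE mxE.
  under [RHS]eq_bigr do rewrite mxE mulr_suml.
  rewrite exchange_big/= pair_big/=; apply: eq_bigr => -[a i] _ /=.
  by rewrite !mxE big_ord1 !mxE; ring.
have c2E w : \sum_i mean_cov_inputs z Z i w *: c2 i =
    row_mx (M2 *m z w) (sqrtmx C *m Z w).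
  apply/matrixP => r s; rewrite summxE big_sumType/=.
  case: (split_ordP s) => j ->.
    rewrite row_mxEl [X in _ + X]big1 ?addr0; last first.
      by move=> i _; rewrite mxE row_mxEl mxE mulr0.
    by rewrite mxE; apply: eq_bigr => a _; rewrite !ord1 mxE row_mxEl mxE mulrC.
  rewrite row_mxEr [X in X + _]big1 ?add0r; last first.
    by move=> i _; rewrite mxE row_mxEr mxE mulr0.
  rewrite mxE -(pair_big xpredT xpredT
    (fun a j' => (Z w a j' *: c2 (inr (a, j'))) r (rshift 1 j)))/=.
  apply: eq_bigr => a _; rewrite (bigD1 j)//= big1 ?addr0.
    by rewrite mxE row_mxEr mxE big_ord1 !mxE !eqxx mulr1 mulrC.
  move=> j'; rewrite eq_sym => /negbTE jj'.
  by rewrite mxE row_mxEr mxE big_ord1 !mxE jj' andbF !mulr0.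
under eq_fun do rewrite -c1E; under [X in same_law _ _ _ X]eq_fun do rewrite -c2E.
apply: normal_family_gram => // r s r' s'.
transitivity (C r r' * (s == s')%:R).
  have -> : (s == s')%:R = (E^T *m E) s s' by rewrite EE mxE.
  rewrite -M1C !mxE mulr_suml; under [RHS]eq_bigr do rewrite mulr_sumr.
  rewrite pair_big/=; apply: eq_bigr => -[a i] _ /=.
  by rewrite !mxE !big_ord1 !mxE; ring.
rewrite big_sumType/=.
case: (split_ordP s) => j ->; case: (split_ordP s') => j' ->.
- rewrite [X in _ + X]big1 ?addr0; last first.
    by move=> i _; rewrite row_mxEl mxE mul0r.
  rewrite !ord1 eqxx mulr1 -M2C mxE; apply: eq_bigr => a _.
  by rewrite !row_mxEl !mxE.
- rewrite !big1 ?addr0 ?eq_lrshift ?mulr0// => i _.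
    by rewrite row_mxEl mxE mul0r.
  by rewrite mulrC row_mxEr mxE mul0r.
- rewrite !big1 ?addr0 ?eq_rlshift ?mulr0// => i _.
    by rewrite mulrC row_mxEl mxE mul0r.
  by rewrite row_mxEr mxE mul0r.
- rewrite [X in _ = X + _]big1 ?add0r; last first.
    by move=> i _; rewrite row_mxEr mxE mul0r.
  rewrite eq_rshift -{1}(sqrtmxK pC) mxE mulr_suml.
  rewrite -(pair_big xpredT xpredT (fun a i =>
    c2 (inr (a, i)) r (rshift 1 j) * c2 (inr (a, i)) r' (rshift 1 j')))/=.
  apply: eq_bigr => a _; rewrite (bigD1 j)//= big1 ?addr0.
    rewrite !row_mxEr !mxE !big_ord1 !mxE !eqxx mulr1 mulrA.
    by rewrite -{2}(sqrtmx_psd pC).1 mxE eq_sym.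
  move=> i; rewrite eq_sym => /negbTE ji.
  by rewrite row_mxEr mxE big_ord1 !mxE ji andbF mulr0 mul0r.
Qed.

Lemma ensemble_step_law :
  let D := L *m mxcov x *m L^T in
  same_law P P'
    (fun w => let W := L *m x + b *m (const_mx 1)^T + M1 *m V w in
              (mxmean W, mxcov W))
    (fun w => (L *m mxmean x + b + (Num.sqrt N.+1%:R)^-1 *: (M2 *m z w),
               D + C + (Num.sqrt N%:R)^-1 *: Delta dN C D (Z w))).
Proof.
move=> D; have pD : psdmx D by apply: psdmx_conj; exact: mxcov_psd.
have [E [isoE oE LxE]] := ensemble_isometry dN x L.
(* Both sides are this one function of the rotated noise: its first column moves the mean, the
   others the covariance. *)
pose f (A : 'M[F]_(d, 1 + N)) :=
  let U := Num.sqrt N%:R *: (sqrtmx D *m pid_mx d) + rsubmx A in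
  (L *m mxmean x + b + (Num.sqrt N.+1%:R)^-1 *: lsubmx A, N%:R^-1 *: (U *m U^T)).
have mf : measurable_fun setT f.
  have msub : measurable_fun setT (fun A : 'M[F]_(d, 1 + N) =>
      Num.sqrt N%:R *: (sqrtmx D *m pid_mx d) + rsubmx A).
    apply: measurable_addmx; first exact: measurable_cst.
    apply/measurable_mxP => i j; under eq_fun do rewrite mxE.
    exact: measurable_mx_entry.
  apply: measurable_fun_pair.
    apply: measurable_addmx; first exact: measurable_cst.
    apply: measurable_scalemx; first exact: measurable_cst.
    apply/measurable_mxP => i j; under eq_fun do rewrite mxE.
    exact: measurable_mx_entry.
  apply: measurable_scalemx; first exact: measurable_cst.
  by apply: measurable_mulmx => //; exact: measurable_trmx.
have := same_law_comp mf (noise_law (isomx_tr_mul isoE)).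
congr same_law; apply/funext => w /=; rewrite /f.
  set W := _ + M1 *m V w.
  have WE : W *m E = row_mx
      (Num.sqrt N.+1%:R *: (L *m mxmean x + b) +
       lsubmx (M1 *m V w *m E : 'M[F]_(d, 1 + N)))
      (Num.sqrt N%:R *: (sqrtmx D *m pid_mx d) +
       rsubmx (M1 *m V w *m E : 'M[F]_(d, 1 + N))).
    have -> : W = L *m (x - mxmean x *m (const_mx 1)^T) +
        (L *m mxmean x + b) *m (const_mx 1)^T + M1 *m V w.
      by rewrite /W mulmxBr mulmxDl mulmxA -!addrA addKr.
    rewrite 2!(mulmxDl _ _ E) LxE -(mulmxA _ _ E) oE.
    rewrite -[X in _ + X](hsubmxK (M1 *m V w *m E : 'M[F]_(d, 1 + N))).
    have -> : (L *m mxmean x + b) *m (Num.sqrt N.+1%:R *: (delta_mx 0 0 : 'rV[F]_(N.+1))) =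
        row_mx (Num.sqrt N.+1%:R *: (L *m mxmean x + b)) (0 : 'M[F]_(d, N)).
      rewrite -scalemxAr; move: (L *m mxmean x + b) => v.
      apply/matrixP => r s; rewrite !mxE big_ord1 !mxE eqxx andTb.
      case: (@split_ordP 1 N s) => j ->; rewrite ?ord1 mxE.
        by rewrite [X in (nat_of_bool X)%:R](_ : _ = true) ?mulr1.
      by rewrite [X in (nat_of_bool X)%:R](_ : _ = false) ?mulr0.
    by rewrite !(@add_row_mx _ d 1 N) !add0r !addr0.
  have [-> ->] := mxmean_mxcov_isometry (isomx_mul_tr isoE) oE WE.
  by rewrite scalerDr scalerA mulVf ?scale1r// gt_eqF// sqrtr_gt0 ltr0n.
by rewrite row_mxKl row_mxKr Delta_gram.
Qed.

End EnsembleStep.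

(** * Independent blocks of inputs *)

Section Grouping.
Context {F : realType} d (O : measurableType d) (P : probability O F).
Local Open Scope ereal_scope.

Lemma mutually_independent_seq (I : choiceType) (G : I -> set (set O)) s E :
  mutually_independent P G -> uniq s -> (forall i, i \in s -> G i (E i)) ->
  P (\bigcap_(i in [set` s]) E i) = \prod_(i <- s) P (E i).
Proof.
move=> indG us GE; have := indG [fset i in s]%fset E.
have -> : [set` [fset i in s]%fset] = [set` s].
  by apply/seteqP; split=> i /=; rewrite inE.
move=> ->; last by move=> i; rewrite inE; exact: GE.
apply: perm_big; apply: uniq_perm => //.
by move=> i; rewrite inE.
Qed.

Let pi_indep (Pi : set (set O)) (B : set O) :
  Pi `<=` measurable -> setI_closed Pi -> Pi setT -> measurable B ->
  (forall A, Pi A -> P (A `&` B) = P A * P B) ->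
  forall A, <<s Pi >> A -> P (A `&` B) = P A * P B.
Proof.
move=> mPi IPi PiT mB indB A sA.
have PBfin : P B \is a fin_num by rewrite fin_num_measure.
have b0 : (0 <= fine (P B))%R by rewrite fine_ge0.
pose k : {nonneg F} := NngNum b0.
transitivity (k%:num%:E * P A); last by rewrite /= fineK// muleC.
apply: (@g_sigma_algebra_measure_unique _ _ _ Pi mPi (fun=> setT) (fun=> PiT) _
  (mrestr P mB) (mscale k P)) => //.
- by rewrite bigcup_const//; exists 0%N.
- move=> A1 PiA1; apply: (etrans (indB _ PiA1)); rewrite muleC.
  by congr (_ * _); rewrite /k /= fineK.
- by move=> _; rewrite -[X in X < _]/(P (setT `&` B)) setTI ltey_eq PBfin.
Qed.

Variables (I : choiceType) (G : I -> set (set O)).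
Hypotheses (G_measurable : forall i, G i `<=` measurable)
  (GI : forall i, setI_closed (G i)) (GT : forall i, G i setT)
  (indG : mutually_independent P G).

Let cyl (S : set I) : set (set O) := [set A | exists s (E : I -> set O),
  [/\ uniq s, forall i, i \in s -> S i, forall i, G i (E i) &
      A = \bigcap_(i in [set` s]) E i]].

Let cyl_setI S : setI_closed (cyl S).
Proof.
move=> _ _ [s [E [us sS GE ->]]] [s' [E' [us' sS' GE' ->]]].
exists (undup (s ++ s')), (fun i => (if i \in s then E i else setT) `&`
                                    (if i \in s' then E' i else setT)).
split.
- exact: undup_uniq.
- by move=> i; rewrite mem_undup mem_cat => /orP[/sS|/sS'].
- by move=> i; apply: GI; case: ifP.
apply/seteqP; split=> w /=.
  move=> [Ew Ew'] i /=; rewrite mem_undup mem_cat => _.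
  by split; case: ifP => // h; [exact: Ew|exact: Ew'].
move=> Ew; split=> i /= si; have := Ew i; rewrite /= mem_undup mem_cat si ?orbT;
  by case.
Qed.

Let cyl_setT S : cyl S setT.
Proof.
exists [::], (fun=> setT); split => //; apply/seteqP; split=> // w _ i //.
Qed.

Let cyl_measurable S : cyl S `<=` measurable.
Proof.
move=> _ [s [E [us sS GE ->]]]; apply: fin_bigcap_measurable.
  exact: finite_seq.
by move=> i _; exact: (G_measurable (GE i)).
Qed.


(* Two applications of Dynkin's theorem to the pi-systems of finite
   intersections. *)
Lemma independent_blocks (S1 S2 : set I) A B :
  (forall i, S1 i -> ~ S2 i) ->
  <<s \bigcup_(i in S1) G i >> A -> <<s \bigcup_(i in S2) G i >> B ->
  P (A `&` B) = P A * P B.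
Proof.
move=> S12.
have sub S : <<s \bigcup_(i in S) G i >> `<=` <<s cyl S >>.
  apply: smallest_sub; first exact: smallest_sigma_algebra.
  move=> C [i Si GC]; apply: sub_sigma_algebra.
  exists [:: i], (fun j => if j == i then C else setT); split => //.
  - by move=> j; rewrite inE => /eqP ->.
  - by move=> j; case: eqP => [->|].
  apply/seteqP; split=> w /=.
    by move=> Cw j /=; rewrite inE => /eqP ->; rewrite eqxx.
  by move=> /(_ i); rewrite /= inE eqxx; apply.
move=> /sub sA /sub sB.
have mB : measurable B.
  move: B sB; apply: smallest_sub; first exact: sigma_algebra_measurable.
  exact: cyl_measurable.
apply: (pi_indep (@cyl_measurable S1)) sA => // A' cA'.
have mA' := cyl_measurable cA'.
rewrite setIC [RHS]muleC.
apply: (pi_indep (@cyl_measurable S2)) sB => // B' cB'.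
move: cA' cB' => [s [E [us sS GE ->]]] [s' [E' [us' sS' GE' ->]]].
have dis i : i \in s' -> i \notin s.
  by move=> si'; apply/negP => si; exact: (S12 i (sS i si) (sS' i si')).
rewrite (mutually_independent_seq indG us (fun i _ => GE i)).
rewrite (mutually_independent_seq indG us' (fun i _ => GE' i)).
have := @mutually_independent_seq _ _ (s' ++ s)
  (fun i => if i \in s then E i else E' i) indG.
rewrite big_cat/= cat_uniq us us' andbT /=.
have -> : ~~ has (in_mem^~ (mem s')) s.
  by apply/hasPn => i si; apply/negP => /dis; rewrite si.
move=> /(_ isT) h; rewrite [X in _ = X * _](eq_big_seq
  (fun i => P (if i \in s then E i else E' i))); last first.
  by move=> i /dis /negbTE ->.
rewrite [X in _ = _ * X](eq_big_seq
  (fun i => P (if i \in s then E i else E' i))); last by move=> i ->.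
rewrite -h; last by move=> i _; case: ifP.
congr (P _); apply/seteqP; split=> w /=.
  move=> [Ew' Ew] i /=; rewrite mem_cat => /orP[si'|si].
    by rewrite (negbTE (dis _ si')); exact: Ew'.
  by rewrite si; exact: Ew.
move=> Ew; split=> i /= si; have := Ew i; rewrite /= mem_cat si ?orbT.
  by rewrite (negbTE (dis _ si)); apply.
by apply.
Qed.

End Grouping.

(** * Laws of paths *)

Section PathLaws.
Context {F : realType}.

Lemma measurable_seq_coord d (E : measurableType d) n :
  measurable_fun setT (fun x : seq_space E => x n).
Proof.
move=> _ A mA; apply: sub_sigma_algebra; exists n => //.
by exists A => //; rewrite setTI.
Qed.

Lemma measurable_seqP d d' (T : measurableType d') (E : measurableType d)
    (f : T -> seq_space E) :
  measurable_fun setT f <-> forall n, measurable_fun setT (fun w => f w n).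
Proof.
split=> [mf n|mf]; first exact: (measurableT_comp (measurable_seq_coord n) mf).
apply: (@measurability _ _ _ (seq_space E) setT f (\bigcup_(n in [set: nat])
    preimage_set_system setT (fun x : nat -> E => x n) measurable)) => //.
move=> _ [_ [n _ [A mA <-]] <-]; rewrite !setTI.
by have := mf n measurableT A mA; rewrite setTI.
Qed.

(** Freezing the path after time t, rather than truncating it, keeps the paths for all t in the same
    measurable space. *)
Definition stopped (T E : Type) t (q : nat -> T -> E) (w : T) : nat -> E :=
  fun j => q (minn j t) w.

Section StoppedLaws.
Context da dq (A : measurableType da) (Q : measurableType dq)
  d d' (O : measurableType d) (O' : measurableType d')
  (P : probability O F) (P' : probability O' F)
  (a : O -> A) (a' : O' -> A) (q : nat -> O -> Q) (q' : nat -> O' -> Q).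

Let stopped_law t := same_law P P'
  (fun w => (a w, stopped t q w : seq_space Q))
  (fun w => (a' w, stopped t q' w : seq_space Q)).

(** The preimages under stopping maps form a pi-system, because stopping at u and then at some r <=
    u is stopping at r; they generate the sigma-algebra because coordinate j is already seen by the
    path stopped at j. *)
Lemma same_law_stopped : (forall t, stopped_law t) ->
  same_law P P' (fun w => (a w, (fun j => q j w) : seq_space Q))
                (fun w => (a' w, (fun j => q' j w) : seq_space Q)).
Proof.
move=> ql.
have ma : measurable_fun setT a.
  by have [/(measurableT_comp measurable_fst) h _ _] := ql 0%N.
have ma' : measurable_fun setT a'.
  by have [_ /(measurableT_comp measurable_fst) h _] := ql 0%N.
have mq : measurable_fun setT (fun w => (a w, (fun j => q j w) : seq_space Q)).
  apply: measurable_fun_pair => //; apply/measurable_seqP => j.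
  have [/(measurableT_comp measurable_snd) /measurable_seqP/(_ j) + _ _] := ql j.
  by rewrite /stopped /= minnn.
have mq' : measurable_fun setT (fun w => (a' w, (fun j => q' j w) : seq_space Q)).
  apply: measurable_fun_pair => //; apply/measurable_seqP => j.
  have [_ /(measurableT_comp measurable_snd) /measurable_seqP/(_ j) + _] := ql j.
  by rewrite /stopped /= minnn.
split => // C mC.
pose stop t (z : A * seq_space Q) : A * seq_space Q := (z.1, fun j => z.2 (minn j t)).
have mstop t : measurable_fun setT (stop t).
  apply: measurable_fun_pair; first exact: measurable_fst.
  apply/measurable_seqP => j.
  exact: (measurableT_comp (measurable_seq_coord (minn j t)) measurable_snd).
have stopK r u z : (r <= u)%N -> stop r (stop u z) = stop r z.
  move=> ru; congr pair; apply/funext => j; rewrite /stop /=.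
  by rewrite -minnA (minn_idPl ru).
pose G : set (set (A * seq_space Q)) :=
  [set C | exists t D, measurable D /\ C = stop t @^-1` D].
have GT : G setT by exists 0%N, setT; rewrite preimage_setT.
apply: (@measure_unique _ _ _ G (fun=> setT) _ _ _ _
  (distribution P (mfun_of mq)) (distribution P' (mfun_of mq'))) => //.
- apply/seteqP; split; last first.
    apply: smallest_sub; first exact: sigma_algebra_measurable.
    by move=> _ [t [D [mD ->]]]; exact: measurable_preimage.
  have mid : measurable_fun setT
      (idfun : g_sigma_algebraType G -> (A * seq_space Q)%type).
    apply/measurable_fun_pairP; split.
      move=> _ B mB; apply: sub_sigma_algebra; exists 0%N, (B `*` setT).
      by split; [exact: measurableX|rewrite setTI; apply/seteqP; split=> // z []].
    apply/measurable_seqP => j _ B mB; apply: sub_sigma_algebra.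
    exists j, (setT `*` ((fun h : seq_space Q => h j) @^-1` B)); split.
      apply: measurableX => //; apply: measurable_preimage => //.
      exact: measurable_seq_coord.
    by rewrite setTI; apply/seteqP; split=> z; rewrite /stop /= minnn => // -[].
  by move=> B mB; have := mid measurableT B mB; rewrite setTI.
- move=> _ _ [t [D [mD ->]]] [s [E [mE ->]]].
  exists (maxn t s), (stop t @^-1` D `&` stop s @^-1` E); split.
    by apply: measurableI; exact: measurable_preimage.
  apply/seteqP; split=> z; rewrite /preimage /= !stopK ?leq_maxl ?leq_maxr//.
- by rewrite bigcup_const//; exists 0%N.
- by move=> _ [t [D [mD ->]]]; have [_ _] := ql t; exact.
- by move=> _; rewrite -[X in (X < _)%E]/(P setT) probability_setT ltry.
Qed.

End StoppedLaws.

Section LumpedStep.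
Context da dx dq dv dv' (A : measurableType da) (Xi : measurableType dx)
  (Q : measurableType dq) (V : measurableType dv) (V' : measurableType dv')
  d d' (O : measurableType d) (O' : measurableType d')
  (P : probability O F) (P' : probability O' F)
  (a : O -> A) (a' : O' -> A) (x : nat -> O -> Xi) (q' : nat -> O' -> Q)
  (stat : Xi -> Q) (t : nat) (v : O -> V) (v' : O' -> V')
  (Phi : A -> Xi -> V -> Xi) (Psi : A -> Q -> V' -> Q).

Let q j w := stat (x j w).

(** The chain is [x], the observed process its statistic [q]. The parameter [a] and the history of
    [q] are carried along with the current state, since joint laws of whole paths are compared and
    the transition may depend on [a]. *)
Lemma lumped_step :
  measurable_fun setT stat ->
  measurable_fun setT (fun z => Phi z.1.1 z.1.2 z.2) ->
  measurable_fun setT (fun z => Psi z.1.1 z.1.2 z.2) ->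
  measurable_fun setT v -> measurable_fun setT v' -> measurable_fun setT (x t) ->
  (forall w, x t.+1 w = Phi (a w) (x t w) (v w)) ->
  (forall w, q' t.+1 w = Psi (a' w) (q' t w) (v' w)) ->
  indep P (fun w => (a w, stopped t q w : seq_space Q, x t w)) v ->
  indep P' (fun w => (a' w, stopped t q' w : seq_space Q)) v' ->
  (forall al xi, same_law P P' (fun w => stat (Phi al xi (v w)))
                               (fun w => Psi al (stat xi) (v' w))) ->
  same_law P P' (fun w => (a w, stopped t q w : seq_space Q))
                (fun w => (a' w, stopped t q' w : seq_space Q)) ->
  same_law P P' (fun w => (a w, stopped t.+1 q w : seq_space Q))
                (fun w => (a' w, stopped t.+1 q' w : seq_space Q)).
Proof.
move=> ms mPhi mPsi mv mv' mx xS qS iv iv' ker hl; have [mah mah' _] := hl.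
pose S := (A * seq_space Q * Xi)%type; pose T := (A * seq_space Q)%type.
(* Recomputing the last state from [s.2] makes the kernel hypothesis applicable
   at every point of [S]. *)
pose g (s : S) : T := (s.1.1, fun j => if (j < t)%N then s.1.2 j else stat s.2).
have mh j : measurable_fun setT (fun z : T => z.2 j).
  exact: (measurableT_comp (measurable_seq_coord j) measurable_snd).
have mg : measurable_fun setT g.
  apply: measurable_fun_pair.
    exact: (measurableT_comp measurable_fst measurable_fst).
  apply/measurable_seqP => j /=; case: (j < t)%N.
    exact: (measurableT_comp (mh j) measurable_fst).
  exact: (measurableT_comp ms measurable_snd).
have gX w : g (a w, stopped t q w, x t w) = (a w, stopped t q w).
  congr pair; apply/funext => j; rewrite /stopped /q.
  by rewrite /=; case: (ltnP j t) => // tj; rewrite (minn_idPr tj).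
pose Phi' (s : S) (v : V) := stat (Phi s.1.1 s.2 v).
pose Psi' (s : T) (v : V') := Psi s.1 (s.2 t) v.
have mPhi' : measurable_fun setT (fun z : S * V => Phi' z.1 z.2).
  apply: (measurableT_comp ms); apply: (measurableT_comp mPhi
    (g := fun z : S * V => (z.1.1.1, z.1.2, z.2))).
  apply: measurable_fun_pair; last exact: measurable_snd.
  apply: measurable_fun_pair.
    apply: (measurableT_comp measurable_fst).
    exact: (measurableT_comp measurable_fst measurable_fst).
  exact: (measurableT_comp measurable_snd measurable_fst).
have mPsi' : measurable_fun setT (fun z : T * V' => Psi' z.1 z.2).
  apply: (measurableT_comp mPsi (g := fun z : T * V' => (z.1.1, z.1.2 t, z.2))).
  apply: measurable_fun_pair; last exact: measurable_snd.
  apply: measurable_fun_pair.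
    exact: (measurableT_comp measurable_fst measurable_fst).
  exact: (measurableT_comp (mh t) measurable_fst).
have hl' : same_law P P' (g \o (fun w => (a w, stopped t q w : seq_space Q, x t w)))
                   (fun w => (a' w, stopped t q' w : seq_space Q)).
  by rewrite (_ : _ \o _ = fun w => (a w, stopped t q w : seq_space Q))//;
    apply/funext => w /=; rewrite gX.
have ker' (s : S) : same_law P P' (fun w => Phi' s (v w)) (fun w => Psi' (g s) (v' w)).
  by rewrite /Psi' /g /= ltnn; exact: ker.
have mX : measurable_fun setT (fun w => (a w, stopped t q w : seq_space Q, x t w)).
  exact: measurable_fun_pair.
have := same_law_step mX mv mv' mg mPhi' mPsi' iv iv' hl' ker'.
(* Appends the new statistic and keeps it constant from t + 1 on, as a path stopped at t + 1
   requires. *)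
pose f (z : T * Q) : T := (z.1.1, fun j => if (j <= t)%N then z.1.2 j else z.2).
have mf : measurable_fun setT f.
  apply: measurable_fun_pair.
    exact: (measurableT_comp measurable_fst measurable_fst).
  apply/measurable_seqP => j /=; case: (j <= t)%N; last exact: measurable_snd.
  exact: (measurableT_comp (mh j) measurable_fst).
move=> /(same_law_comp mf); congr same_law; apply/funext => w /=; rewrite /f /=.
  congr pair; apply/funext => j; rewrite /stopped /q /Phi' /=.
  case: (leqP j t) => jt; last by rewrite (minn_idPr jt) xS.
  rewrite (minn_idPl (leqW jt)); case: (ltnP j t) => // tj.
  by rewrite (_ : j = t)//; apply/eqP; rewrite eqn_leq jt.
congr pair; apply/funext => j; rewrite /stopped /Psi' /=.
case: (leqP j t) => jt; first by rewrite (minn_idPl (leqW jt)).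
by rewrite (minn_idPr jt) qS minnn.
Qed.

End LumpedStep.
End PathLaws.

(** * Gaussian inputs of the filter *)

Section KalmanAlgebra.
Context {F : realType}.

Lemma posdef_unit n (M : 'M[F]_n) : posdefmx M -> M \in unitmx.
Proof.
move=> [_ pM]; rewrite -row_free_unit -kermx_eq0 -nz_row_eq0.
set u := nz_row _; have /sub_kermxP uM : (u <= kermx M)%MS := nz_row_sub _.
apply/negPn/negP => u0; have := pM u^T.
by rewrite trmx_eq0 trmxK uM mul0mx mxE ltxx => /(_ u0).
Qed.

Lemma sqrtmx_unit n (M : 'M[F]_n) : posdefmx M -> sqrtmx M \in unitmx.
Proof.
move=> pM; have := posdef_unit pM; rewrite -{1}(sqrtmxK (posdef_psd pM)).
by rewrite unitmx_mul => /andP[].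
Qed.

Variables (d d0 : nat) (B : 'M[F]_(d0, d)) (R0 : 'M[F]_d0).
Hypothesis R0_pd : posdefmx R0.

Lemma Rhat_psd p : psdmx (Rhat B R0 p).
Proof. by apply: psdmx_conj; exact: posdef_psd. Qed.

Lemma Rhat_gram p :
  Rhat B R0 p = (gain B R0 p *m sqrtmx R0) *m (gain B R0 p *m sqrtmx R0)^T.
Proof.
have pR0 := posdef_psd R0_pd.
rewrite trmx_mul (sqrtmx_psd pR0).1 mulmxA -(mulmxA (gain B R0 p)).
by rewrite sqrtmxK.
Qed.

(** The Joseph form of the covariance update. Positivity of p makes B p B' + R0 invertible, so K (B
    p B' + R0) = p B', whence Ahat p B' = K R0; multiplying by K' gives Ahat p - Ahat p Ahat' = K R0
    K'. *)
Lemma Ahat_joseph p : psdmx p ->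
  Ahat B R0 p *m p *m (Ahat B R0 p)^T + Rhat B R0 p = Ahat B R0 p *m p.
Proof.
move=> pp; set K := gain B R0 p; set S := B *m p *m B^T + R0.
have uS : S \in unitmx.
  apply: posdef_unit; split.
    by rewrite ((psdmxD (psdmx_conj B pp) (posdef_psd R0_pd)).1).
  move=> v v0; rewrite mulmxDr mulmxDl mxE ltr_wpDl//.
    exact: (psdmx_conj B pp).2.
  exact: R0_pd.2.
have KS : K *m S = p *m B^T by rewrite /K /gain -/S mulmxKV.
have e : Ahat B R0 p *m p *m B^T = K *m R0.
  rewrite /Ahat -/K mulmxBl mul1mx mulmxBl -{1}KS /S.
  by rewrite mulmxDr !mulmxA addrC addKr.
rewrite {2}/Ahat -/K linearB/= trmx1 trmx_mul mulmxBr mulmx1.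
by rewrite mulmxA e /Rhat -/K subrK.
Qed.

End KalmanAlgebra.

Section GaussianNoise.
Context {F : realType} d (O : measurableType d) (P : probability O F).
Local Open Scope ereal_scope.

Lemma sigma_of_measurable d' (E : measurableType d') (X : O -> E) :
  measurable_fun setT X -> sigma_of X `<=` measurable.
Proof. by move=> mX _ [A mA <-]; exact: mX. Qed.

Lemma sigma_of_setI d' (E : measurableType d') (X : O -> E) :
  setI_closed (sigma_of X).
Proof.
move=> _ _ [A mA <-] [B mB <-]; exists (A `&` B); first exact: measurableI.
by rewrite !setTI.
Qed.

Lemma sigma_of_setT d' (E : measurableType d') (X : O -> E) :
  sigma_of X setT.
Proof. by exists setT => //; rewrite setTI. Qed.

Lemma sigma_of_preimage d' (E : measurableType d') (X : O -> E) A :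
  measurable A -> sigma_of X (X @^-1` A).
Proof. by move=> mA; exists A => //; rewrite setTI. Qed.

Lemma std_gaussian_family m n (Z : O -> 'M[F]_(m, n)) : std_gaussian P Z ->
  normal_family P (fun (ij : 'I_m * 'I_n) w => Z w ij.1 ij.2).
Proof.
move=> [mZ lZ iZ]; split=> [ij|B mB]; first exact: mZ.
have := @mutually_independent_seq _ _ _ _ _ _ (enum {: 'I_m * 'I_n})
  (fun ij => (fun w => Z w ij.1 ij.2) @^-1` B ij) iZ (enum_uniq _).
have -> : [set` enum {: 'I_m * 'I_n}] = setT.
  by apply/seteqP; split=> // ij _ /=; rewrite mem_enum.
move=> ->; last by move=> ij _; exact: sigma_of_preimage.
by rewrite big_enum/=; apply: eq_bigr => ij _; exact: lZ.
Qed.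

Lemma gaussian_whiten k (X : O -> 'cV[F]_k) C : posdefmx C ->
  gaussian P X 0 C -> std_gaussian P (fun w => invmx (sqrtmx C) *m X w)%R.
Proof.
move=> pC [Z gZ XE]; rewrite (_ : (fun _ => _) = Z)//; apply/funext => w.
by rewrite XE add0r mulKmx// sqrtmx_unit.
Qed.

(** Written as a function of the [X i], rather than taken from the witnesses in [gaussian], so that
    it is measurable for the sigma-algebras whose independence is assumed. *)
Definition whitened k N (X : 'I_N -> O -> 'cV[F]_k) C (w : O) : 'M[F]_(k, N) :=
  \matrix_(a, i) (invmx (sqrtmx C) *m X i w)%R a 0%R.

Lemma whitenedK k N (X : 'I_N -> O -> 'cV[F]_k) C w i : posdefmx C ->
  (sqrtmx C *m col i (whitened X C w))%R = X i w.
Proof.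
move=> pC; rewrite (_ : col i _ = invmx (sqrtmx C) *m X i w)%R.
  by rewrite mulmxA mulmxV ?mul1mx// sqrtmx_unit.
by apply/matrixP => a b; rewrite ord1 !mxE.
Qed.

Let prod_pair m n (f : 'I_m * 'I_n -> \bar F) :
  \prod_ij f ij = \prod_i \prod_j f (i, j).
Proof. by rewrite pair_bigA; apply: eq_bigr => -[]. Qed.

Lemma whitened_family (I : choiceType) (G : I -> set (set O)) k N
    (X : 'I_N -> O -> 'cV[F]_k) (idx : 'I_N -> I) C :
  mutually_independent P G -> injective idx ->
  (forall i, G (idx i) = sigma_of (X i)) ->
  posdefmx C -> (forall i, gaussian P (X i) 0 C) ->
  normal_family P (fun (ai : 'I_k * 'I_N) w => whitened X C w ai.1 ai.2).
Proof.
move=> iG inj GX pC gX.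
pose Z i w := (invmx (sqrtmx C) *m X i w)%R.
have fZ i := std_gaussian_family (gaussian_whiten pC (gX i)).
have Ze (i : 'I_N) (a : 'I_k) w : whitened X C w a i = Z i w a 0%R by rewrite mxE.
split=> [[a i]|B mB].
  by under eq_fun do rewrite Ze; exact: ((fZ i).1 (a, 0%R)).
pose D i := \bigcap_(a in setT) (fun v : 'cV[F]_k =>
   (invmx (sqrtmx C) *m v)%R a 0%R) @^-1` B (a, i).
have mD i : measurable (D i).
  apply: fin_bigcap_measurable; first exact: finite_finset.
  move=> a _; apply: measurable_preimage => //.
  have : measurable_fun setT (fun v : 'cV[F]_k => invmx (sqrtmx C) *m v)%R.
    by apply: measurable_mulmx; [exact: measurable_cst|exact: measurable_id].
  by move=> /measurable_mxP; exact.
(* A partial inverse of [idx] extends the events attached to the [X i] to a family over all of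
   [I]. *)
have [f fK] : exists f : I -> option 'I_N, forall i, f (idx i) = Some i.
  exists (fun k => [pick i | idx i == k]) => i.
  by case: pickP => [j /eqP/inj ->//|/(_ i)]; rewrite eqxx.
pose E k := if f k is Some i then X i @^-1` D i else setT.
have := @mutually_independent_seq _ _ _ _ _ _ (map idx (enum 'I_N)) E iG.
rewrite map_inj_uniq ?enum_uniq// => /(_ isT) h.
transitivity (P (\bigcap_(k in [set` map idx (enum 'I_N)]) E k)).
  congr (P _); apply/seteqP; split=> w /= Bw.
    move=> _ /= /mapP[i _ ->]; rewrite /E fK => a _ /=.
    by have := Bw (a, i) Logic.I; rewrite /= Ze.
  move=> [a i] _ /=; rewrite Ze.
  have := Bw (idx i); rewrite /= map_f ?mem_enum// => /(_ isT).
  by rewrite /E fK; apply.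
rewrite h; last by move=> _ /mapP[i _ ->]; rewrite GX /E fK; exact: sigma_of_preimage.
rewrite big_map big_enum/= prod_pair exchange_big/=; apply: eq_bigr => i _; rewrite /E fK.
have := (fZ i).2 (fun ab => B (ab.1, i)) (fun ab => mB _).
rewrite prod_pair/=.
under eq_bigr do rewrite big_ord1.
move=> <-; congr (P _); apply/seteqP; split=> w /= Dw.
  by move=> [a b] _ /=; rewrite ord1; exact: (Dw a Logic.I).
by move=> a _; exact: (Dw (a, 0%R) Logic.I).
Qed.

Lemma mean_cov_inputs_family (I : choiceType) (G : I -> set (set O)) k m N
    (z : O -> 'cV[F]_k) (Z : O -> 'M[F]_(m, N)) (iz iZ : I) :
  mutually_independent P G -> iz != iZ ->
  G iz = sigma_of z -> G iZ = sigma_of Z -> std_gaussian P z ->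
  std_gaussian P Z -> normal_family P (mean_cov_inputs z Z).
Proof.
move=> iG izZ Gz GZ gz gZ; have [mz _ _] := gz; have [mZ _ _] := gZ.
split=> [[a|[a b]]|B mB]; first exact: mz; first exact: mZ.
pose Dz := \bigcap_(a in setT) (fun v : 'cV[F]_k => v a 0%R) @^-1` B (inl a).
pose DZ := \bigcap_(ab in setT) (fun v : 'M[F]_(m, N) => v ab.1 ab.2) @^-1` B (inr ab).
have mDz : measurable Dz.
  apply: fin_bigcap_measurable; first exact: finite_finset.
  by move=> a _; apply: measurable_preimage => //; exact: measurable_mx_entry.
have mDZ : measurable DZ.
  apply: fin_bigcap_measurable; first exact: finite_finset.
  by move=> a _; apply: measurable_preimage => //; exact: measurable_mx_entry.
have := @mutually_independent_seq _ _ _ _ _ _ [:: iz; iZ]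
  (fun i => if i == iz then z @^-1` Dz else Z @^-1` DZ) iG.
rewrite /= inE izZ andbT => /(_ isT) h.
transitivity (P (z @^-1` Dz `&` Z @^-1` DZ)).
  congr (P _); apply/seteqP; split=> w /=.
    move=> Bw; split=> a _ /=; first exact: (Bw (inl a) Logic.I).
    exact: (Bw (inr a) Logic.I).
  by move=> [Dw DZw] [a|a] _ /=; [exact: (Dw a Logic.I)|exact: (DZw a Logic.I)].
move: h; rewrite !big_cons big_nil mule1 eqxx eq_sym (negbTE izZ) => h.
transitivity (P (z @^-1` Dz) * P (Z @^-1` DZ)).
  rewrite -h; last first.
    move=> i; rewrite !inE => /orP[/eqP ->|/eqP ->].
      by rewrite eqxx Gz; exact: sigma_of_preimage.
    by rewrite eq_sym (negbTE izZ) GZ; exact: sigma_of_preimage.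
  congr (P _); apply/seteqP; split=> w /=.
    move=> [Dw DZw] i /=; rewrite !inE => /orP[/eqP ->|/eqP ->].
      by rewrite eqxx.
    by rewrite eq_sym (negbTE izZ).
  move=> Ew; have := Ew iz; have := Ew iZ.
  by rewrite /= !inE !eqxx orbT eq_sym (negbTE izZ) /= => /(_ isT) ? /(_ isT).
rewrite big_sumType/=; congr (_ * _).
  have [_ /(_ (fun ab => B (inl ab.1))) lz] := std_gaussian_family gz.
  rewrite -[LHS](_ : P (\bigcap_(ab in setT)
      (fun w => z w ab.1 ab.2) @^-1` B (inl ab.1)) = _).
    rewrite lz// prod_pair/=.
    by apply: eq_bigr => a _; rewrite big_ord1.
  congr (P _); apply/seteqP; split=> w /= Dw.
    by move=> a _; exact: (Dw (a, 0%R) Logic.I).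
  by move=> [a b] _ /=; rewrite ord1; exact: (Dw a Logic.I).
have [_ /(_ (fun ab => B (inr ab))) lZ] := std_gaussian_family gZ.
exact: lZ.
Qed.

End GaussianNoise.

(** * Measurability with respect to blocks of inputs *)

Section Adapted.
Context {F : realType} d (O : measurableType d) (P : probability O F).
Variables (I : choiceType) (G : I -> set (set O)).

(** Adaptedness is ordinary measurability once O carries the sigma-algebra generated by the inputs
    in S, so the measurability lemmas for matrix operations, valid on any domain, apply to it
    directly. *)
Definition adapted d' (E : measurableType d') (S : set I) (X : O -> E) :=
  measurable_fun (setT : set (g_sigma_algebraType (\bigcup_(i in S) G i))) X.

Lemma adapted_input d' (E : measurableType d') S (X : O -> E) i :
  S i -> G i = sigma_of X -> adapted S X.
Proof.
move=> Si GX _ A mA; apply: sub_sigma_algebra; exists i => //.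
by rewrite GX setTI; exact: sigma_of_preimage.
Qed.

Lemma adapted_measurable d' (E : measurableType d') S (X : O -> E) :
  (forall i, G i `<=` measurable) -> adapted S X -> measurable_fun setT X.
Proof.
move=> mG aX _ A mA; have := aX measurableT A mA.
apply: smallest_sub; first exact: sigma_algebra_measurable.
by move=> C [i _]; exact: mG.
Qed.

Lemma adapted_indep d1 d2 (E1 : measurableType d1) (E2 : measurableType d2)
    S1 S2 (X : O -> E1) (Y : O -> E2) :
  (forall i, G i `<=` measurable) -> (forall i, setI_closed (G i)) ->
  (forall i, G i setT) -> mutually_independent P G ->
  (forall i, S1 i -> ~ S2 i) -> adapted S1 X -> adapted S2 Y -> indep P X Y.
Proof.
move=> mG GI GT iG S12 aX aY A B mA mB.
apply: (independent_blocks mG GI GT iG S12).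
  by have := aX measurableT A mA; rewrite setTI.
by have := aY measurableT B mB; rewrite setTI.
Qed.

End Adapted.

(** * The half-steps and their kernels *)

Section Steps.
Context {F : realType} (d d0 N : nat) (dN : (d <= N)%N)
  (A : 'M[F]_d) (B : 'M[F]_(d0, d)) (R : 'M[F]_d) (R0 : 'M[F]_d0).

Local Notation obs := (seq_space ('cV[F]_d * 'cV[F]_d0)%type).
Local Notation state := ('cV[F]_d * 'M[F]_d)%type.
Local Notation ens := ('M[F]_(d, N.+1)).

Definition mean_cov (x : ens) : state := (mxmean x, mxcov x).

(** The particle update regrouped into the shape L x + b 1' + M V, with whitened noise; M is
    negative because the perturbation of the observation is subtracted. *)
Definition ens_update n (y : obs) (x : ens) (V : 'M[F]_(d0, N.+1)) : ens :=
  let K := gain B R0 (mxcov x) in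
  Ahat B R0 (mxcov x) *m x + K *m (y n).2 *m (const_mx 1)^T +
    - (K *m sqrtmx R0) *m V.

Definition ens_predict (y : obs) (x : ens) (V : 'M[F]_(d, N.+1)) : ens :=
  A *m x + (0 : 'cV[F]_d) *m (const_mx 1)^T + sqrtmx R *m V.

(* The covariance part is not put in the form [Ahat p Ahat' + Rhat], which agrees
   with it only where [p] is positive semi-definite. *)
Definition state_update n (y : obs) (q : state)
    (v : 'cV[F]_d0 * 'M[F]_(d, N)) : state :=
  (q.1 + gain B R0 q.2 *m ((y n).2 - B *m q.1) +
     (Num.sqrt N.+1%:R)^-1 *: (gain B R0 q.2 *m sqrtmx R0 *m v.1),
   Ahat B R0 q.2 *m q.2 + (Num.sqrt N%:R)^-1 *:
     Delta dN (Rhat B R0 q.2) (Ahat B R0 q.2 *m q.2 *m (Ahat B R0 q.2)^T) v.2).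

Definition state_predict (y : obs) (q : state)
    (v : 'cV[F]_d * 'M[F]_(d, N)) : state :=
  (A *m q.1 + (Num.sqrt N.+1%:R)^-1 *: (sqrtmx R *m v.1),
   A *m q.2 *m A^T + R + (Num.sqrt N%:R)^-1 *: Delta dN R (A *m q.2 *m A^T) v.2).

Section Measurability.
Context dT (T : measurableType dT).

Lemma measurable_mxmean (x : T -> ens) :
  measurable_fun setT x -> measurable_fun setT (fun w => mxmean (x w)).
Proof.
move=> mx; under eq_fun do rewrite mxmeanE.
apply: measurable_scalemx; first exact: measurable_cst.
by apply: measurable_mulmx => //; exact: measurable_cst.
Qed.

Lemma measurable_mxcov (x : T -> ens) :
  measurable_fun setT x -> measurable_fun setT (fun w => mxcov (x w)).
Proof.
move=> mx; under eq_fun do rewrite (mxcovE _).2.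
have my : measurable_fun setT (fun w => x w - mxmean (x w) *m (const_mx 1)^T).
  apply: measurable_addmx => //; apply: measurable_oppmx.
  apply: measurable_mulmx; last exact: measurable_cst.
  exact: measurable_mxmean.
apply: measurable_scalemx; first exact: measurable_cst.
by apply: measurable_mulmx => //; exact: measurable_trmx.
Qed.

Let measurable_Ahat (p : T -> 'M[F]_d) :
  measurable_fun setT p -> measurable_fun setT (fun w => Ahat B R0 (p w)).
Proof.
move=> mp; apply: measurable_addmx; first exact: measurable_cst.
apply: measurable_oppmx; apply: measurable_mulmx; last exact: measurable_cst.
exact: measurable_gain.
Qed.

Lemma measurable_ens_update n (y : T -> obs) (x : T -> ens) V :
  measurable_fun setT y -> measurable_fun setT x -> measurable_fun setT V ->
  measurable_fun setT (fun w => ens_update n (y w) (x w) (V w)).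
Proof.
move=> my mx mV; have mp := measurable_mxcov mx.
have mK := measurable_gain B R0 mp.
have myn : measurable_fun setT (fun w => (y w n).2).
  by apply: (measurableT_comp measurable_snd); move/measurable_seqP: my; apply.
apply: measurable_addmx; first apply: measurable_addmx.
- by apply: measurable_mulmx => //; exact: measurable_Ahat.
- by apply: measurable_mulmx; [exact: measurable_mulmx|exact: measurable_cst].
- apply: measurable_mulmx => //; apply: measurable_oppmx.
  by apply: measurable_mulmx => //; exact: measurable_cst.
Qed.

Lemma measurable_ens_predict (y : T -> obs) (x : T -> ens) V :
  measurable_fun setT x -> measurable_fun setT V ->
  measurable_fun setT (fun w => ens_predict (y w) (x w) (V w)).
Proof.
move=> mx mV; have mc m n (M : 'M[F]_(m, n)) : measurable_fun setT (fun _ : T => M).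
  exact: measurable_cst.
apply: measurable_addmx; first apply: measurable_addmx => //.
- exact: measurable_mulmx.
- exact: measurable_mulmx.
Qed.

Lemma measurable_state_update n (y : T -> obs) (q : T -> state) v :
  measurable_fun setT y -> measurable_fun setT q -> measurable_fun setT v ->
  measurable_fun setT (fun w => state_update n (y w) (q w) (v w)).
Proof.
move=> my mq mv; have mc k l (M : 'M[F]_(k, l)) : measurable_fun setT (fun _ : T => M).
  exact: measurable_cst.
have m1 : measurable_fun setT (fun w => (q w).1).
  exact: (measurableT_comp measurable_fst mq).
have m2 : measurable_fun setT (fun w => (q w).2).
  exact: (measurableT_comp measurable_snd mq).
have v1 : measurable_fun setT (fun w => (v w).1).
  exact: (measurableT_comp measurable_fst mv).
have v2 : measurable_fun setT (fun w => (v w).2).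
  exact: (measurableT_comp measurable_snd mv).
have mK := measurable_gain B R0 m2; have mA := measurable_Ahat m2.
have myn : measurable_fun setT (fun w => (y w n).2).
  by apply: (measurableT_comp measurable_snd); move/measurable_seqP: my; apply.
apply: measurable_fun_pair.
  apply: measurable_addmx; first apply: measurable_addmx => //.
    apply: measurable_mulmx => //; apply: measurable_addmx => //.
    by apply: measurable_oppmx; exact: measurable_mulmx.
  apply: measurable_scalemx; first exact: measurable_cst.
  by apply: measurable_mulmx => //; exact: measurable_mulmx.
apply: measurable_addmx; first exact: measurable_mulmx.
apply: measurable_scalemx; first exact: measurable_cst.
apply: measurable_Delta => //.
  apply: measurable_mulmx; first exact: measurable_mulmx.
  exact: measurable_trmx.
apply: measurable_mulmx; last exact: measurable_trmx.
exact: measurable_mulmx.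
Qed.

Lemma measurable_state_predict (y : T -> obs) (q : T -> state) v :
  measurable_fun setT q -> measurable_fun setT v ->
  measurable_fun setT (fun w => state_predict (y w) (q w) (v w)).
Proof.
move=> mq mv; have mc k l (M : 'M[F]_(k, l)) : measurable_fun setT (fun _ : T => M).
  exact: measurable_cst.
have m1 : measurable_fun setT (fun w => (q w).1).
  exact: (measurableT_comp measurable_fst mq).
have m2 : measurable_fun setT (fun w => (q w).2).
  exact: (measurableT_comp measurable_snd mq).
have v1 : measurable_fun setT (fun w => (v w).1).
  exact: (measurableT_comp measurable_fst mv).
have v2 : measurable_fun setT (fun w => (v w).2).
  exact: (measurableT_comp measurable_snd mv).
have mD : measurable_fun setT (fun w => A *m (q w).2 *m A^T).
  by apply: measurable_mulmx => //; exact: measurable_mulmx.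
apply: measurable_fun_pair.
  apply: measurable_addmx; first exact: measurable_mulmx.
  apply: measurable_scalemx; first exact: measurable_cst.
  exact: measurable_mulmx.
apply: measurable_addmx; first exact: measurable_addmx.
apply: measurable_scalemx; first exact: measurable_cst.
exact: measurable_Delta.
Qed.

End Measurability.

Section Kernels.
Hypotheses (N0 : (0 < N)%N) (R_pd : posdefmx R) (R0_pd : posdefmx R0).
Context dO dO' (O : measurableType dO) (O' : measurableType dO')
  (P : probability O F) (P' : probability O' F).

(** The general step yields the covariance Ahat p Ahat' + Rhat, which [Ahat_joseph] turns into Ahat
    p because p is a sample covariance. The sign of the noise coefficient disappears in its Gram
    matrix. *)
Lemma update_kernel n y (x : ens) (V : O -> 'M[F]_(d0, N.+1))
    (z : O' -> 'cV[F]_d0) (Z : O' -> 'M[F]_(d, N)) :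
  normal_family P (fun (ai : 'I_d0 * 'I_N.+1) w => V w ai.1 ai.2) ->
  normal_family P' (mean_cov_inputs z Z) ->
  same_law P P' (fun w => mean_cov (ens_update n y x (V w)))
                (fun w => state_update n y (mean_cov x) (z w, Z w)).
Proof.
move=> NV NzZ; have pp := mxcov_psd x; set p := mxcov x in pp.
have G1 : - (gain B R0 p *m sqrtmx R0) *m (- (gain B R0 p *m sqrtmx R0))^T =
    Rhat B R0 p by rewrite linearN/= mulNmx mulmxN opprK -Rhat_gram.
have := ensemble_step_law dN N0 x (Ahat B R0 p) (gain B R0 p *m (y n).2)
  (Rhat_psd B R0_pd p) G1 (esym (Rhat_gram B R0_pd p)) NV NzZ.
congr same_law; apply/funext => w; rewrite /state_update /=; congr (_, _ + _).
  rewrite -/p mulmxBr mulmxA /Ahat mulmxBl mul1mx.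
  by congr (_ + _); rewrite addrA [RHS]addrAC.
by rewrite Ahat_joseph.
Qed.

Lemma predict_kernel y (x : ens) (V : O -> 'M[F]_(d, N.+1))
    (z : O' -> 'cV[F]_d) (Z : O' -> 'M[F]_(d, N)) :
  normal_family P (fun (ai : 'I_d * 'I_N.+1) w => V w ai.1 ai.2) ->
  normal_family P' (mean_cov_inputs z Z) ->
  same_law P P' (fun w => mean_cov (ens_predict y x (V w)))
                (fun w => state_predict y (mean_cov x) (z w, Z w)).
Proof.
move=> NV NzZ; have pR := posdef_psd R_pd.
have GR : sqrtmx R *m (sqrtmx R)^T = R by rewrite (sqrtmx_psd pR).1 sqrtmxK.
have := ensemble_step_law dN N0 x A 0 pR GR GR NV NzZ.
by congr same_law; apply/funext => w; rewrite /state_predict /= addr0.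
Qed.

End Kernels.
End Steps.

Lemma measurable_whitened (F : realType) d (T : measurableType d) k N
    (X : 'I_N -> T -> 'cV[F]_k) C : (forall i, measurable_fun setT (X i)) ->
  measurable_fun setT (whitened X C).
Proof.
move=> mX; apply/measurable_mxP => a i; under eq_fun do rewrite mxE.
have : measurable_fun setT (fun w => invmx (sqrtmx C) *m X i w).
  by apply: measurable_mulmx => //; exact: measurable_cst.
by move=> /measurable_mxP; exact.
Qed.

Lemma gaussian_measurable (F : realType) d (O : measurableType d)
    (P : probability O F) n (X : O -> 'cV[F]_n) mu C :
  gaussian P X mu C -> measurable_fun setT X.
Proof.
move=> [Z [mZ _ _] XE]; rewrite (funext XE).
apply: measurable_addmx; first exact: measurable_cst.
apply: measurable_mulmx; first exact: measurable_cst.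
by apply/measurable_mxP => i j; exact: mZ.
Qed.

Lemma half_cases t : exists n, t = n.*2 \/ t = n.*2.+1.
Proof.
exists t./2; rewrite -{1 3}(odd_double_half t).
by case: odd; [right|left].
Qed.

(** * The ensemble as an adapted process *)

Section EnsembleSide.
Context (F : realType) (d d0 N : nat) (A : 'M[F]_d) (B : 'M[F]_(d0, d))
  (R : 'M[F]_d) (R0 : 'M[F]_d0) (dO : measure_display) (O : measurableType dO)
  (P : probability O F) (X : nat -> O -> 'cV[F]_d) (Y : nat -> O -> 'cV[F]_d0)
  (xi xih cW : nat -> 'I_N.+1 -> O -> 'cV[F]_d)
  (cV : nat -> 'I_N.+1 -> O -> 'cV[F]_d0).
Hypotheses (R_pd : posdefmx R) (R0_pd : posdefmx R0)
  (mXY : measurable_fun setT (path2 X Y))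
  (model : enkf A B R R0 P X Y xi xih cW cV).

(* Even times are predictions, odd times are updates. *)
Definition ensemble_at t w : 'M[F]_(d, N.+1) :=
  \matrix_(a, i) (if odd t then xih t./2 i w else xi t./2 i w) a 0.

Lemma col_ensemble_even n i w : col i (ensemble_at n.*2 w) = xi n i w.
Proof.
by apply/matrixP => a b; rewrite !mxE ord1 odd_double doubleK.
Qed.

Lemma col_ensemble_odd n i w : col i (ensemble_at n.*2.+1 w) = xih n i w.
Proof.
by apply/matrixP => a b; rewrite !mxE ord1 oddS odd_double/= uphalf_double.
Qed.

Let col_inj (x y : 'M[F]_(d, N.+1)) : (forall i, col i x = col i y) -> x = y.
Proof.
move=> xy; apply/matrixP => a i.
by have := congr1 (fun v : 'cV_d => v a 0) (xy i); rewrite !mxE.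
Qed.

Let col_ones k (v : 'cV[F]_k) (i : 'I_N.+1) : col i (v *m (const_mx 1)^T) = v.
Proof. by apply/matrixP => a b; rewrite (ord1 b) !mxE big_ord1 !mxE mulr1. Qed.

Let col_mulmx k l (L : 'M[F]_(k, l)) (x : 'M[F]_(l, N.+1)) i :
  col i (L *m x) = L *m col i x.
Proof. by rewrite !colE mulmxA. Qed.

Lemma ensemble_at_update n w : ensemble_at n.*2.+1 w =
  ens_update B R0 n (path2 X Y w) (ensemble_at n.*2 w) (whitened (cV n) R0 w).
Proof.
apply: col_inj => i; rewrite col_ensemble_odd (enkf_update model).
have -> : sample_cov (fun j => xi n j w) = mxcov (ensemble_at n.*2 w).
  by congr sample_cov; apply/funext => j; rewrite col_ensemble_even.
rewrite /ens_update !linearD/= col_ones !col_mulmx col_ensemble_even.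
set K := gain _ _ _; rewrite mulNmx -(mulmxA K (sqrtmx R0)) whitenedK//.
rewrite /Ahat -/K mulmxBl mul1mx mulmxN.
by rewrite mulmxN mulmxA -!addrA; congr (_ + _); rewrite addrCA.
Qed.

Lemma ensemble_at_predict n w : ensemble_at n.+1.*2 w =
  ens_predict A R (path2 X Y w) (ensemble_at n.*2.+1 w) (whitened (cW n.+1) R w).
Proof.
apply: col_inj => i; rewrite col_ensemble_even (enkf_predict model).
rewrite /ens_predict mul0mx addr0 linearD/= !col_mulmx col_ensemble_odd.
by rewrite whitenedK.
Qed.

Definition ens_index := (unit + 'I_N.+1 + nat * 'I_N.+1 + nat * 'I_N.+1)%type.

Definition ens_fam : ens_index -> set (set O) :=
  (fun _ : unit => sigma_of (path2 X Y)) \+fam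
  (fun i : 'I_N.+1 => sigma_of (xi 0%N i)) \+fam
  (fun ni : nat * 'I_N.+1 => sigma_of (cW ni.1.+1 ni.2)) \+fam
  (fun ni : nat * 'I_N.+1 => sigma_of (cV ni.1 ni.2)).

(* The first time at which [ensemble_at] depends on the input. *)
Definition ens_time (k : ens_index) : nat := match k with
  | inl (inl _) => 0
  | inl (inr ni) => ni.1.*2.+2
  | inr ni => ni.1.*2.+1 end.

Let mxi0 i : measurable_fun setT (xi 0%N i).
Proof. by case: (enkf_init model i). Qed.

Let mcW n i : measurable_fun setT (cW n.+1 i).
Proof. exact: gaussian_measurable (enkf_W model n i). Qed.

Let mcV n i : measurable_fun setT (cV n i).
Proof. exact: gaussian_measurable (enkf_V model n i). Qed.

Lemma ens_fam_measurable k : ens_fam k `<=` measurable.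
Proof. by case: k => [[[[]|i]|[n i]]|[n i]]; apply: sigma_of_measurable. Qed.

Lemma ens_fam_setI k : setI_closed (ens_fam k).
Proof. by case: k => [[[[]|i]|ni]|ni]; exact: sigma_of_setI. Qed.

Lemma ens_fam_setT k : ens_fam k setT.
Proof. by case: k => [[[[]|i]|ni]|ni]; exact: sigma_of_setT. Qed.

Lemma adapted_path S : S (inl (inl (inl tt))) -> adapted ens_fam S (path2 X Y).
Proof. by move=> SXY; exact: (adapted_input SXY). Qed.

Lemma adapted_whitened_cV S n : (forall i, S (inr (n, i))) ->
  adapted ens_fam S (whitened (cV n) R0).
Proof.
by move=> Si; apply: measurable_whitened => i; exact: (adapted_input (Si i)).
Qed.

Lemma adapted_whitened_cW S n : (forall i, S (inl (inr (n, i)))) ->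
  adapted ens_fam S (whitened (cW n.+1) R).
Proof.
by move=> Si; apply: measurable_whitened => i; exact: (adapted_input (Si i)).
Qed.

Lemma adapted_ensemble_init S : (forall i, S (inl (inl (inr i)))) ->
  adapted ens_fam S (ensemble_at 0).
Proof.
move=> Si; apply/measurable_mxP => a i.
rewrite (_ : (fun w => _) = fun w => xi 0%N i w a 0); last first.
  by apply/funext => w; rewrite mxE.
have : adapted ens_fam S (xi 0%N i) by exact: (adapted_input (Si i)).
by move=> /measurable_mxP; exact.
Qed.

Lemma adapted_ensemble t S : (forall k, (ens_time k <= t)%N -> S k) ->
  adapted ens_fam S (ensemble_at t).
Proof.
elim: t S => [|t IH] S St; first by apply: adapted_ensemble_init => i; exact: St.
have aE : adapted ens_fam S (ensemble_at t).
  by apply: IH => k kt; apply: St; exact: leqW.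
have aXY : adapted ens_fam S (path2 X Y) by apply: adapted_path; exact: St.
have [n [tn|tn]] := half_cases t; subst t.
- rewrite (funext (ensemble_at_update n)); apply: measurable_ens_update => //.
  by apply: adapted_whitened_cV => i; exact: St.
- rewrite -doubleS (funext (ensemble_at_predict n)).
  apply: measurable_ens_predict => //.
  by apply: adapted_whitened_cW => i; apply: St; rewrite -doubleS.
Qed.

End EnsembleSide.

(** * The recursion as an adapted process *)

Section RecursionSide.
Context (F : realType) (d d0 N : nat) (dN : (d <= N)%N)
  (A : 'M[F]_d) (B : 'M[F]_(d0, d)) (R : 'M[F]_d) (R0 : 'M[F]_d0)
  (dO : measure_display) (O : measurableType dO) (P : probability O F)
  (X : nat -> O -> 'cV[F]_d) (Y : nat -> O -> 'cV[F]_d0)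
  (Z Zh : nat -> O -> 'M[F]_(d, N))
  (z : nat -> O -> 'cV[F]_d) (zh : nat -> O -> 'cV[F]_d0)
  (m mh : nat -> O -> 'cV[F]_d) (p ph : nat -> O -> 'M[F]_d).
Hypotheses (mXY : measurable_fun setT (path2 X Y))
  (mmp : measurable_fun setT (fun w => (m 0%N w, p 0%N w)))
  (inputs : gaussian_inputs P X Y (m 0%N) (p 0%N) Z Zh z zh)
  (recursion : mean_cov_recursion dN A B R R0 Y Z Zh z zh m mh p ph).

Definition state_at t w : 'cV[F]_d * 'M[F]_d :=
  if odd t then (mh t./2 w, ph t./2 w) else (m t./2 w, p t./2 w).

Lemma state_at_even n w : state_at n.*2 w = (m n w, p n w).
Proof. by rewrite /state_at odd_double doubleK. Qed.

Lemma state_at_odd n w : state_at n.*2.+1 w = (mh n w, ph n w).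
Proof. by rewrite /state_at oddS odd_double /= uphalf_double. Qed.

Lemma state_at_update n w : state_at n.*2.+1 w =
  state_update dN B R0 n (path2 X Y w) (state_at n.*2 w) (zh n w, Zh n w).
Proof.
by rewrite state_at_odd state_at_even (mcr_mh recursion) (mcr_ph recursion).
Qed.

Lemma state_at_predict n w : state_at n.+1.*2 w =
  state_predict dN A R (path2 X Y w) (state_at n.*2.+1 w) (z n.+1 w, Z n.+1 w).
Proof.
by rewrite state_at_odd state_at_even (mcr_m recursion) (mcr_p recursion).
Qed.

Definition rec_index := (unit + unit + nat + nat + nat + nat)%type.

Definition rec_fam : rec_index -> set (set O) :=
  (fun _ : unit => sigma_of (path2 X Y)) \+fam
  (fun _ : unit => sigma_of (fun w => (m 0%N w, p 0%N w))) \+fam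
  (fun n : nat => sigma_of (Z n.+1)) \+fam
  (fun n : nat => sigma_of (Zh n)) \+fam
  (fun n : nat => sigma_of (z n.+1)) \+fam
  (fun n : nat => sigma_of (zh n)).

(** The same clock as [ens_time]. The whole path of signal and observations counts as known at time
    0, which its independence from the other inputs allows. *)
Definition rec_time (k : rec_index) : nat := match k with
  | inl (inl (inl (inl _))) => 0
  | inl (inl (inl (inr n))) => n.*2.+2
  | inl (inl (inr n)) => n.*2.+1
  | inl (inr n) => n.*2.+2
  | inr n => n.*2.+1 end.

Let measurable_std k l (U : O -> 'M[F]_(k, l)) :
  std_gaussian P U -> measurable_fun setT U.
Proof. by move=> [mU _ _]; apply/measurable_mxP. Qed.

Lemma rec_fam_measurable k : rec_fam k `<=` measurable.
Proof.
case: k => [[[[[[]|[]]|n]|n]|n]|n]; apply: sigma_of_measurable => //;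
  apply: measurable_std.
- exact: (gi_Z inputs).
- exact: (gi_Zh inputs).
- exact: (gi_z inputs).
- exact: (gi_zh inputs).
Qed.

Lemma rec_fam_setI k : setI_closed (rec_fam k).
Proof. by case: k => [[[[[[]|[]]|n]|n]|n]|n]; exact: sigma_of_setI. Qed.

Lemma rec_fam_setT k : rec_fam k setT.
Proof. by case: k => [[[[[[]|[]]|n]|n]|n]|n]; exact: sigma_of_setT. Qed.

Lemma adapted_rec_path S : S (inl (inl (inl (inl (inl tt))))) ->
  adapted rec_fam S (path2 X Y).
Proof. by move=> SXY; exact: (adapted_input SXY). Qed.

Lemma adapted_rec_init S : S (inl (inl (inl (inl (inr tt))))) ->
  adapted rec_fam S (state_at 0).
Proof. by move=> Smp; exact: (adapted_input Smp). Qed.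

Lemma adapted_rec_update S n : S (inr n) -> S (inl (inl (inr n))) ->
  adapted rec_fam S (fun w => (zh n w, Zh n w)).
Proof.
move=> S1 S2; apply: measurable_fun_pair.
  exact: (adapted_input S1).
exact: (adapted_input S2).
Qed.

Lemma adapted_rec_predict S n :
  S (inl (inr n)) -> S (inl (inl (inl (inr n)))) ->
  adapted rec_fam S (fun w => (z n.+1 w, Z n.+1 w)).
Proof.
move=> S1 S2; apply: measurable_fun_pair.
  exact: (adapted_input S1).
exact: (adapted_input S2).
Qed.

Lemma adapted_state t S : (forall k, (rec_time k <= t)%N -> S k) ->
  adapted rec_fam S (state_at t).
Proof.
elim: t S => [|t IH] S St; first by apply: adapted_rec_init; exact: St.
have aE : adapted rec_fam S (state_at t).
  by apply: IH => k kt; apply: St; exact: leqW.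
have aXY : adapted rec_fam S (path2 X Y) by apply: adapted_rec_path; exact: St.
have [n [tn|tn]] := half_cases t; subst t.
- rewrite (funext (state_at_update n)); apply: measurable_state_update => //.
  by apply: adapted_rec_update; exact: St.
- rewrite -doubleS (funext (state_at_predict n)).
  apply: measurable_state_predict => //.
  by apply: adapted_rec_predict; apply: St; rewrite -doubleS.
Qed.

End RecursionSide.

(** * Equality of the path laws *)

Theorem theorem5p2 (F : realType) (d d0 N : nat)
    (d_gt0 : (0 < d)%N) (d0_gt0 : (0 < d0)%N) (dN : (d < N.+1)%N)
    (A : 'M[F]_d) (B : 'M[F]_(d0, d))
    (R : 'M[F]_d) (R0 : 'M[F]_d0) (P0 : 'M[F]_d)
    (R_pd : posdefmx R) (R0_pd : posdefmx R0) (P0_pd : posdefmx P0)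
    (* the space of the ensemble Kalman filter *)
    (dO : measure_display) (O : measurableType dO) (P : probability O F)
    (X : nat -> O -> 'cV[F]_d) (Y : nat -> O -> 'cV[F]_d0)
    (W : nat -> O -> 'cV[F]_d) (V : nat -> O -> 'cV[F]_d0)
    (xi xih cW : nat -> 'I_N.+1 -> O -> 'cV[F]_d)
    (cV : nat -> 'I_N.+1 -> O -> 'cV[F]_d0)
    (XY_model : signal_observation A B R R0 P0 P X Y W V)
    (xi_model : enkf A B R R0 P X Y xi xih cW cV)
    (* the space of the recursion *)
    (dO' : measure_display) (O' : measurableType dO') (P' : probability O' F)
    (X' : nat -> O' -> 'cV[F]_d) (Y' : nat -> O' -> 'cV[F]_d0)
    (Z Zh : nat -> O' -> 'M[F]_(d, N))
    (z : nat -> O' -> 'cV[F]_d) (zh : nat -> O' -> 'cV[F]_d0)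
    (m mh : nat -> O' -> 'cV[F]_d) (p ph : nat -> O' -> 'M[F]_d)
    (XY'_copy : same_law P' P (path2 X' Y') (path2 X Y))
    (m0p0_copy : same_law P' P (fun w => (m 0%N w, p 0%N w))
       (fun w => (sample_mean (fun i => xi 0%N i w),
                  sample_cov (fun i => xi 0%N i w))))
    (inputs : gaussian_inputs P' X' Y' (m 0%N) (p 0%N) Z Zh z zh)
    (recursion : mean_cov_recursion (dN : (d <= N)%N) A B R R0 Y' Z Zh z zh
       m mh p ph) :
  same_law P' P
    (path6 X' Y' m p mh ph)
    (path6 X Y (fun n w => sample_mean (fun i => xi n i w))
               (fun n w => sample_cov (fun i => xi n i w))
               (fun n w => sample_mean (fun i => xih n i w))
               (fun n w => sample_cov (fun i => xih n i w))).

Proof.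
have mXY : measurable_fun setT (path2 X Y) by case: XY'_copy.
have mXY' : measurable_fun setT (path2 X' Y') by case: XY'_copy.
have mmp : measurable_fun setT (fun w => (m 0%N w, p 0%N w)) by case: m0p0_copy.
have N0 : (0 < N)%N := leq_trans d_gt0 dN.
have iG : mutually_independent P (ens_fam X Y xi cW cV) := enkf_indep xi_model.
have iG' : mutually_independent P' (rec_fam X' Y' Z Zh z zh m p) := gi_indep inputs.
have mG := ens_fam_measurable mXY xi_model.
have mG' := rec_fam_measurable mXY' mmp inputs.
pose x := ensemble_at xi xih; pose q' := state_at m mh p ph.
pose q t w := mean_cov (x t w).
have q_even n w : q n.*2 w =
    (sample_mean (fun i => xi n i w), sample_cov (fun i => xi n i w)).
  by congr pair; [congr sample_mean|congr sample_cov]; apply/funext => i;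
    rewrite /x col_ensemble_even.
have q_odd n w : q n.*2.+1 w =
    (sample_mean (fun i => xih n i w), sample_cov (fun i => xih n i w)).
  by congr pair; [congr sample_mean|congr sample_cov]; apply/funext => i;
    rewrite /x col_ensemble_odd.
have mstat : measurable_fun setT (@mean_cov F d N).
  by apply: measurable_fun_pair; [exact: measurable_mxmean|exact: measurable_mxcov].
have ax t : adapted (ens_fam X Y xi cW cV) [set k | (ens_time k <= t)%N] (x t).
  exact: (adapted_ensemble R_pd R0_pd xi_model).
(* Lumping goes from the ensemble to the recursion, so the two spaces appear in the order opposite
   to the goal; [same_law_sym] restores it at the end. *)
have main t : same_law P P'
    (fun w => (path2 X Y w, stopped t q w : seq_space _))
    (fun w => (path2 X' Y' w, stopped t q' w : seq_space _)).
  elim: t => [|t IH].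
    have q0 : same_law P P' (q 0%N) (q' 0%N).
      rewrite (_ : q 0%N = fun w => (sample_mean (fun i => xi 0%N i w),
        sample_cov (fun i => xi 0%N i w))); last by apply/funext => w; exact: (q_even 0%N).
      rewrite (_ : q' 0%N = fun w => (m 0%N w, p 0%N w))//.
      exact: same_law_sym.
    have ind : indep P (path2 X Y) (q 0%N).
      apply: (adapted_indep (S1 := [set inl (inl (inl tt))])
        (S2 := [set k | exists i, k = inl (inl (inr i))]) mG) iG _ _ _.
      - exact: ens_fam_setI.
      - exact: ens_fam_setT.
      - by move=> _ /= -> [i].
      - exact: adapted_path.
      apply: (measurableT_comp mstat); apply: adapted_ensemble_init => i.
      by exists i.
    have ind' : indep P' (path2 X' Y') (q' 0%N).
      apply: (adapted_indep (S1 := [set inl (inl (inl (inl (inl tt))))])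
        (S2 := [set inl (inl (inl (inl (inr tt))))]) mG') iG' _ _ _.
      - exact: rec_fam_setI.
      - exact: rec_fam_setT.
      - by move=> _ /= ->.
      - exact: adapted_rec_path.
      exact: adapted_rec_init.
    have := indep_same_law ind ind' (same_law_sym XY'_copy) q0.
    (* A path stopped at time 0 is constant, hence a measurable image of the initial state. *)
    have mf : measurable_fun setT (fun z : seq_space ('cV[F]_d * 'cV[F]_d0)%type *
        ('cV[F]_d * 'M[F]_d) => (z.1, (fun=> z.2) : seq_space ('cV[F]_d * 'M[F]_d)%type)).
      apply: measurable_fun_pair; first exact: measurable_fst.
      by apply/measurable_seqP => j; exact: measurable_snd.
    move=> /(same_law_comp mf); congr same_law; apply/funext => w /=;
      congr pair; apply/funext => j; by rewrite /stopped minn0.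
  have mx : measurable_fun setT (x t) := adapted_measurable mG (ax t).
  have past_indep dv (Vt : measurableType dv) (v : O -> Vt) :
      adapted (ens_fam X Y xi cW cV) [set k | ens_time k = t.+1] v ->
      indep P (fun w => (path2 X Y w, stopped t q w : seq_space _, x t w)) v.
    move=> av; apply: (adapted_indep mG (@ens_fam_setI _ _ _ _ _ _ _ _ _ _ _)
      (@ens_fam_setT _ _ _ _ _ _ _ _ _ _ _) iG _ _ av
      (S1 := [set k | (ens_time k <= t)%N])).
      by move=> k /= kt kt'; move: kt; rewrite kt' ltnn.
    apply: measurable_fun_pair; last exact: ax.
    apply: measurable_fun_pair; first exact: adapted_path.
    apply/measurable_seqP => j; apply: (measurableT_comp mstat).
    apply: (adapted_ensemble R_pd R0_pd xi_model) => k /= kj.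
    by rewrite (leq_trans kj)// geq_minr.
  have past_indep' dv (Vt : measurableType dv) (v : O' -> Vt) :
      adapted (rec_fam X' Y' Z Zh z zh m p) [set k | rec_time k = t.+1] v ->
      indep P' (fun w => (path2 X' Y' w, stopped t q' w : seq_space _)) v.
    move=> av; apply: (adapted_indep mG' (@rec_fam_setI _ _ _ _ _ _ _ _ _ _ _ _ _ _)
      (@rec_fam_setT _ _ _ _ _ _ _ _ _ _ _ _ _ _) iG' _ _ av
      (S1 := [set k | (rec_time k <= t)%N])).
      by move=> k /= kt kt'; move: kt; rewrite kt' ltnn.
    apply: measurable_fun_pair; first exact: adapted_rec_path.
    apply/measurable_seqP => j.
    apply: (adapted_state recursion) => k /= kj.
    by rewrite (leq_trans kj)// geq_minr.
  (* From t = 2n the half-step is the update at n, from t = 2n + 1 the prediction at n + 1. *)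
  have [n [tn|tn]] := half_cases t.
    have nV : adapted (ens_fam X Y xi cW cV) [set k | ens_time k = t.+1]
        (whitened (cV n) R0).
      by apply: adapted_whitened_cV => i /=; rewrite tn.
    have nz : adapted (rec_fam X' Y' Z Zh z zh m p) [set k | rec_time k = t.+1]
        (fun w => (zh n w, Zh n w)).
      by apply: adapted_rec_update; rewrite /= tn.
    apply: (@lumped_step F _ _ _ _ _ _ _ _ _ _ _ _ _ _ P P' (path2 X Y) (path2 X' Y')
      x q' (@mean_cov F d N) t (whitened (cV n) R0) (fun w => (zh n w, Zh n w))
      (ens_update B R0 n) (state_update (dN : (d <= N)%N) B R0 n)) => //.
    - apply: measurable_ens_update; last exact: measurable_snd.
        exact: (measurableT_comp measurable_fst measurable_fst).
      exact: (measurableT_comp measurable_snd measurable_fst).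
    - apply: measurable_state_update; last exact: measurable_snd.
        exact: (measurableT_comp measurable_fst measurable_fst).
      exact: (measurableT_comp measurable_snd measurable_fst).
    - exact: adapted_measurable nV.
    - exact: adapted_measurable nz.
    - by move=> w; rewrite tn; exact: (ensemble_at_update R0_pd xi_model).
    - by move=> w; rewrite tn; exact: (state_at_update X' recursion).
    - exact: past_indep.
    - exact: past_indep'.
    - move=> al y; apply: update_kernel => //.
        apply: (whitened_family iG (idx := fun i => inr (n, i))) => //.
          by move=> i j [].
        exact: (enkf_V xi_model).
      apply: (mean_cov_inputs_family iG' (iz := inr n) (iZ := inl (inl (inr n)))) => //.
        exact: (gi_zh inputs).
      exact: (gi_Zh inputs).
  have nW : adapted (ens_fam X Y xi cW cV) [set k | ens_time k = t.+1]
      (whitened (cW n.+1) R).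
    by apply: adapted_whitened_cW => i /=; rewrite tn.
  have nz : adapted (rec_fam X' Y' Z Zh z zh m p) [set k | rec_time k = t.+1]
      (fun w => (z n.+1 w, Z n.+1 w)).
    by apply: adapted_rec_predict; rewrite /= tn.
  apply: (@lumped_step F _ _ _ _ _ _ _ _ _ _ _ _ _ _ P P' (path2 X Y) (path2 X' Y')
    x q' (@mean_cov F d N) t (whitened (cW n.+1) R) (fun w => (z n.+1 w, Z n.+1 w))
    (ens_predict A R) (state_predict (dN : (d <= N)%N) A R)) => //.
  - apply: measurable_ens_predict; last exact: measurable_snd.
    exact: (measurableT_comp measurable_snd measurable_fst).
  - apply: measurable_state_predict; last exact: measurable_snd.
    exact: (measurableT_comp measurable_snd measurable_fst).
  - exact: adapted_measurable nW.
  - exact: adapted_measurable nz.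
  - by move=> w; rewrite tn -doubleS; exact: (ensemble_at_predict R_pd xi_model).
  - by move=> w; rewrite tn -doubleS; exact: (state_at_predict X' recursion).
  - exact: past_indep.
  - exact: past_indep'.
  - move=> al y; apply: predict_kernel => //.
      apply: (whitened_family iG (idx := fun i => inl (inr (n, i)))) => //.
        by move=> i j [].
      exact: (enkf_W xi_model).
    apply: (mean_cov_inputs_family iG' (iz := inl (inr n))
      (iZ := inl (inl (inl (inr n))))) => //.
      exact: (gi_z inputs).
    exact: (gi_Z inputs).
pose obs := seq_space ('cV[F]_d * 'cV[F]_d0)%type.
pose states := seq_space ('cV[F]_d * 'M[F]_d)%type.
(* Regroups the half-steps 2n and 2n + 1 into the six components at time n. *)
pose f (u : obs * states) :
    seq_space ('cV[F]_d * 'cV[F]_d0 * 'cV[F]_d * 'M[F]_d * 'cV[F]_d * 'M[F]_d)%type :=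
  fun n => ((u.1 n).1, (u.1 n).2, (u.2 n.*2).1, (u.2 n.*2).2,
            (u.2 n.*2.+1).1, (u.2 n.*2.+1).2).
have mf : measurable_fun setT f.
  have m1 n : measurable_fun setT (fun u : obs * states => u.1 n).
    exact: (measurableT_comp (measurable_seq_coord n) measurable_fst).
  have m2 n : measurable_fun setT (fun u : obs * states => u.2 n).
    exact: (measurableT_comp (measurable_seq_coord n) measurable_snd).
  apply/measurable_seqP => n.
  do 5!(apply: measurable_fun_pair;
    last by first [exact: (measurableT_comp measurable_snd (m1 _))
                  |exact: (measurableT_comp measurable_snd (m2 _))
                  |exact: (measurableT_comp measurable_fst (m2 _))]).
  exact: (measurableT_comp measurable_fst (m1 n)).
have /(same_law_comp mf)/same_law_sym := same_law_stopped main.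
congr same_law; apply/funext => w; apply/funext => n; rewrite /f /=.
  by rewrite /q' state_at_even state_at_odd.
by have [-> ->] := q_even n w; have [-> ->] := q_odd n w.
Qed.
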